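(* Let $0<H_1\le H_2<\infty$, $H_1H_2<H_1+H_2$, $c>0$, $\gamma_0:=H_1/H_2$, and let $V_{\gamma_0},V_+,V_-$ be the random fields on $\bar{\mathbb{R}}^2_+$ given by the stochastic integrals in the context. (i) The random fields $V_{\gamma_0}$, $V_+$, $V_-$ are well-defined for all such $H_1,H_2,c$, with the exception of $H_1=1$ for $V_+$ and $H_2=1$ for $V_-$. They have zero mean, finite variance and stationary rectangular increments. Furthermore, in the sense of equality of finite-dimensional distributions, $$V_+=\kappa^+_{H_1,H_2}\begin{cases}B_{(H_1+1)/2,\,1/2},&H_1<1,\\ B_{1,\,(1+H_2-H_2/H_1)/2},&H_1>1,\end{cases}\qquad V_-=\kappa^-_{H_1,H_2}\begin{cases}B_{1/2,\,(H_2+1)/2},&H_2<1,\\ B_{(1+H_1-H_1/H_2)/2,\,1},&H_2>1,\end{cases}$$ where $B_{\mathcal{H}_1,\mathcal{H}_2}$ denotes a fractional Brownian sheet with parameters $\mathcal{H}_1,\mathcal{H}_2$ and $\kappa^\pm_{H_1,H_2}>0$ are some constants. (ii) $V_{\gamma_0},V_+,V_-$ are operator scaling random fields: for any $\lambda>0$, in the sense of equality of finite-dimensional distributions of random fields indexed by $(x,y)\in\bar{\mathbb{R}}^2_+$, $$\{V_{\gamma_0}(\lambda x,\lambda^{\gamma_0}y)\}=\{\lambda^{H(\gamma_0)}V_{\gamma_0}(x,y)\},$$ $$\{V_+(\lambda x,\lambda^{\gamma}y)\}=\{\lambda^{H_+(\gamma)}V_+(x,y)\},\qquad \{V_-(\lambda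 x,\lambda^{\gamma}y)\}=\{\lambda^{H_-(\gamma)}V_-(x,y)\},$$ where $\gamma>0$ is arbitrary in the last two relations and $H(\gamma_0),H_+(\gamma),H_-(\gamma)$ are the exponents defined in the context. (iii) $V_{\gamma_0}$ has dependent rectangular increments, while each of $V_+$ and $V_-$ has either independent or invariant rectangular increments along one of the coordinate axes.
   Context: Notation: $\mathbb{R}^2_+=\{(x,y):x>0,y>0\}$, $\bar{\mathbb{R}}^2_+=\{(x,y):x\ge0,y\ge0\}$. ''fdd'' means finite-dimensional distributions. **The fields.** $W(du,dv)$ is a standard complex-valued Gaussian white noise on $\mathbb{R}^2$ with $\overline{W(du,dv)}=W(-du,-dv)$, zero mean, $\mathrm{E}|W(du,dv)|^2=du\,dv$; $W_1(du)$ is a standard complex-valued Gaussian white noise on $\mathbb{R}$ with $\overline{W_1(du)}=W_1(-du)$, zero mean, $\mathrm{E}|W_1(du)|^2=du$. ''Well-defined'' means that the deterministic integrands are square integrable. Let $h(u,v)=(|u|^2+c|v|^{2H_2/H_1})^{-H_1/2}$, $(u,v)\ne(0,0)$. For $(x,y)\in\bar{\mathbb{R}}^2_+$: $$V_{\gamma_0}(x,y)=\int_{\mathbb{R}^2}\frac{(1-e^{\mathrm{i}ux})(1-e^{\mathrm{i}vy})}{\mathrm{i}^2uv}\sqrt{h(u,v)}\,W(du,dv),$$ $$V_+(x,y)=\begin{cases}\int_{\mathbb{R}^2}\frac{(1-e^{\mathrm{i}ux})(1-e^{\mathrm{i}vy})}{\mathrm{i}^2uv}|u|^{-H_1/2}W(du,dv),&H_1<1,\\[2mm]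 x\,\rho_1c^{(1-H_1)/4}\int_{\mathbb{R}}\frac{1-e^{\mathrm{i}vy}}{\mathrm{i}v}|v|^{-(H_1H_2-H_2)/(2H_1)}W_1(dv),&H_1>1,\end{cases}$$ $$V_-(x,y)=\begin{cases}c^{-H_1/4}\int_{\mathbb{R}^2}\frac{(1-e^{\mathrm{i}ux})(1-e^{\mathrm{i}vy})}{\mathrm{i}^2uv}|v|^{-H_2/2}W(du,dv),&H_2<1,\\[2mm] y\,\rho_2c^{-H_1/(4H_2)}\int_{\mathbb{R}}\frac{1-e^{\mathrm{i}ux}}{\mathrm{i}u}|u|^{-(H_1H_2-H_1)/(2H_2)}W_1(du),&H_2>1,\end{cases}$$ where, with $B(\cdot,\cdot)$ the beta function, $\rho_1,\rho_2>0$, $\rho_1^2=B\big(\tfrac12,\tfrac{H_1-1}{2}\big)$ and $\rho_2^2=\tfrac{H_1}{H_2}B\big(\tfrac{H_1}{2H_2},\tfrac{H_1H_2-H_1}{2H_2}\big)$. The constants $\kappa^\pm_{H_1,H_2}$ may also depend on $c$. **Exponents.** $H_+(\gamma)=(1+\gamma+H_1)/2$ if $H_1<1$, and $H_+(\gamma)=(\gamma H_1+\gamma H_1H_2-\gamma H_2+2H_1)/(2H_1)$ if $H_1>1$. $H_-(\gamma)=(1+\gamma+\gamma H_2)/2$ if $H_2<1$, and $H_-(\gamma)=(H_2+H_1H_2-H_1+2\gamma H_2)/(2H_2)$ if $H_2>1$. $H(\gamma_0)=(H_1+H_2+H_1H_2)/(2H_2)$ (defined for $H_1\ne1$, $H_2\ne1$).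 **Fractional Brownian sheet.** For $0<\mathcal{H}_1,\mathcal{H}_2\le1$, $B_{\mathcal{H}_1,\mathcal{H}_2}$ is the zero-mean Gaussian process on $\bar{\mathbb{R}}^2_+$ with $\mathrm{E}[B_{\mathcal{H}_1,\mathcal{H}_2}(x,y)B_{\mathcal{H}_1,\mathcal{H}_2}(x',y')]=\tfrac14(x^{2\mathcal{H}_1}+x'^{2\mathcal{H}_1}-|x-x'|^{2\mathcal{H}_1})(y^{2\mathcal{H}_2}+y'^{2\mathcal{H}_2}-|y-y'|^{2\mathcal{H}_2})$. **Rectangular increments.** A rectangle is $K=K_{(u,v);(x,y)}=(u,x]\times(v,y]$ with $u<x$, $v<y$; for a RF $V$ on $\bar{\mathbb{R}}^2_+$ put $V(K)=V(x,y)-V(u,y)-V(x,v)+V(u,v)$. Two rectangles are separated by a line $\ell'$ if they lie on different sides of $\ell'$. $V$ has stationary rectangular increments if for each $(u,v)\in\mathbb{R}^2_+$ the families $\{V(K_{(u,v);(x,y)})\}$ and $\{V(K_{(0,0);(x-u,y-v)})\}$, indexed by $(x,y)$ with $x\ge u$, $y\ge v$, have the same fdd. For such $V$ with $V(x,0)=V(0,y)=0$ for all $x,y\ge0$, and a line $\ell\subset\mathbb{R}^2$ through the origin, $V$ has: (1) independent rectangular increments in direction $\ell$ if for every line $\ell'$ perpendicular to $\ell$ and any rectangles $K,K'\subset\mathbb{R}^2_+$ separated by $\ell'$, $V(K)$ and $V(K')$ are independent; (2) invariant rectangular increments in direction $\ell$ if $V(K)=V(K')$ a.s. for any rectangles $K,K'\subset\mathbb{R}^2_+$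 with $K'=K+(x,y)$ for some $(x,y)\in\ell$; (3) dependent rectangular increments in direction $\ell$ if neither (1) nor (2) holds; (4) dependent rectangular increments if (3) holds for every line $\ell$ through the origin. ''Along a coordinate axis'' means in direction $\ell$ with $\ell$ that axis. *)

(* Defs.v *)
From HB Require Import structures.
From mathcomp Require Import all_boot all_order all_algebra.
From mathcomp Require Export complex.
From mathcomp Require Export all_classical all_reals all_analysis.

Set Implicit Arguments.
Unset Strict Implicit.
Unset Printing Implicit Defensive.

Import Order.TTheory GRing.Theory Num.Theory.
Import numFieldNormedType.Exports.

Local Open Scope classical_set_scope.
Local Open Scope ring_scope.
Local Open Scope complex_scope.

(** * Gaussian families, finite-dimensional distributions, independence *)

Section probability_notions.
Context {R : realType}.

(* The library's [normal_prob m 0] is not a Dirac mass, so the degenerate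
   (almost surely constant) case is listed separately. *)
Definition gaussian_law {d : measure_display} {Omega : measurableType d}
    (P : probability Omega R) (X : Omega -> R) : Prop :=
  (exists m s : R, s != 0 /\
     forall A : set R, measurable A -> P (X @^-1` A) = normal_prob m s A)
  \/ (exists m : R, {ae P, forall w, X w = m}).

Definition gaussian_family {d : measure_display} {Omega : measurableType d}
    (P : probability Omega R) {I : Type} (D : set I) (X : I -> Omega -> R) : Prop :=
  forall (n : nat) (t : 'I_n -> I) (a : 'I_n -> R), (forall i, D (t i)) ->
    gaussian_law P (fun w => \sum_(i < n) a i * X (t i) w).

(* Equality of the finite-dimensional distributions of two families indexed by
   [D], possibly living on different probability spaces. *)
Definition fdd_eq {d d' : measure_display}
    {Omega : measurableType d} {Omega' : measurableType d'}
    (P : probability Omega R) (P' : probability Omega' R) {I : Type} (D : set I)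
    (X : I -> Omega -> R) (Y : I -> Omega' -> R) : Prop :=
  forall (n : nat) (t : 'I_n -> I) (A : set (n.-tuple R)),
    (forall i, D (t i)) -> measurable A ->
    P [set w | A [tuple X (t i) w | i < n]] =
    P' [set w | A [tuple Y (t i) w | i < n]].

Definition independent_rv {d : measure_display} {Omega : measurableType d}
    (P : probability Omega R) (X Y : Omega -> R) : Prop :=
  forall A B : set R, measurable A -> measurable B ->
    P (X @^-1` A `&` Y @^-1` B) = (P (X @^-1` A) * P (Y @^-1` B))%E.

End probability_notions.

(** * Complex Gaussian white noise and its stochastic integral *)

Definition sqnormc {R : realType} (z : R[i]) : R :=
  complex.Re z ^+ 2 + complex.Im z ^+ 2.

Section white_noise.
Context {R : realType} {dS : measure_display} {S : measurableType dS}.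
Variables (mu : {measure set S -> \bar R}) (neg : S -> S).
Context {d : measure_display} {Omega : measurableType d}.
Variable P : probability Omega R.

Definition finite_measure_set (A : set S) : Prop :=
  measurable A /\ (mu A < +oo)%E.

(* Standard complex Gaussian random measure with control measure [mu], indexed
   by the measurable sets of finite [mu]-measure, with
   [W(-A) = conj (W A)] and [E[W(A) conj (W(B))] = mu (A `&` B)].
   The last identity is the integrated form of [E|W(du)|^2 = mu(du)] and
   orthogonality over disjoint sets; it entails
   [E|W(A `|` B) - W(A) - W(B)|^2 = 0] for disjoint [A] and [B], that is, a.s.
   additivity. *)
Record white_noise (W : set S -> Omega -> R[i]) : Prop := WhiteNoise {
  wn_measurable : forall A, finite_measure_set A ->
    measurable_fun [set: Omega] (fun w => complex.Re (W A w)) /\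
    measurable_fun [set: Omega] (fun w => complex.Im (W A w)) ;
  wn_gaussian : gaussian_family P
    [set p : set S * bool | finite_measure_set p.1]
    (fun p w => if p.2 then complex.Im (W p.1 w) else complex.Re (W p.1 w)) ;
  wn_conj : forall A, finite_measure_set A ->
    {ae P, forall w, W (neg @` A) w = conjc (W A w)} ;
  wn_mean : forall A, finite_measure_set A ->
    ('E_P[fun w => complex.Re (W A w)] = 0)%E /\
    ('E_P[fun w => complex.Im (W A w)] = 0)%E ;
  wn_cov : forall A B, finite_measure_set A -> finite_measure_set B ->
    ('E_P[fun w => complex.Re (W A w * conjc (W B w))%R] = mu (A `&` B))%E /\
    ('E_P[fun w => complex.Im (W A w * conjc (W B w))%R] = 0)%E }.

Definition square_integrable (g : S -> R[i]) : Prop :=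
  [/\ measurable_fun [set: S] (fun s => complex.Re (g s)),
      measurable_fun [set: S] (fun s => complex.Im (g s)) &
      (\int[mu]_s (sqnormc (g s))%:E < +oo)%E].

Record step_fun := StepFun {
  sf_size : nat ;
  sf_coef : 'I_sf_size -> R[i] ;
  sf_set : 'I_sf_size -> set S ;
  sf_finite : forall i, finite_measure_set (sf_set i) }.

Definition step_val (f : step_fun) (s : S) : R[i] :=
  \sum_(i < sf_size f) sf_coef i * (\1_(@sf_set f i) s)%:C.

Definition step_integral (W : set S -> Omega -> R[i]) (f : step_fun)
    (w : Omega) : R[i] :=
  \sum_(i < sf_size f) sf_coef i * W (@sf_set f i) w.

(* [X] is a version of the stochastic integral of [g] against [W]: the mean
   square limit of the integrals of step functions converging to [g] in L^2.
   The integral of [g] is a.s. real when [g (neg s) = conj (g s)], as for all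
   the integrands below; hence [X] is taken real-valued. *)
Definition stochastic_integral (W : set S -> Omega -> R[i]) (g : S -> R[i])
    (X : Omega -> R) : Prop :=
  exists f : nat -> step_fun,
    (fun n => \int[mu]_s (sqnormc (step_val (f n) s - g s)%R)%:E)%E @ \oo
      --> (0 : \bar R)%E /\
    (fun n => 'E_P[fun w => sqnormc (step_integral W (f n) w - (X w)%:C)%R])%E @ \oo
      --> (0 : \bar R)%E.

Definition scaled_stochastic_integral (W : set S -> Omega -> R[i]) (a : R)
    (g : S -> R[i]) (X : Omega -> R) : Prop :=
  exists2 Z : {RV P >-> R}, stochastic_integral W g Z &
    {ae P, forall w, X w = a * Z w}.

End white_noise.


Definition white_noise1 {R : realType} {d : measure_display}
    {Omega : measurableType d} (P : probability Omega R)
    (W1 : set R -> Omega -> R[i]) : Prop :=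
  white_noise (@lebesgue_measure R) (fun u : R => - u) P W1.

Definition white_noise2 {R : realType} {d : measure_display}
    {Omega : measurableType d} (P : probability Omega R)
    (W : set (R * R) -> Omega -> R[i]) : Prop :=
  white_noise (@lebesgue_measure R \x @lebesgue_measure R)%E
    (fun p : R * R => (- p.1, - p.2)) P W.

(** * The kernels and the three random fields *)

Section fields.
Context {R : realType}.
Variables (H1 H2 c : R).

(* The notation ['i] would denote the abstract imaginary unit of [Num]. *)
Definition iC : R[i] := 0 +i* 1.

Definition expi (t : R) : R[i] := cos t +i* sin t.

(* (1 - e^{iux}) / (iu) *)
Definition ker1 (x u : R) : R[i] := (1 - expi (u * x)) / (iC * u%:C).

(* (1 - e^{iux}) (1 - e^{ivy}) / (i^2 u v) *)
Definition ker2 (x y : R) (p : R * R) : R[i] :=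
  ((1 - expi (p.1 * x)) * (1 - expi (p.2 * y))) /
  (iC ^+ 2 * p.1%:C * p.2%:C).

Definition h (p : R * R) : R :=
  (`|p.1| `^ 2 + c * `|p.2| `^ (2 * H2 / H1)) `^ (- (H1 / 2)).

Definition integrand_gamma0 (x y : R) (p : R * R) : R[i] :=
  ker2 x y p * (Num.sqrt (h p))%:C.

Definition integrand_plus_lt1 (x y : R) (p : R * R) : R[i] :=
  ker2 x y p * (`|p.1| `^ (- (H1 / 2)))%:C.

Definition integrand_plus_gt1 (y v : R) : R[i] :=
  ker1 y v * (`|v| `^ (- ((H1 * H2 - H2) / (2 * H1))))%:C.

Definition integrand_minus_lt1 (x y : R) (p : R * R) : R[i] :=
  ker2 x y p * (`|p.2| `^ (- (H2 / 2)))%:C.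

Definition integrand_minus_gt1 (x u : R) : R[i] :=
  ker1 x u * (`|u| `^ (- ((H1 * H2 - H1) / (2 * H2))))%:C.

(* The library's [beta_fun] is restricted to natural number arguments. *)
Definition betaR (a b : R) : R :=
  \int[@lebesgue_measure R]_(t in `]0, 1[) (t `^ (a - 1) * (1 - t) `^ (b - 1)).

Definition rho1 : R := Num.sqrt (betaR (1 / 2) ((H1 - 1) / 2)).

Definition rho2 : R :=
  Num.sqrt (H1 / H2 * betaR (H1 / (2 * H2)) ((H1 * H2 - H1) / (2 * H2))).

Let leb1 := @lebesgue_measure R.
Let leb2 := (@lebesgue_measure R \x @lebesgue_measure R)%E.

Definition well_defined_gamma0 : Prop :=
  forall x y : R, 0 <= x -> 0 <= y ->
    square_integrable leb2 (integrand_gamma0 x y).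

Definition well_defined_plus : Prop :=
  (H1 < 1 -> forall x y : R, 0 <= x -> 0 <= y ->
     square_integrable leb2 (integrand_plus_lt1 x y)) /\
  (1 < H1 -> forall y : R, 0 <= y ->
     square_integrable leb1 (integrand_plus_gt1 y)).

Definition well_defined_minus : Prop :=
  (H2 < 1 -> forall x y : R, 0 <= x -> 0 <= y ->
     square_integrable leb2 (integrand_minus_lt1 x y)) /\
  (1 < H2 -> forall x : R, 0 <= x ->
     square_integrable leb1 (integrand_minus_gt1 x)).

Section random_fields.
Context {d : measure_display} {Omega : measurableType d}.
Variable P : probability Omega R.
Variables (W : set (R * R) -> Omega -> R[i]) (W1 : set R -> Omega -> R[i]).

(* A random field is a family of random variables indexed by all of R x R; only
   its values on the closed first quadrant matter. *)
Definition is_V_gamma0 (V : R -> R -> {RV P >-> R}) : Prop :=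
  forall x y : R, 0 <= x -> 0 <= y ->
    stochastic_integral leb2 P W (integrand_gamma0 x y) (V x y).

Definition is_V_plus (V : R -> R -> {RV P >-> R}) : Prop :=
  forall x y : R, 0 <= x -> 0 <= y ->
    (H1 < 1 ->
       stochastic_integral leb2 P W (integrand_plus_lt1 x y) (V x y)) /\
    (1 < H1 ->
       scaled_stochastic_integral leb1 P W1 (x * rho1 * c `^ ((1 - H1) / 4))
         (integrand_plus_gt1 y) (V x y)).

Definition is_V_minus (V : R -> R -> {RV P >-> R}) : Prop :=
  forall x y : R, 0 <= x -> 0 <= y ->
    (H2 < 1 ->
       scaled_stochastic_integral leb2 P W (c `^ (- (H1 / 4)))
         (integrand_minus_lt1 x y) (V x y)) /\
    (1 < H2 ->
       scaled_stochastic_integral leb1 P W1 (y * rho2 * c `^ (- (H1 / (4 * H2))))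
         (integrand_minus_gt1 x) (V x y)).

End random_fields.

Definition H_gamma0 : R := (H1 + H2 + H1 * H2) / (2 * H2).

(* The value at [H1 = 1] is irrelevant. *)
Definition H_plus (gamma : R) : R :=
  if H1 < 1 then (1 + gamma + H1) / 2
  else (gamma * H1 + gamma * H1 * H2 - gamma * H2 + 2 * H1) / (2 * H1).

(* The value at [H2 = 1] is irrelevant. *)
Definition H_minus (gamma : R) : R :=
  if H2 < 1 then (1 + gamma + gamma * H2) / 2
  else (H2 + H1 * H2 - H1 + 2 * gamma * H2) / (2 * H2).

Definition fbs_index_plus : R * R :=
  if H1 < 1 then ((H1 + 1) / 2, 1 / 2) else (1, (1 + H2 - H2 / H1) / 2).

Definition fbs_index_minus : R * R :=
  if H2 < 1 then (1 / 2, (H2 + 1) / 2) else ((1 + H1 - H1 / H2) / 2, 1).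

End fields.

(** * Properties of random fields on the closed first quadrant *)

Section field_properties.
Context {R : realType} {d : measure_display} {Omega : measurableType d}.
Variable P : probability Omega R.

Definition quadrant : set (R * R) := [set p | 0 < p.1 /\ 0 < p.2].

Definition closed_quadrant : set (R * R) := [set p | 0 <= p.1 /\ 0 <= p.2].

Definition fractional_brownian_sheet (h1 h2 : R)
    (B : R -> R -> {RV P >-> R}) : Prop :=
  [/\ 0 < h1 <= 1, 0 < h2 <= 1,
      gaussian_family P closed_quadrant (fun p w => B p.1 p.2 w),
      (forall x y : R, 0 <= x -> 0 <= y -> ('E_P[B x y] = 0)%E) &
      forall x y x' y' : R, 0 <= x -> 0 <= y -> 0 <= x' -> 0 <= y' ->
        ('E_P[fun w => (B x y w * B x' y' w)%R] =
         (1 / 4 * (x `^ (2 * h1) + x' `^ (2 * h1) - `|x - x'| `^ (2 * h1))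
                * (y `^ (2 * h2) + y' `^ (2 * h2) - `|y - y'| `^ (2 * h2)))%R%:E)%E].

Definition zero_mean (V : R -> R -> {RV P >-> R}) : Prop :=
  forall x y : R, 0 <= x -> 0 <= y -> ('E_P[V x y] = 0)%E.

Definition finite_variance (V : R -> R -> {RV P >-> R}) : Prop :=
  forall x y : R, 0 <= x -> 0 <= y -> ('V_P[V x y] < +oo)%E.

Definition rect (u v x y : R) : set (R * R) := `]u, x] `*` `]v, y].

(* V(K) for K = rect u v x y. *)
Definition incr (V : R -> R -> {RV P >-> R}) (u v x y : R) (w : Omega) : R :=
  V x y w - V u y w - V x v w + V u v w.

Definition stationary_increments (V : R -> R -> {RV P >-> R}) : Prop :=
  forall u v : R, 0 < u -> 0 < v ->
    fdd_eq P P [set p : R * R | u <= p.1 /\ v <= p.2]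
      (fun p => incr V u v p.1 p.2)
      (fun p => incr V 0 0 (p.1 - u) (p.2 - v)).

(* Part of the setting in which the directional notions below are considered. *)
Definition null_on_axes (V : R -> R -> {RV P >-> R}) : Prop :=
  forall t : R, 0 <= t ->
    {ae P, forall w, V t 0 w = 0} /\ {ae P, forall w, V 0 t w = 0}.

(* A line through the origin is given by a direction vector [l <> (0,0)]; the
   lines perpendicular to it are {p | l.1 * p.1 + l.2 * p.2 = s}. The sides of a
   line are closed half-planes, so that the adjacent rectangles (0,1] x (0,1] and
   (1,2] x (0,1] are separated by the line of abscissa 1. *)
Definition separated (l : R * R) (s : R) (K K' : set (R * R)) : Prop :=
  (K `<=` [set p | l.1 * p.1 + l.2 * p.2 <= s] /\
   K' `<=` [set p | s <= l.1 * p.1 + l.2 * p.2]) \/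
  (K' `<=` [set p | l.1 * p.1 + l.2 * p.2 <= s] /\
   K `<=` [set p | s <= l.1 * p.1 + l.2 * p.2]).

Definition independent_increments (V : R -> R -> {RV P >-> R}) (l : R * R) : Prop :=
  forall (s u v x y u' v' x' y' : R),
    u < x -> v < y -> u' < x' -> v' < y' ->
    rect u v x y `<=` quadrant -> rect u' v' x' y' `<=` quadrant ->
    separated l s (rect u v x y) (rect u' v' x' y') ->
    independent_rv P (incr V u v x y) (incr V u' v' x' y').

Definition invariant_increments (V : R -> R -> {RV P >-> R}) (l : R * R) : Prop :=
  forall (t u v x y : R), let a := t * l.1 in let b := t * l.2 in
    u < x -> v < y ->
    rect u v x y `<=` quadrant ->
    rect (u + a) (v + b) (x + a) (y + b) `<=` quadrant ->
    {ae P, forall w, incr V u v x y w = incr V (u + a) (v + b) (x + a) (y + b) w}.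

Definition dependent_increments_dir (V : R -> R -> {RV P >-> R}) (l : R * R) : Prop :=
  ~ independent_increments V l /\ ~ invariant_increments V l.

Definition dependent_increments (V : R -> R -> {RV P >-> R}) : Prop :=
  forall l : R * R, l != (0, 0) -> dependent_increments_dir V l.

Definition along_coordinate_axis (Q : R * R -> Prop) : Prop :=
  Q (1, 0) \/ Q (0, 1).

Definition operator_scaling (V : R -> R -> {RV P >-> R}) (gamma Hexp : R) : Prop :=
  forall lambda : R, 0 < lambda ->
    fdd_eq P P closed_quadrant
      (fun p w => V (lambda * p.1) (lambda `^ gamma * p.2) w)
      (fun p w => lambda `^ Hexp * V p.1 p.2 w).

End field_properties.

(* [V = k B] in the sense of finite-dimensional distributions, where [B] is a
   fractional Brownian sheet. The law of [B] depends on its parameters only, so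
   the identity is required for every such sheet, on any probability space; the
   first conjunct excludes that this holds for lack of sheets. *)
Definition fdd_scaled_fbs {R : realType} {d : measure_display}
    {Omega : measurableType d} (P : probability Omega R)
    (V : R -> R -> {RV P >-> R}) (k : R) (h12 : R * R) : Prop :=
  (exists B : R -> R -> {RV P >-> R}, fractional_brownian_sheet h12.1 h12.2 B) /\
  forall (d' : measure_display) (Omega' : measurableType d')
    (P' : probability Omega' R) (B : R -> R -> {RV P' >-> R}),
    fractional_brownian_sheet h12.1 h12.2 B ->
    fdd_eq P P' closed_quadrant (fun p w => V p.1 p.2 w)
      (fun p w => k * B p.1 p.2 w).

(* Main.v *)
(* The three fields are centred Gaussian, so that their properties can be read off
   their covariances. As [m] is even in [u], the odd part of the product of the
   kernels integrates to zero, and the covariance is the twofold polarization of the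
   variogram [v x y = \int\int kappa x u * kappa y w * m (u, w) ^+ 2], where
   [kappa x u] is the squared modulus of [(1 - e^{iux}) / (iu)]. The substitution
   [(u, w) -> (u / s, w / t)] makes [v] homogeneous, whence the operator scaling; for
   [V_+] and [V_-] it gives [v x y = k^2 |x|^{2 h1} |y|^{2 h2}], the variogram of a
   multiple of a fractional Brownian sheet, with independent increments along an axis
   of exponent 1 and invariant increments along an axis of exponent 2. For
   [V_gamma0], the inequality [A + B >= A^{1-t} B^t] dominates [h] by a product of
   powers of exponents greater than -1. Two neighbouring squares, on a diagonal or
   antidiagonal, are separated by a line orthogonal to any given direction; the
   covariance of the increments of [V_gamma0] over them is an integral of mixed
   differences of [h], positive because [z^{-H1/2}] is strictly convex. The
   covariance of the increments over two translates of a square is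
   [\int\int kappa kappa h cos (us) cos (wt)], less than their variance, so that they
   do not coincide.
   A law on R^n is determined by the integrals of [cos (a.x + u)], because indicators
   of boxes are iterated bounded limits of trigonometric polynomials; hence equality
   of the covariances gives equality of the finite-dimensional distributions, and
   uncorrelated variables of a Gaussian family are independent. *)

Require Import Defs.
From mathcomp Require Import all_boot all_order all_algebra ring lra.
From mathcomp Require Import all_classical all_reals all_analysis.
From mathcomp Require Import measurable_realfun.

Set Implicit Arguments.
Unset Strict Implicit.
Unset Printing Implicit Defensive.

Import Order.TTheory GRing.Theory Num.Theory.
Import numFieldNormedType.Exports.

Local Open Scope classical_set_scope.
Local Open Scope ring_scope.

(** * Laws determined by trigonometric integrals *)

(** Two choices shape the development. Laws are compared through [cos (a.x + u)] alone, so that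
    every integral is real: the phase [u] carries the imaginary part of the characteristic function.
    And centred Gaussian families are handled through one predicate, [gaussian_kernel], which gives
    the transform of every finite linear combination. Variance 0 is allowed there, and combinations
    of combinations stay in the class, which covers rectangular increments, rescalings and
    differences at once. All kernels are polarizations of one function [v]; polarization is linear,
    hence commutes with the spectral integral, and identities between covariances become algebra on
    [kappa] under the integral sign. The hypothesis [H1 * H2 < H1 + H2] enters as integrability near
    the axes: it puts below 1 the exponent [H1 * H2 / (H1 + H2)] of the product dominating [h], and
    also the exponents of the one-dimensional integrals. The constants [kp] and [km] are built from
    spectral integrals that depend on [H1], [H2], [c] only, so they can be fixed before any
    probability space. *)

Lemma measurable_cos {R : realType} : measurable_fun setT (@cos R).
Proof. by apply: continuous_measurable_fun => x; exact: continuous_cos. Qed.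

Lemma cvg_norm_le {R : realType} (u : nat -> R) (l M : R) :
  (forall n, `|u n| <= M) -> u n @[n --> \oo] --> l -> `|l| <= M.
Proof.
move=> uM /cvg_norm ul.
rewrite -(cvg_lim _ ul)//; apply: limr_le; first by apply/cvg_ex; exists `|l|.
by apply: nearW => n; exact: uM.
Qed.

Section bounded_integrals.
Context {R : realType} {d : measure_display} {T : measurableType d}.

Definition bounded_meas (f : T -> R) : Prop :=
  measurable_fun setT f /\ exists M : R, forall x, `|f x| <= M.

Lemma bounded_meas_integrable (P : probability T R) (f : T -> R) :
  bounded_meas f -> P.-integrable setT (EFin \o f).
Proof.
move=> [mf [M fM]]; apply: measurable_bounded_integrable => //.
  by rewrite -ge0_fin_numE//; exact: fin_num_measure.
exists M; split; first exact: num_real.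
by move=> x Mx y _ /=; exact: le_trans (fM y) (ltW Mx).
Qed.

Lemma Rintegral_bounded_cvg (P : probability T R) (f_ : nat -> T -> R) f M :
  (forall n, measurable_fun setT (f_ n)) -> (forall n x, `|f_ n x| <= M) ->
  (forall x, f_ n x @[n --> \oo] --> f x) ->
  \int[P]_x f_ n x @[n --> \oo] --> \int[P]_x f x.
Proof.
move=> mf fM ff.
have := @dominated_cvg _ T R P setT measurableT (fun n x => (f_ n x)%:E)
  (EFin \o f) (cst M%:E).
move=> /(_ _ _ _ _ _)/= H.
have {}H : (\int[P]_x (f_ n x)%:E)%E @[n --> \oo] --> (\int[P]_x (f x)%:E)%E.
  apply: H.
  - by move=> n; apply/measurable_EFinP; exact: mf.
  - by move=> x _; apply: cvg_EFin; [exact: nearW|exact: ff].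
  - by [].
  - by apply: finite_measure_integrable_cst.
  - by move=> n x _; rewrite lee_fin.
rewrite /Rintegral; apply: fine_cvg.
rewrite fineK//.
have mlim : measurable_fun setT f.
  by apply: (measurable_fun_cvg (h := f_)) => // x _; exact: ff.
apply: integrable_fin_num => //; apply: bounded_meas_integrable; split => //.
by exists M => x; apply: cvg_norm_le (ff x) => n; exact: fM.
Qed.

End bounded_integrals.

(** With [w] the square root of [z], [n w^n] is at most the sum of the first [n] powers of [w],
    hence at most [1 / (1 - w)]; the other factor [w^n] tends to 0. *)
Lemma mulrn_expr_cvg0 {R : realType} (z : R) : 0 <= z -> z < 1 ->
  n%:R * z ^+ n @[n --> \oo] --> 0.
Proof.
move=> z0 z1; set w := Num.sqrt z.
have w0 : 0 <= w by exact: sqrtr_ge0.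
have w1 : w < 1 by rewrite -(@sqrtr1 R) ltr_sqrt.
have [w00|wn0] := eqVneq w 0.
  have z00 : z = 0 by rewrite -(sqr_sqrtr z0) -/w w00 expr0n.
  apply: cvg_near_cst; near=> n.
  have : (0 < n)%N by near: n; exists 1%N.
  by rewrite z00 expr0n; case: eqP => [->|]; rewrite ?ltnn// mulr0.
have wp : 0 < w by rewrite lt_def wn0.
have bnd n : n%:R * w ^+ n <= (1 - w)^-1.
  have nw : `|w| < 1 by rewrite ger0_norm.
  apply: le_trans (_ : series (geometric 1 w) n <= _); last first.
    by have := geometric_le_lim n (@ler01 R) wp nw; rewrite mul1r.
  rewrite /series/= big_mkord mulr_natl -[X in _ *+ X]card_ord -sumr_const.
  apply: ler_sum => i _; rewrite mul1r.
  by apply: (ler_wiXn2l w0 (ltW w1)); exact: ltnW (ltn_ord i).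
have H : geometric ((1 - w)^-1) w @ \oo --> (0 : R).
  by apply: cvg_geometric; rewrite ger0_norm.
have K : (cst 0 : nat -> R) n @[n --> \oo] --> (0 : R) by exact: cvg_cst.
apply: (squeeze_cvgr _ K H).
near=> n; rewrite mulr_ge0 ?exprn_ge0//= /geometric/=.
have -> : z ^+ n = w ^+ n * w ^+ n by rewrite -exprMn -expr2 sqr_sqrtr.
by rewrite mulrA ler_wpM2r ?exprn_ge0// bnd.
Unshelve. all: end_near. Qed.

Lemma bernoulli_ge {R : realType} (a : R) n : 0 <= a <= 1 ->
  1 - n%:R * a <= (1 - a) ^+ n.
Proof.
move=> /andP[a0 a1]; elim: n => [|n IH]; first by rewrite mul0r subr0 expr0.
rewrite exprS; apply: le_trans (_ : (1 - a) * (1 - n%:R * a) <= _); last first.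
  by rewrite ler_wpM2l// subr_ge0.
have : 0 <= n%:R * (a * a) by rewrite !mulr_ge0.
by rewrite -natr1; nra.
Qed.

(** Below one half, Bernoulli's inequality bounds the power from below by [1 - n (2y)^n]. Otherwise
    [1 - t <= exp (-t)] bounds it from above by [exp (-n (2y)^n) <= exp (-n)]. The factor [n] in the
    exponent settles [y = 1/2], where [2 ^ n] alone would give the limit [1/e]. *)
Lemma threshold_cvg {R : realType} (y : R) : 0 <= y <= 1 ->
  (1 - y ^+ n) ^+ (n * 2 ^ n) @[n --> \oo] --> ((y < 1 / 2)%R%:R : R).
Proof.
move=> /andP[y0 y1].
have yn n : 0 <= y ^+ n <= 1 by rewrite exprn_ge0//= exprn_ile1.
have sy n : 0 <= 1 - y ^+ n <= 1.
  by have := yn n => /andP[? ?]; apply/andP; split; lra.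
case: ltP => yh /=.
- have H : 1 - n%:R * (2 * y) ^+ n @[n --> \oo] --> (1 : R).
    rewrite -[X in _ --> X]subr0; apply: cvgB; first exact: cvg_cst.
    by apply: mulrn_expr_cvg0; lra.
  have K : (cst 1 : nat -> R) n @[n --> \oo] --> (1 : R) by exact: cvg_cst.
  apply: (squeeze_cvgr _ H K).
  apply: nearW => n; apply/andP; split.
    apply: le_trans (bernoulli_ge _ (yn n)).
    by rewrite natrM natrX exprMn mulrA.
  by have := sy n => /andP[? ?]; exact: exprn_ile1.
- have H : expR (-1) ^+ n @[n --> \oo] --> (0 : R).
    by apply: cvg_expr; rewrite ger0_norm ?expR_ge0// -[X in _ < X]expR0 ltr_expR; lra.
  have K : (cst 0 : nat -> R) n @[n --> \oo] --> (0 : R) by exact: cvg_cst.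
apply: (squeeze_cvgr _ K H).
  apply: nearW => n; have := sy n => /andP[s0 s1].
  rewrite exprn_ge0//=.
  apply: le_trans (_ : expR (- y ^+ n) ^+ (n * 2 ^ n) <= _).
    by rewrite lerXn2r// ?nnegrE ?expR_ge0// expR_ge1Dx.
  rewrite -!expRM_natr ler_expR natrM natrX mulN1r mulNr lerN2.
  rewrite mulrCA -exprMn -[leLHS]mulr1 ler_wpM2l//.
  by apply: exprn_ege1; lra.
Qed.

Section trigonometric_class.
Context {R : realType} {n : nat}.

(* The bounded pointwise sequential closure of the trigonometric polynomials in
   n variables. *)
Inductive trig_class : (n.-tuple R -> R) -> Prop :=
| trig_cos (a : 'I_n -> R) (u : R) :
    trig_class (fun x => cos (\sum_(i < n) a i * tnth x i + u))
| trig_add f g : trig_class f -> trig_class g -> trig_class (fun x => f x + g x)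
| trig_scale k f : trig_class f -> trig_class (fun x => k * f x)
| trig_lim (f_ : nat -> n.-tuple R -> R) f M :
    (forall k, trig_class (f_ k)) -> (forall k x, `|f_ k x| <= M) ->
    (forall x, f_ k x @[k --> \oo] --> f x) -> trig_class f.

Lemma trig_class_ext f g : trig_class f -> f =1 g -> trig_class g.
Proof. by move=> tf /funext <-. Qed.

Lemma trig_class_bounded_meas f : trig_class f -> bounded_meas f.
Proof.
elim=> {f} [a u|f g _ [mf [M fM]] _ [mg [N gN]]|k f _ [mf [M fM]]|f_ f M _ IH fM ff].
- split; last by exists 1 => x; rewrite ler_norml cos_geN1 cos_le1.
  apply: measurableT_comp; first exact: measurable_cos.
  apply: measurable_funD => //; apply: measurable_sum => i.
  by apply: measurable_funM => //; exact: measurable_tnth.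
- split; first exact: measurable_funD.
  by exists (M + N) => x; rewrite (le_trans (ler_normD _ _))// lerD.
- split; first exact: measurable_funM.
  by exists (`|k| * M) => x; rewrite normrM ler_wpM2l.
- split.
    apply: (measurable_fun_cvg (h := f_)) => [k|x _]; last exact: ff.
    by have [] := IH k.
  by exists M => x; apply: cvg_norm_le (ff x) => n'; exact: fM.
Qed.

(** Induction on [f] with [g] arbitrary and, in the cosine case, on [g]; for two cosines the
    product-to-sum formula applies. In the limit cases the bound of the other factor keeps the
    products uniformly bounded. *)
Lemma trig_class_mul f g : trig_class f -> trig_class g ->
  trig_class (fun x => f x * g x).
Proof.
move=> tf; elim: tf g => {f} [a u|f f' _ IHf _ IHf'|k f _ IHf|f_ f M _ IHf fM ff] g tg.
- elim: tg => {g} [b v|g g' _ IHg _ IHg'|k g _ IHg|g_ g M _ IHg gM gg].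
  + apply: (@trig_class_ext (fun x =>
      2^-1 * (cos (\sum_(i < n) (a i + b i) * tnth x i + (u + v)) +
              cos (\sum_(i < n) (a i - b i) * tnth x i + (u - v))))).
      by apply: trig_scale; apply: trig_add; exact: trig_cos.
    move=> x; set A := \sum_(i < n) a i * tnth x i.
    set B := \sum_(i < n) b i * tnth x i.
    have -> : \sum_(i < n) (a i + b i) * tnth x i + (u + v) = (A + u) + (B + v).
      by under eq_bigr do rewrite mulrDl; rewrite big_split/= -/A -/B; ring.
    have -> : \sum_(i < n) (a i - b i) * tnth x i + (u - v) = (A + u) - (B + v).
      under eq_bigr do rewrite mulrBl; rewrite big_split/= sumrN -/A -/B; ring.
    by rewrite cosD cosB; field.
  + by apply: trig_class_ext (trig_add IHg IHg') _ => x; rewrite mulrDr.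
  + by apply: trig_class_ext (trig_scale k IHg) _ => x; rewrite mulrCA.
  + apply: (@trig_lim _ _ M IHg) => [k x|x].
      rewrite normrM -[leRHS]mul1r ler_pM//.
      by rewrite ler_norml cos_geN1 cos_le1.
    by apply: cvgM; [exact: cvg_cst|exact: gg].
- by apply: trig_class_ext (trig_add (IHf _ tg) (IHf' _ tg)) _ => x; rewrite mulrDl.
- by apply: trig_class_ext (trig_scale k (IHf _ tg)) _ => x; rewrite mulrA.
- have [_ [N gN]] := trig_class_bounded_meas tg.
  apply: (@trig_lim _ _ (M * N) (fun k => IHf k _ tg)) => [k x|x].
    by rewrite normrM ler_pM.
  by apply: cvgM; [exact: ff|exact: cvg_cst].
Qed.

Lemma trig_class_cst k : trig_class (fun=> k).
Proof.
apply: trig_class_ext (trig_scale k (trig_cos (fun=> 0) 0)) _ => x /=.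
by rewrite big1 ?addr0 ?cos0 ?mulr1// => i _; rewrite mul0r.
Qed.

Lemma trig_class_sub f g : trig_class f -> trig_class g ->
  trig_class (fun x => f x - g x).
Proof.
move=> tf tg; apply: trig_class_ext (trig_add tf (trig_scale (-1) tg)) _ => x.
by rewrite mulN1r.
Qed.

Lemma trig_class_pow f m : trig_class f -> trig_class (fun x => f x ^+ m).
Proof.
move=> tf; elim: m => [|m IH]; first exact: trig_class_cst.
by apply: trig_class_ext (trig_class_mul tf IH) _ => x; rewrite exprS.
Qed.

(** The passage from smooth functions to indicators: the powers in [threshold_cvg] are polynomials
    in [f], hence stay in the class, and they lie between 0 and 1. *)
Lemma trig_class_threshold f : trig_class f -> (forall x, 0 <= f x <= 1) ->
  trig_class (fun x => (f x < 1 / 2)%R%:R).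
Proof.
move=> tf f01.
apply: (@trig_lim (fun k x => (1 - f x ^+ k) ^+ (k * 2 ^ k)) _ 1).
- move=> k; apply: trig_class_pow; apply: trig_class_sub.
    exact: trig_class_cst.
  exact: trig_class_pow.
- move=> k x; have /andP[f0 f1] := f01 x.
  have a0 : 0 <= 1 - f x ^+ k by rewrite subr_ge0 exprn_ile1.
  rewrite ger0_norm ?exprn_ge0// exprn_ile1// lerBlDr lerDl exprn_ge0//.
- by move=> x; apply: threshold_cvg; exact: f01.
Qed.

(** Periodicity prevents one cosine from singling out an interval. Divided by [k + 1], both
    arguments eventually lie within [pi] of 0, where the cosine decreases in the absolute value of
    its argument, and the two sides agree. The affine change brings the difference of cosines into
    [[0, 1]] with level one half. *)
Lemma cvg_intvl_cos (r t : R) : 0 < r ->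
  (((2^-1 + (cos (r / k.+1%:R) - cos (t / k.+1%:R)) / 4 < 1 / 2)%R%:R : R)
   @[k --> \oo] --> ((`|t| < r)%R%:R : R)).
Proof.
move=> r0; apply: cvg_near_cst; near=> k.
have k0 : 0 < (k.+1%:R : R) by [].
have rk : r / k.+1%:R <= pi.
  rewrite ler_pdivrMr// -ler_pdivrMl ?pi_gt0//.
  rewrite (@le_trans _ _ k%:R)// ?ler_nat//.
  by near: k; exact: nbhs_infty_ger.
have tk : `|t| / k.+1%:R <= pi.
  rewrite ler_pdivrMr// -ler_pdivrMl ?pi_gt0//.
  rewrite (@le_trans _ _ k%:R)// ?ler_nat//.
  by near: k; exact: nbhs_infty_ger.
have ct : cos (t / k.+1%:R) = cos (`|t| / k.+1%:R).
  by case: (ger0P t) => // _; rewrite mulNr cosN.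
have -> : (2^-1 + (cos (r / k.+1%:R) - cos (t / k.+1%:R)) / 4 < 1 / 2) =
          (cos (r / k.+1%:R) < cos (t / k.+1%:R)).
  by apply/idP/idP; lra.
rewrite ct ltr_cos ?in_itv/= ?rk ?tk ?divr_ge0 ?normr_ge0 ?(ltW r0)//.
by rewrite ltr_pM2r ?invr_gt0.
Unshelve. all: end_near. Qed.

Lemma trig_class_intvl i (m r : R) : 0 < r ->
  trig_class (fun x => (`|tnth x i - m| < r)%R%:R).
Proof.
move=> r0.
apply: (@trig_lim (fun k x => (2^-1 + (cos (r / k.+1%:R) -
   cos ((tnth x i - m) / k.+1%:R)) / 4 < 1 / 2)%R%:R) _ 1).
- move=> k; apply: trig_class_threshold; last first.
    move=> x; have := cos_geN1 (r / k.+1%:R); have := cos_le1 (r / k.+1%:R).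
    have := cos_geN1 ((tnth x i - m) / k.+1%:R).
    have := cos_le1 ((tnth x i - m) / k.+1%:R).
    by move=> ? ? ? ?; apply/andP; split; lra.
  apply: (@trig_class_ext (fun x => (2^-1 + cos (r / k.+1%:R) / 4) +
     (- 4^-1) * cos (\sum_(j < n) (if j == i then k.+1%:R^-1 else 0) * tnth x j
         + (- m / k.+1%:R)))).
    by apply: trig_add; [exact: trig_class_cst|apply: trig_scale; exact: trig_cos].
  move=> x; rewrite (bigD1 i)//= eqxx big1 ?addr0; last first.
    by move=> j /negbTE ->; rewrite mul0r.
  have -> : k.+1%:R^-1 * tnth x i + - m / k.+1%:R = (tnth x i - m) / k.+1%:R.
    by rewrite mulrBl mulNr mulrC.
  by field.
- by move=> k x; rewrite ger0_norm ?ler0n// lern1 leq_b1.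
- by move=> x; exact: cvg_intvl_cos.
Qed.

Definition trig_set : set (set (n.-tuple R)) := [set A | trig_class \1_A].

Lemma trig_set_sigma_algebra : sigma_algebra setT trig_set.
Proof.
have tC A : trig_set A -> trig_set (~` A).
  move=> tA; apply: trig_class_ext (trig_class_sub (trig_class_cst 1) tA) _ => x.
  by rewrite indicC indicE; case: (x \in A); rewrite ?subrr ?subr0.
have t0 : trig_set set0.
  by apply: trig_class_ext (trig_class_cst 0) _ => x; rewrite indicE in_set0.
have tI A B : trig_set A -> trig_set B -> trig_set (A `&` B).
  by move=> tA tB; apply: trig_class_ext (trig_class_mul tA tB) _ => x; rewrite indicI.
split=> //.
  by move=> A tA; rewrite setTD; exact: tC.
(* The indicator of a countable union is the pointwise limit of those of the finite unions, which
   are eventually constant at every point. *)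
move=> F tF; pose G k := \bigcup_(i < k) F i.
have tG k : trig_set (G k).
  rewrite /G; elim: k => [|k IH]; first by rewrite bigcup_mkord big_ord0.
  rewrite bigcup_mkord big_ord_recr/= -bigcup_mkord -[X in trig_set X]setCK setCU.
  by apply: (tC); apply: tI; apply: (tC).
apply: (@trig_lim (fun k => \1_(G k)) _ 1) => //.
  by move=> k x; rewrite indicE ger0_norm ?ler0n// lern1 leq_b1.
move=> x; apply: cvg_near_cst.
have [[j _ Fjx]|nF] := pselect ((\bigcup_k F k) x).
  near=> k; rewrite !indicE !mem_set//; first by exists j.
  by exists j => //=; near: k; exists j.+1.
by apply: nearW => k; rewrite !indicE !memNset// => -[j _ Fjx]; apply: nF; exists j.
Unshelve. all: end_near. Qed.

Lemma measurable_trig_set (A : set (n.-tuple R)) : measurable A -> trig_set A.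
Proof.
pose SB i := [set B : set R | trig_set ((fun x : n.-tuple R => tnth x i) @^-1` B)].
have [t0 tC tU] := trig_set_sigma_algebra.
have SBs i : sigma_algebra setT (SB i).
  split; first by rewrite /SB/= preimage_set0.
    by move=> B SBB; exact: tC.
  by move=> F SF; rewrite /SB/= preimage_bigcup; exact: tU.
have mSB i (B : set R) : measurable B -> SB i B.
  suff : (@ocitv R).-sigma.-measurable `<=` SB i by exact.
  rewrite RGenOInfty.measurableE; apply: smallest_sub => //.
  move=> _ [a ->]; have [_ _] := SBs i.
  (* The half-line is the union of the intervals with left end [a], centre [a + k + 1] and radius
     [k + 1], which are of the kind already treated. *)
  rewrite (_ : `]a, +oo[%classic = \bigcup_k [set y | `|y - (a + k.+1%:R)| < k.+1%:R]).
    apply => k.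
    apply: (trig_class_ext (trig_class_intvl i (a + k.+1%:R) (ltr0Sn R k))).
    by move=> x; rewrite indicE; congr (_%:R); congr nat_of_bool;
       apply/idP/idP; rewrite inE.
  apply/seteqP; split=> y /=; rewrite in_itv/= andbT.
    move=> ay; exists (Num.truncn (y - a)) => //=.
    have ya := truncnS_gt (y - a).
    by rewrite ltr_norml; apply/andP; split; lra.
  by move=> [k _ /=]; rewrite ltr_norml => /andP[? _]; lra.
suff : g_sigma_preimage (fun i : 'I_n => (@tnth n R)^~ i) `<=` trig_set by apply.
apply: smallest_sub; first by split.
move=> B; rewrite -bigcup_seq/= => -[i _ [C mC <-]].
by rewrite setTI; exact: mSB.
Qed.

End trigonometric_class.

(* Cramer-Wold: a law on R^n is determined by the laws of the linear forms. *)
Lemma trig_law {R : realType} {d d' : measure_display} {T : measurableType d}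
    {T' : measurableType d'} (P : probability T R) (P' : probability T' R)
    (n : nat) (X : 'I_n -> T -> R) (Y : 'I_n -> T' -> R) :
  (forall i, measurable_fun setT (X i)) -> (forall i, measurable_fun setT (Y i)) ->
  (forall a u, \int[P]_w cos (\sum_(i < n) a i * X i w + u) =
               \int[P']_w cos (\sum_(i < n) a i * Y i w + u)) ->
  forall A : set (n.-tuple R), measurable A ->
    P [set w | A [tuple X i w | i < n]] = P' [set w | A [tuple Y i w | i < n]].
Proof.
move=> mX mY XY A mA.
pose F w := [tuple X i w | i < n]; pose G w := [tuple Y i w | i < n].
have mF : measurable_fun setT F.
  apply/measurable_fun_tnthP => i; apply: eq_measurable_fun (mX i) => w _ /=.
  by rewrite tnth_mktuple.
have mG : measurable_fun setT G.
  apply/measurable_fun_tnthP => i; apply: eq_measurable_fun (mY i) => w _ /=.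
  by rewrite tnth_mktuple.
have bF f : trig_class f -> bounded_meas (f \o F).
  move=> /trig_class_bounded_meas[mf [M fM]]; split; last by exists M => w; exact: fM.
  exact: measurableT_comp.
have bG f : trig_class f -> bounded_meas (f \o G).
  move=> /trig_class_bounded_meas[mf [M fM]]; split; last by exists M => w; exact: fM.
  exact: measurableT_comp.
(* The integrals agree for a single cosine by assumption, and the agreement passes to sums,
   multiples and bounded limits. *)
have key f : trig_class f -> \int[P]_w f (F w) = \int[P']_w f (G w).
  move=> tf; elim: (tf) => {f tf} [a u|f g tf IHf tg IHg|k f tf IHf|f_ f M tf IHf fM ff].
  - have := XY a u; rewrite /F /G => XYau; rewrite -[RHS]/(Rintegral _ _ _).
    transitivity (\int[P]_w cos (\sum_(i < n) a i * X i w + u)).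
      by congr Rintegral; apply/funext => w; under eq_bigr do rewrite tnth_mktuple.
    rewrite XYau; congr Rintegral; apply/funext => w.
    by under [in RHS]eq_bigr do rewrite tnth_mktuple.
  - rewrite !RintegralD//; try (apply: bounded_meas_integrable;
       first [exact: bF|exact: bG]).
    by rewrite IHf IHg.
  - rewrite !RintegralZl//; try (apply: bounded_meas_integrable;
       first [exact: bF|exact: bG]).
    by rewrite IHf.
  - have H1 : \int[P]_w f_ k (F w) @[k --> \oo] --> \int[P]_w f (F w).
      apply: (@Rintegral_bounded_cvg _ _ _ P (fun k => f_ k \o F) (f \o F) M).
      + by move=> k; have [] := bF _ (tf k).
      + by move=> k w; exact: fM.
      + by move=> w; exact: ff.
    have H2 : \int[P']_w f_ k (G w) @[k --> \oo] --> \int[P']_w f (G w).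
      apply: (@Rintegral_bounded_cvg _ _ _ P' (fun k => f_ k \o G) (f \o G) M).
      + by move=> k; have [] := bG _ (tf k).
      + by move=> k w; exact: fM.
      + by move=> w; exact: ff.
    move: H1; under eq_fun do rewrite IHf.
    by move=> H1; exact: (cvg_unique _ H1 H2).
have mFA : measurable (F @^-1` A) by rewrite -[X in measurable X]setTI; exact: mF.
have mGA : measurable (G @^-1` A) by rewrite -[X in measurable X]setTI; exact: mG.
have := key _ (measurable_trig_set mA).
rewrite (_ : (fun w => \1_A (F w)) = \1_(F @^-1` A))//.
rewrite (_ : (fun w => \1_A (G w)) = \1_(G @^-1` A))//.
rewrite /Rintegral !integral_indic// !setIT => H.
by rewrite -[LHS]fineK ?fin_num_measure// -[RHS]fineK ?fin_num_measure// H.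
Qed.

(** * The Fourier transform of the normal law *)

Lemma measurable_sin {R : realType} : measurable_fun setT (@sin R).
Proof. by apply: continuous_measurable_fun => x; exact: continuous_sin. Qed.

Section gaussian_characteristic_function.
Context {R : realType}.
Let mu := @lebesgue_measure R.

(** The form in which integration by parts is used on the whole line: the fundamental theorem over
    [[-n, n]], with dominated convergence for the integrals and vanishing boundary values. *)
Lemma Rintegral_derivative0 (F f : R -> R) :
  (forall x : R, is_derive x 1 F (f x)) -> continuous f ->
  mu.-integrable setT (EFin \o f) ->
  F n%:R @[n --> \oo] --> (0 : R) -> F (- n%:R) @[n --> \oo] --> (0 : R) ->
  \int[mu]_x f x = 0.
Proof.
move=> dF cf intf Fp Fn.
have cF : continuous F.
  by move=> x; apply/differentiable_continuous; apply/derivable1_diffP; have [] := dF x.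
have H1 : \int[mu]_(x in `[- n%:R, n%:R]) f x @[n --> \oo] --> (0 : R).
  have H : F n%:R - F (- n%:R) @[n --> \oo] --> (0 : R).
    by rewrite -[X in _ --> X]subr0; exact: cvgB.
  apply: cvg_trans H; apply: near_eq_cvg; near=> n.
  have n0 : (0 < n)%N by near: n; exists 1%N.
  have nn : - n%:R < n%:R :> R by rewrite -subr_gt0 opprK -natrD ltr0n addn_gt0 n0.
  rewrite /Rintegral (@continuous_FTC2 _ f F _ _ nn)//.
  - by apply: continuous_subspaceT => x; exact: cf.
  - split; first by move=> x _; have [] := dF x.
      by apply: cvg_at_right_filter; exact: cF.
    by apply: cvg_at_left_filter; exact: cF.
  - by move=> x _; rewrite derive1E; have [_ ->] := dF x.
have H2 : (\int[mu]_x (((EFin \o f) \_ `[(- n%:R)%R, (n%:R)%R]%classic) x))%E @[n --> \oo] -->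
    (\int[mu]_x (f x)%:E)%E.
  apply: (@dominated_cvg _ _ _ mu setT measurableT (fun n x => ((EFin \o f) \_ `[(- n%:R)%R, (n%:R)%R]%classic) x) (EFin \o f) (fun x => `|(f x)%:E|%E)) => //.
  - move=> n; apply/(measurable_restrictT _ _).1 => //.
    by have /integrableP[/measurable_funTS] := intf.
  - move=> x _; apply: cvg_near_cst; near=> n.
    rewrite patchE mem_set//= in_itv/=.
    have : `|x| <= n%:R by near: n; exact: nbhs_infty_ger.
    by rewrite ler_norml.
  - by apply: integrable_abse.
  - by move=> n x _; rewrite patchE; case: ifP => // _; rewrite abse0.
have H3 : \int[mu]_(x in `[- n%:R, n%:R]) f x @[n --> \oo] --> \int[mu]_x f x.
  rewrite /Rintegral; apply: fine_cvg; rewrite fineK; last exact: integrable_fin_num.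
  by under eq_fun do rewrite integral_mkcond.
exact: (cvg_unique _ H3 H1).
Unshelve. all: end_near. Qed.

Lemma is_derive_ext (f g : R -> R) (x a b : R) :
  is_derive x (1 : R) f a -> f =1 g -> a = b -> is_derive x (1 : R) g b.
Proof. by move=> df /funext <- <-. Qed.

(** Half of the exponent is kept and the other half absorbs the factor: with [z = |x - m| / (2 |s|)]
    this is [2 z <= 1 + z^2 <= exp (z^2)]. It provides an integrable majorant for derivatives in
    [t], and decay at infinity. *)
Lemma normal_fun_moment (m s x : R) : s != 0 ->
  `|x - m| * normal_fun m s x <= `|s| * normal_fun m (Num.sqrt 2 * s) x.
Proof.
move=> s0; rewrite /normal_fun.
have s2 : 0 < `|s| by rewrite normr_gt0.
set y := `|x - m|.
have -> : (x - m) ^+ 2 = y ^+ 2 by rewrite real_normK// num_real.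
have -> : (Num.sqrt 2 * s) ^+ 2 = 2 * `|s| ^+ 2.
  by rewrite exprMn sqr_sqrtr// real_normK// num_real.
have -> : s ^+ 2 = `|s| ^+ 2 by rewrite real_normK// num_real.
set a := `|s| in s2 *.
have a0 : a != 0 by rewrite gt_eqF.
clearbody a y.
rewrite (_ : - y ^+ 2 / (a ^+ 2 *+ 2) =
    - y ^+ 2 / (2 * a ^+ 2 *+ 2) - (y / (2 * a)) ^+ 2); last first.
  rewrite -[a ^+ 2 *+ 2]mulr_natr -[2 * a ^+ 2 *+ 2]mulr_natr.
  by field.
rewrite expRD mulrCA [leRHS]mulrC; apply: ler_wpM2l; first exact: expR_ge0.
rewrite mulrC expRN ler_pdivrMl ?expR_gt0//.
apply: le_trans (_ : (1 + (y / (2 * a)) ^+ 2) * a <= _); last first.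
  by rewrite ler_wpM2r ?expR_ge1Dx// ltW.
rewrite [leLHS](_ : y = (y / (2 * a)) * 2 * a); last by field.
apply: ler_wpM2r; first exact: ltW.
set z := y / (2 * a); clearbody z.
have : 0 <= (z - 1) ^+ 2 by exact: sqr_ge0.
nra.
Qed.

Lemma integrable_normal_fun (m s : R) : s != 0 ->
  mu.-integrable setT (EFin \o normal_fun m s).
Proof.
move=> s0; have := integrable_normal_pdf m s; rewrite normal_pdfE// => H.
have : mu.-integrable setT (fun x : R => (normal_peak s)^-1%:E * (normal_peak s * normal_fun m s x)%:E)%E.
  exact: integrableZl.
congr (integrable _ _ _); apply/funext => x /=.
by rewrite -EFinM mulKf// gt_eqF// normal_peak_gt0.
Qed.

Lemma is_derive_affine (a b t : R) : is_derive t (1 : R) (fun t : R => t * a + b) a.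
Proof.
apply: (@is_derive_eq _ _ _ (((@id R) * cst a) + cst b)).
by rewrite /GRing.scale/= mulr0 add0r addr0 mulr1.
Qed.

Lemma is_derive_cos_affine (a b t : R) :
  is_derive t (1 : R) (fun t => cos (t * a + b)) (- a * sin (t * a + b)).
Proof.
have := @is_derive1_comp R (@cos R) (fun t => t * a + b) t _ _ (is_derive_cos (t * a + b)) (is_derive_affine a b t).
by move/is_derive_ext; apply=> //; rewrite mulNr mulrC mulNr.
Qed.

Lemma is_derive_sin_affine (a b t : R) :
  is_derive t (1 : R) (fun t => sin (t * a + b)) (a * cos (t * a + b)).
Proof.
have := @is_derive1_comp R (@sin R) (fun t => t * a + b) t _ _ (is_derive_sin (t * a + b)) (is_derive_affine a b t).
by move/is_derive_ext; apply=> //; rewrite mulrC.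
Qed.

Lemma is_derive_normal_fun (m s x : R) :
  is_derive x (1 : R) (normal_fun m s) (- (s ^- 2) * (x - m) * normal_fun m s x).
Proof.
have d1 : is_derive x (1 : R) (fun x => - (x - m) ^+ 2 / (s ^+ 2 *+ 2)) (- (s ^- 2) * (x - m)).
  apply: (@is_derive_eq _ _ _ ((- ((@id R) - cst m) ^+ 2) * cst ((s ^+ 2 *+ 2)^-1))).
  rewrite /GRing.scale/= mulr0 add0r expr1 subr0 mulr1.
  rewrite -[(id - cst m) x]/(x - m) -[s ^+ 2 *+ 2]mulr_natl invfM mulrN mulNr.
  by rewrite mulrACA mulVf// mul1r.
have := is_derive1_comp (is_derive_expR _) d1.
by move/is_derive_ext; apply=> //; rewrite mulrC.
Qed.

(** The transform [F] solves [F' t = - s^2 t F t]: differentiation under the integral brings down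
    [x - m], and integration by parts turns the result back into [F]. Hence [exp ((s t)^2 / 2) F t]
    is constant, equal to its value at 0. *)
Lemma Rintegral_normal_fun_cos (m s : R) (t u : R) : s != 0 ->
  \int[mu]_x (cos (t * (x - m) + u) * normal_fun m s x) =
  expR (- (s * t) ^+ 2 / 2) * (cos u * \int[mu]_x normal_fun m s x).
Proof.
move=> s0.
have mf : measurable_fun setT (normal_fun m s) by exact: measurable_normal_fun.
have dcos t' x : is_derive t' (1 : R) (fun t => cos (t * (x - m) + u) * normal_fun m s x)
   (- (x - m) * sin (t' * (x - m) + u) * normal_fun m s x).
  have := is_deriveM (is_derive_cos_affine (x - m) u t') (is_derive_cst (normal_fun m s x) t' (1 : R)).
  by move/is_derive_ext; apply=> //; rewrite /GRing.scale/= mulr0 add0r mulrC.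
(* An antiderivative whose derivative combines the integrand of [F] with that of the derivative of
   [F]. *)
have dsin t' x : is_derive x (1 : R) (fun x => sin (t' * (x - m) + u) * normal_fun m s x)
   (t' * cos (t' * (x - m) + u) * normal_fun m s x - s ^- 2 * ((x - m) *
      sin (t' * (x - m) + u) * normal_fun m s x)).
  have := is_deriveM (is_derive_sin_affine t' (- t' * m + u) x) (is_derive_normal_fun m s x).
  have E y : y * t' + (- t' * m + u) = t' * (y - m) + u by ring.
  move/is_derive_ext; apply=> [y|]; first by rewrite -[LHS]/(sin _ * _) E.
  by rewrite /GRing.scale/= E; ring.
have intZ r f : mu.-integrable setT (EFin \o f) ->
    \int[mu]_x (r * f x) = r * \int[mu]_x f x by exact: RintegralZl.
have intB f g : mu.-integrable setT (EFin \o f) -> mu.-integrable setT (EFin \o g) ->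
    \int[mu]_x (f x - g x) = \int[mu]_x f x - \int[mu]_x g x by exact: RintegralB.
pose F t := \int[mu]_x (cos (t * (x - m) + u) * normal_fun m s x).
have i0 := integrable_normal_fun m s0.
have mcos t' : measurable_fun setT (fun x : R => cos (t' * (x - m) + u)).
  apply: measurableT_comp; first exact: measurable_cos.
  by apply: measurable_funD => //; apply: measurable_funM => //; exact: measurable_funB.
have msin t' : measurable_fun setT (fun x : R => sin (t' * (x - m) + u)).
  apply: measurableT_comp; first exact: measurable_sin.
  by apply: measurable_funD => //; apply: measurable_funM => //; exact: measurable_funB.
have intc t' : mu.-integrable setT (EFin \o (fun x : R => cos (t' * (x - m) + u) * normal_fun m s x)).
  apply: le_integrable i0 => //.
    by apply/measurable_EFinP; apply: measurable_funM; [exact: mcos|exact: mf].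
  move=> x _; rewrite lee_fin normrM ler_piMl//.
  by rewrite ler_norml cos_geN1 cos_le1.
have i1 : mu.-integrable setT (EFin \o (fun x : R => `|s| * normal_fun m (Num.sqrt 2 * s) x)).
  have s20 : Num.sqrt 2 * s != 0 by rewrite mulf_neq0// sqrtr_eq0 -ltNge.
  have := integrableZl (measurableT) `|s| (integrable_normal_fun m s20).
  by apply: eq_integrable => // x _ /=; rewrite EFinM.
have domin t' x : `|(x - m) * sin (t' * (x - m) + u) * normal_fun m s x| <=
    `|s| * normal_fun m (Num.sqrt 2 * s) x.
  apply: le_trans (normal_fun_moment m x s0).
  rewrite !normrM (ger0_norm (normal_fun_ge0 m s x)) ler_wpM2r ?normal_fun_ge0//.
  by rewrite ler_piMr// ler_norml sin_geN1 sin_le1.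
have ints t' : mu.-integrable setT (EFin \o (fun x : R => (x - m) * sin (t' * (x - m) + u) * normal_fun m s x)).
  apply: le_integrable i1 => //.
    have mx : measurable_fun [set: R] (fun x : R => (x - m) * sin (t' * (x - m) + u) * normal_fun m s x).
      apply: measurable_funM; last exact: mf.
      by apply: measurable_funM; [exact: measurable_funB|exact: msin].
    by apply/measurable_EFinP; exact: mx.
  move=> x _ /=; rewrite lee_fin [leRHS]ger0_norm; first exact: domin.
  by rewrite mulr_ge0// normal_fun_ge0.
have dF t' : is_derive t' (1 : R) F (- \int[mu]_x ((x - m) * sin (t' * (x - m) + u) * normal_fun m s x)).
  have tI : `]t' - 1, t' + 1[%classic t' by rewrite /= in_itv/=; lra.
  have H := @derivable_under_integral R _ _ mu (fun t x : R => cos (t * (x - m) + u) * normal_fun m s x)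
    setT measurableT t' (t' - 1) (t' + 1) tI (fun x _ => intc x).
  have H' := @differentiation_under_integral R _ _ mu (fun t x : R => cos (t * (x - m) + u) * normal_fun m s x)
    setT measurableT t' (t' - 1) (t' + 1) tI (fun x _ => intc x).
  have dd x y : `]t' - 1, t' + 1[%classic x -> [set: R] y ->
     derivable (fun t : R => cos (t * (y - m) + u) * normal_fun m s y) x 1.
    by move=> _ _; have [] := dcos x y.
  have G0 y : 0 <= `|s| * normal_fun m (Num.sqrt 2 * s) y by rewrite mulr_ge0// normal_fun_ge0.
  have pd x y : (partial1of2 (fun t x : R => cos (t * (x - m) + u) * normal_fun m s x)) x y =
     - ((y - m) * sin (x * (y - m) + u) * normal_fun m s y).
    by rewrite partial1of2E; have [_ ->] := dcos x y; ring.
  have Gub x y : `]t' - 1, t' + 1[%classic x -> [set: R] y ->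
     `|(partial1of2 (fun t x : R => cos (t * (x - m) + u) * normal_fun m s x)) x y| <=
       `|s| * normal_fun m (Num.sqrt 2 * s) y.
    by move=> _ _; rewrite pd normrN.
  have {}H := H dd _ G0 i1 Gub.
  have {}H' := H' dd _ G0 i1 Gub.
  have := derivableP H; rewrite -derive1E H' => /is_derive_ext; apply=> //.
  rewrite -[RHS]mulN1r; apply: etrans (intZ (-1) _ (ints t')); apply: eq_Rintegral => x _.
  by rewrite pd mulN1r.
have IBP t' : \int[mu]_x ((x - m) * sin (t' * (x - m) + u) * normal_fun m s x) = s ^+ 2 * t' * F t'.
  have cn : continuous (normal_fun m s).
    by move=> x; apply/differentiable_continuous; apply/derivable1_diffP;
       have [] := is_derive_normal_fun m s x.
  have int' : mu.-integrable setT (EFin \o (fun x : R => t' * cos (t' * (x - m) + u) * normal_fun m s x -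
      s ^- 2 * ((x - m) * sin (t' * (x - m) + u) * normal_fun m s x))).
    have := integrableB measurableT (integrableZl measurableT t' (intc t'))
      (integrableZl measurableT (s ^- 2) (ints t')).
    by apply: eq_integrable => // x _ /=; rewrite -[in RHS]mulrA.
  have bd x : `|sin (t' * (x - m) + u) * normal_fun m s x| <= normal_fun m s x.
    rewrite normrM [X in _ * X]ger0_norm ?normal_fun_ge0// ler_piMl ?normal_fun_ge0//.
    by rewrite ler_norml sin_geN1 sin_le1.
  (* Stated for any sequence of absolute value [n], so as to serve both ends of [[-n, n]]; the
     moment bound gives decay of order [1 / |x - m|]. *)
  have tail (w : nat -> R) : (forall n, `|w n| = n%:R) ->
      sin (t' * (w n - m) + u) * normal_fun m s (w n) @[n --> \oo] --> (0 : R).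
    move=> wn; apply/cvgr0Pnorm_lt => e e0; near=> n.
    apply: le_lt_trans (bd _) _.
    have nb : `|s| / e + `|m| < n%:R by near: n; exact: nbhs_infty_gtr.
    have wm : `|s| / e < `|w n - m|.
      by have := lerB_dist (w n) m; rewrite wn; lra.
    have wm0 : 0 < `|w n - m| by apply: le_lt_trans wm; rewrite divr_ge0// ltW.
    rewrite ltr_pdivrMr// in wm.
    have := normal_fun_moment m (w n) s0 => H.
    have nf1 : normal_fun m (Num.sqrt 2 * s) (w n) <= 1.
      rewrite -[leRHS]expR0 ler_expR mulNr oppr_le0 mulr_ge0 ?sqr_ge0//.
      by rewrite invr_ge0 mulrn_wge0// sqr_ge0.
    rewrite -(ltr_pM2l wm0); apply: le_lt_trans H _; apply: le_lt_trans wm.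
    by rewrite ler_piMr.
  have := @Rintegral_derivative0 _ _ (dsin t') _ int'.
  have Tp := tail (fun n => n%:R) (fun n => normr_nat R n).
  have Tn := tail (fun n => - n%:R) (fun n => etrans (normrN _) (normr_nat R n)).
  move=> /(_ _ Tp Tn) H.
  have ic := integrableZl measurableT t' (intc t').
  have is_ := integrableZl measurableT (s ^- 2) (ints t').
  have {}H : \int[mu]_x (t' * (cos (t' * (x - m) + u) * normal_fun m s x) -
      s ^- 2 * ((x - m) * sin (t' * (x - m) + u) * normal_fun m s x)) = 0.
    rewrite -[RHS]H; first by apply: eq_Rintegral => x _; rewrite mulrA.
    move=> x; apply: cvgB.
      apply: cvgM; last exact: cn.
      apply: cvgM; first exact: cvg_cst.
      apply: (cvg_comp (fun y : R => t' * (y - m) + u) (@cos R) _ (@continuous_cos R _)).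
      apply: cvgD; last exact: cvg_cst.
      by apply: cvgM; [exact: cvg_cst|apply: cvgB; [exact: cvg_id|exact: cvg_cst]].
    apply: cvgM; first exact: cvg_cst.
    apply: cvgM; last exact: cn.
    apply: cvgM; first by apply: cvgB; [exact: cvg_id|exact: cvg_cst].
    apply: (cvg_comp (fun y : R => t' * (y - m) + u) (@sin R) _ (@continuous_sin R _)).
    apply: cvgD; last exact: cvg_cst.
    by apply: cvgM; [exact: cvg_cst|apply: cvgB; [exact: cvg_id|exact: cvg_cst]].
  have Hc : \int[mu]_x (t' * (cos (t' * (x - m) + u) * normal_fun m s x)) = t' * F t'
    by exact: intZ.
  have Hs := intZ (s ^- 2) _ (ints t').
  have := etrans (esym (intB _ _ ic is_)) H.
  rewrite Hc Hs.
  move/eqP; rewrite subr_eq0 => /eqP E.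
  by rewrite -mulrA E mulrA mulfV ?mul1r// sqrf_eq0.
pose G t := expR ((s * t) ^+ 2 / 2) * F t.
have dG t' : is_derive t' (1 : R) G 0.
  have d1 : is_derive t' (1 : R) (fun t => (s * t) ^+ 2 / 2) (s ^+ 2 * t').
    apply: (@is_derive_ext (fun t => s ^+ 2 / 2 * (t * t)) _ _ (s ^+ 2 / 2 * (t' + t'))).
    - have := @is_deriveZ R _ _ (@id R * @id R) (s ^+ 2 / 2) t' 1 _ (is_deriveM (is_derive_id t' (1:R)) (is_derive_id t' (1:R))).
      by move/is_derive_ext; apply=> //; rewrite /GRing.scale/= !mulr1.
    - by move=> y; rewrite exprMn; ring.
    - by field.
  have := is_deriveM (is_derive1_comp (is_derive_expR _) d1) (dF t').
  move/is_derive_ext; apply=> //; rewrite IBP /GRing.scale/=; ring.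
have := is_derive_0_is_cst t 0 dG.
rewrite /G mulr0 expr0n mul0r expR0 mul1r => Gt.
have -> : \int[mu]_x (cos (t * (x - m) + u) * normal_fun m s x) = F t by [].
have F0 : F 0 = cos u * \int[mu]_x normal_fun m s x.
  rewrite /F; apply: etrans (intZ (cos u) _ i0); apply: eq_Rintegral => x _.
  by rewrite mul0r add0r.
by rewrite mulNr expRN -F0 -Gt mulKf// gt_eqF// expR_gt0.
Unshelve. all: end_near. Qed.

End gaussian_characteristic_function.

(** * Normal transforms and Gaussian laws *)

Section gaussian_transform.
Context {R : realType} {d : measure_display} {T : measurableType d}.
Variable P : probability T R.

(* [X] has the characteristic function of the normal law of mean [m] and
   variance [v]; the phase [u] replaces the imaginary part. *)
Definition normal_transform (X : T -> R) (m v : R) : Prop :=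
  forall t u, \int[P]_w cos (t * X w + u) =
              expR (- (v * t ^+ 2) / 2) * cos (t * m + u).

Lemma bounded_meas_cos (X : T -> R) (t u : R) : measurable_fun setT X ->
  bounded_meas (fun w => cos (t * X w + u)).
Proof.
move=> mX; split; last by exists 1 => w; rewrite ler_norml cos_geN1 cos_le1.
apply: measurableT_comp; first exact: measurable_cos.
by apply: measurable_funD => //; exact: measurable_funM.
Qed.

Lemma Rintegral_ae_eq (f g : T -> R) : measurable_fun setT f ->
  measurable_fun setT g -> {ae P, forall w, f w = g w} ->
  \int[P]_w f w = \int[P]_w g w.
Proof.
move=> mf mg fg; rewrite /Rintegral; congr fine; apply: ae_eq_integral => //.
- exact/measurable_EFinP.
- exact/measurable_EFinP.
- by apply: filterS fg => w /= ->.
Qed.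

Lemma Rintegral_probability_cst (k : R) : \int[P]_w k = k.
Proof. transitivity (k * fine (P setT)); first exact: Rintegral_cst.
by rewrite probability_setT mulr1. Qed.

Lemma integral_normal_prob (m s : R) (f : R -> \bar R) : s != 0 ->
  (normal_prob m s : probability (measurableTypeR R) R).-integrable setT f ->
  (\int[(normal_prob m s : probability (measurableTypeR R) R)]_x f x =
   \int[lebesgue_measure]_x (f x * (normal_pdf m s x)%:E))%E.
Proof.
move=> s0 intf.
rewrite -(Radon_Nikodym_change_of_variables (normal_prob_dominates m s))//=.
have mpdf : measurable_fun setT (EFin \o normal_pdf m s).
  by apply/measurable_EFinP; exact: measurable_normal_pdf.
have mf : measurable_fun setT f by case/integrableP : intf.
apply: ae_eq_integral => //.
- apply: emeasurable_funM => //; apply: (measurable_int lebesgue_measure).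
  by apply: Radon_Nikodym_integrable; exact: normal_prob_dominates.
- by apply: emeasurable_funM.
- apply: ae_eqe_mul2l => /=.
  rewrite Radon_NikodymE//=; first exact: normal_prob_dominates.
  move=> abmu.
  case: cid => /= h [h1 h2 h3].
  apply: integral_ae_eq => //=.
  by move=> E E01 mE; rewrite -h3.
Qed.

Lemma normal_prob_transform (X : T -> R) (m s : R) : measurable_fun setT X ->
  s != 0 -> (forall A, measurable A -> P (X @^-1` A) = normal_prob m s A) ->
  normal_transform X m (s ^+ 2).
Proof.
move=> mX s0 PX t u.
have mc : measurable_fun setT (fun x : R => cos (t * x + u)).
  apply: measurableT_comp; first exact: measurable_cos.
  by apply: measurable_funD => //; exact: measurable_funM.
have mpdf := measurable_normal_pdf m s.
pose f := fun x : R => (cos (t * x + u))%:E.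
pose N : probability (measurableTypeR R) R := normal_prob m s.
have E1 : (\int[P]_w f (X w) = \int[N]_x f x)%E.
  have mX' : @measurable_fun _ _ T (measurableTypeR R) setT X by exact: mX.
  pose X' : {RV P >-> measurableTypeR R} := @mfun_Sub _ _ T (measurableTypeR R) X (mem_set mX').
  transitivity (\int[distribution P X']_x f x)%E.
    rewrite integral_distribution//.
      exact/measurable_EFinP.
    by apply: bounded_meas_integrable; exact: bounded_meas_cos.
  by apply: eq_measure_integral => A mA _; exact: PX.
have intf : N.-integrable setT f.
  apply: bounded_meas_integrable; split; first exact: mc.
  by exists 1 => w; rewrite ler_norml cos_geN1 cos_le1.
rewrite [LHS]/Rintegral E1 integral_normal_prob//.
rewrite -[LHS]/(\int[lebesgue_measure]_x (cos (t * x + u) * normal_pdf m s x)).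
have E2 x : cos (t * x + u) * normal_pdf m s x =
    normal_peak s * (cos (t * (x - m) + (t * m + u)) * normal_fun m s x).
  rewrite normal_pdfE// mulrCA; congr (_ * (cos _ * _)); ring.
under eq_Rintegral do rewrite E2.
have i0 := integrable_normal_fun m s0.
have mc' : measurable_fun setT (fun x : R => cos (t * (x - m) + (t * m + u)) * normal_fun m s x).
  apply: measurable_funM; last exact: measurable_normal_fun.
  apply: measurableT_comp; first exact: measurable_cos.
  by apply: measurable_funD => //; apply: measurable_funM => //; exact: measurable_funB.
have i1 : lebesgue_measure.-integrable setT
    (EFin \o (fun x : R => cos (t * (x - m) + (t * m + u)) * normal_fun m s x)).
  apply: le_integrable i0 => //; first by apply/measurable_EFinP; exact: mc'.
  move=> x _; rewrite lee_fin normrM ler_piMl//.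
  by rewrite ler_norml cos_geN1 cos_le1.
have H1 := RintegralZl (normal_peak s) measurableT i1.
have H0 := RintegralZl (normal_peak s) measurableT i0.
rewrite H1 Rintegral_normal_fun_cos//.
have {}H0 : normal_peak s * \int[lebesgue_measure]_x normal_fun m s x = 1.
  rewrite -H0 /Rintegral -[RHS]/(fine 1%E) -(integral_normal_pdf m s).
  by rewrite normal_pdfE.
rewrite mulrCA; congr (_ * _); first by rewrite exprMn.
by rewrite mulrCA H0 mulr1.
Qed.

(** The almost surely constant case of [gaussian_law] appears here as variance 0. *)
Lemma gaussian_law_transform (X : T -> R) : measurable_fun setT X ->
  gaussian_law P X -> exists m v, 0 <= v /\ normal_transform X m v.
Proof.
move=> mX [[m [s [s0 PX]]]|[m Xm]].
  by exists m, (s ^+ 2); split; [exact: sqr_ge0|exact: normal_prob_transform].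
exists m, 0; split=> // t u; rewrite mul0r oppr0 mul0r expR0 mul1r.
rewrite -[RHS]Rintegral_probability_cst; apply: Rintegral_ae_eq => //.
  by have [] := bounded_meas_cos t u mX.
by apply: filterS Xm => w ->.
Qed.

End gaussian_transform.

Lemma law_determined {R : realType} {d d' : measure_display} {T : measurableType d}
    {T' : measurableType d'} (P : probability T R) (P' : probability T' R)
    (X : T -> R) (Y : T' -> R) :
  measurable_fun setT X -> measurable_fun setT Y ->
  (forall t u, \int[P]_w cos (t * X w + u) = \int[P']_w cos (t * Y w + u)) ->
  forall A : set R, measurable A -> P (X @^-1` A) = P' (Y @^-1` A).
Proof.
move=> mX mY XY A mA.
pose B : set (1.-tuple R) := (fun x => tnth x ord0) @^-1` A.
have mB : measurable B by rewrite -[B]setTI; exact: measurable_tnth.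
have := @trig_law R _ _ T T' P P' 1 (fun=> X) (fun=> Y) (fun=> mX) (fun=> mY) _ B mB.
have E S (Z : S -> R) : [set w | B [tuple Z w | i < 1]] = Z @^-1` A.
  by apply/seteqP; split=> w; rewrite /B/= tnth_mktuple.
rewrite !E; apply=> a u.
under eq_Rintegral do rewrite big_ord1.
by under [RHS]eq_Rintegral do rewrite big_ord1; exact: XY.
Qed.

(** A transform with [v = 0] is that of the constant [m], so the complement of [m] has probability
    0. For [v > 0] the comparison is with the identity under the normal law of standard deviation
    [sqrt v]. *)
Lemma transform_gaussian_law {R : realType} {d : measure_display}
    {T : measurableType d} (P : probability T R) (X : T -> R) (m v : R) :
  measurable_fun setT X -> 0 <= v -> normal_transform P X m v -> gaussian_law P X.
Proof.
move=> mX; rewrite le_eqVlt => /predU1P[<- X0|v0 Xv].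
  right; exists m.
  have := @law_determined _ _ _ _ _ P P X (cst m) mX (measurable_cst _) _
    (~` [set m]) (measurableC (measurable_set1 _)).
  have -> : (cst m : T -> R) @^-1` (~` [set m]) = set0.
    by apply/seteqP; split=> w //=; apply.
  rewrite measure0 => H; exists (X @^-1` (~` [set m])); split.
  - by rewrite -[X in measurable X]setTI; apply: mX => //; exact: measurableC.
  - apply: H => t u; rewrite X0 mul0r oppr0 mul0r expR0 mul1r.
    by rewrite /cst Rintegral_probability_cst.
  - by move=> w /=.
left; exists m, (Num.sqrt v); split; first by rewrite sqrtr_eq0 -ltNge.
have s0 : Num.sqrt v != 0 by rewrite sqrtr_eq0 -ltNge.
move=> A mA.
pose N : probability (measurableTypeR R) R := normal_prob m (Num.sqrt v).
have mid : measurable_fun setT (idfun : measurableTypeR R -> R) by exact: measurable_id.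
rewrite (@law_determined _ _ _ _ _ P N X idfun mX mid)// => t u.
rewrite Xv (@normal_prob_transform _ _ _ N idfun m (Num.sqrt v) mid s0)//.
by rewrite sqr_sqrtr// ltW.
Qed.

(** * Mean and variance recovered from the transform *)

Section moments.
Context {R : realType}.

Lemma norm_sin_le (x : R) : `|sin x| <= `|x|.
Proof.
wlog x0 : x / 0 <= x.
  move=> H; case: (leP 0 x) => [|x0]; first exact: H.
  by rewrite -normrN -sinN -[leRHS]normrN; apply: H; rewrite oppr_ge0 ltW.
move: x0; rewrite le_eqVlt => /predU1P[<-|x0]; first by rewrite sin0.
have [c _] := @MVT R sin cos 0 x x0 (fun y _ => is_derive_sin y)
  (continuous_subspaceT (@continuous_sin R)).
rewrite sin0 !subr0 => ->; rewrite normrM ler_piMl//.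
by rewrite ler_norml cos_geN1 cos_le1.
Qed.

Lemma cvgn_ext (f g : nat -> R) (l : R) :
  f n @[n --> \oo] --> l -> f =1 g -> g n @[n --> \oo] --> l.
Proof. by move=> + /funext <-. Qed.

(** By the derivative of the sine at 0. These rescaled sines are bounded substitutes for [x]: they
    are dominated by [|x|], and their integrals are values of the transform. *)
Lemma mulrn_sin_cvg (x : R) : n.+1%:R * sin (x / n.+1%:R) @[n --> \oo] --> x.
Proof.
have [->|x0] := eqVneq x 0.
  by under eq_fun do rewrite mul0r sin0 mulr0; exact: cvg_cst.
have [d1 d2] := @is_derive_sin R 0.
have H : h^-1 * sin h @[h --> 0^'] --> (1 : R).
  rewrite -(@cos0 R) -d2.
  move: d1; rewrite /derivable /derive => /cvg_ex[l Hl].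
  rewrite (cvg_lim _ Hl)//.
  suff -> : (fun h : R => h^-1 * sin h) = (fun h => h^-1 *: ((sin \o shift 0) (h *: (1 : R)) - sin 0)) by [].
  by apply/funext => h /=; rewrite /GRing.scale/= mulr1 addr0 sin0 subr0.
have /cvgr_dnbhsP/(_ (fun n => x / n.+1%:R)) := H.
have c0 : x / n.+1%:R @[n --> \oo] --> (0 : R).
  rewrite -[X in _ --> X](mulr0 x); apply: cvgM; first exact: cvg_cst.
  exact: cvg_harmonic.
move=> /(_ (conj _ c0)) H'.
have {}H' : (x / n.+1%:R)^-1 * sin (x / n.+1%:R) @[n --> \oo] --> (1 : R).
  by apply: H' => n; rewrite mulf_neq0// invr_eq0 pnatr_eq0.
have : x * ((x / n.+1%:R)^-1 * sin (x / n.+1%:R)) @[n --> \oo] --> x.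
  by rewrite -[X in _ --> X]mulr1; apply: cvgM => //; exact: cvg_cst.
move/cvgn_ext; apply=> n /=.
by rewrite invf_div mulrA mulrCA mulfV// mulr1.
Qed.

Lemma mulrn_sin_norm_le (x : R) n : `|n.+1%:R * sin (x / n.+1%:R)| <= `|x|.
Proof.
rewrite normrM ger0_norm// mulrC -ler_pdivlMr//.
by apply: le_trans (norm_sin_le _) _; rewrite normrM normfV (@ger0_norm _ n.+1%:R).
Qed.

(** With [N] the square of [n + 1], the sequence is squeezed between [v / (1 + v / N)] and [v],
    since [z / (1 + z) <= 1 - exp (-z) <= z]. *)
Lemma expR_sq_cvg (v : R) : 0 <= v ->
  n.+1%:R ^+ 2 * (1 - expR (- (v / n.+1%:R ^+ 2))) @[n --> \oo] --> v.
Proof.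
move=> v0.
have c0 : v / n.+1%:R ^+ 2 @[n --> \oo] --> (0 : R).
  have H : (n.+1%:R ^-1 : R) @[n --> \oo] --> (0 : R) by exact: cvg_harmonic.
  have : v * (n.+1%:R^-1 * n.+1%:R^-1 : R) @[n --> \oo] --> v * (0 * 0).
    by apply: cvgM; [exact: cvg_cst|exact: cvgM].
  rewrite !mulr0; move/cvgn_ext; apply=> n /=.
  by rewrite -invfM -expr2.
have cl : v / (1 + v / n.+1%:R ^+ 2) @[n --> \oo] --> v.
  rewrite -[X in _ --> X]divr1; apply: cvgM; first exact: cvg_cst.
  apply: cvgV; first exact: oner_neq0.
  rewrite -[X in _ --> X]addr0; apply: cvgD => //; exact: cvg_cst.
have K : (cst v : nat -> R) n @[n --> \oo] --> v by exact: cvg_cst.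
apply: (squeeze_cvgr _ cl K); apply: nearW => n /=.
have n0 : 0 < n.+1%:R ^+ 2 :> R by rewrite exprn_gt0.
set N := n.+1%:R ^+ 2 in n0 *.
have z0 : 0 <= v / N by rewrite divr_ge0// ltW.
set z := v / N in z0 *.
have vE : v = N * z by rewrite /z mulrCA mulfV ?mulr1// gt_eqF.
rewrite [X in X / _]vE [X in _ <= _ <= X]vE -mulrA !ler_pM2l//; apply/andP; split.
  have : expR (- z) <= (1 + z)^-1.
    by rewrite expRN lef_pV2 ?expR_ge1Dx// posrE ?expR_gt0//; lra.
  have -> : z / (1 + z) = 1 - (1 + z)^-1 by field; rewrite gt_eqF//; lra.
  lra.
have := expR_ge1Dx (- z); lra.
Qed.

Context {d : measure_display} {T : measurableType d}.
Variable P : probability T R.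

Lemma normal_transform_sin (X : T -> R) (m v t : R) : normal_transform P X m v ->
  \int[P]_w sin (t * X w) = expR (- (v * t ^+ 2) / 2) * sin (t * m).
Proof.
move=> /(_ t (- (pi / 2))); rewrite cosBpihalf => <-.
by apply: eq_Rintegral => w _; rewrite cosBpihalf.
Qed.

Lemma Rintegral_dominated_cvg (f_ : nat -> T -> R) f g :
  (forall n, measurable_fun setT (f_ n)) -> P.-integrable setT (EFin \o g) ->
  (forall n x, `|f_ n x| <= g x) -> P.-integrable setT (EFin \o f) ->
  (forall x, f_ n x @[n --> \oo] --> f x) ->
  \int[P]_x f_ n x @[n --> \oo] --> \int[P]_x f x.
Proof.
move=> mf ig fg intf ff.
have H : (\int[P]_x (f_ n x)%:E)%E @[n --> \oo] --> (\int[P]_x (f x)%:E)%E.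
  apply: (@dominated_cvg _ _ _ P setT measurableT (fun n x => (f_ n x)%:E)
    (EFin \o f) (EFin \o g)) => //.
  - by move=> n; apply/measurable_EFinP; exact: mf.
  - by move=> x _; apply: cvg_EFin; [exact: nearW|exact: ff].
  - by move=> n x _; rewrite lee_fin.
by rewrite /Rintegral; apply: fine_cvg; rewrite fineK//; exact: integrable_fin_num.
Qed.

(** Dominated convergence for [N sin (X / N)] with [N = n + 1], whose mean is
    [exp (- v / (2 N^2)) N sin (m / N)]. *)
Lemma normal_transform_mean (X : T -> R) (m v : R) : measurable_fun setT X ->
  normal_transform P X m v -> P.-integrable setT (EFin \o X) -> \int[P]_w X w = m.
Proof.
move=> mX Xmv iX.
have mS n : measurable_fun setT (fun w => n.+1%:R * sin (X w / n.+1%:R)).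
  apply: measurable_funM => //; apply: measurableT_comp; first exact: measurable_sin.
  exact: measurable_funM.
have H := @Rintegral_dominated_cvg (fun n w => n.+1%:R * sin (X w / n.+1%:R)) X
  (fun w => `|X w|) mS (integrable_norm iX) (fun n w => mulrn_sin_norm_le (X w) n) iX
  (fun w => @mulrn_sin_cvg (X w)).
have E n : \int[P]_w (n.+1%:R * sin (X w / n.+1%:R)) =
    expR (- (v * n.+1%:R ^- 2) / 2) * (n.+1%:R * sin (m / n.+1%:R)).
  rewrite RintegralZl//; last first.
    apply: bounded_meas_integrable; split.
      apply: measurableT_comp; first exact: measurable_sin.
      exact: measurable_funM.
    by exists 1 => w; rewrite ler_norml sin_geN1 sin_le1.
  under eq_Rintegral do rewrite mulrC.
  by rewrite (normal_transform_sin _ Xmv) mulrCA exprVn [m / _]mulrC.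
have K : expR (- (v * n.+1%:R ^- 2) / 2) * (n.+1%:R * sin (m / n.+1%:R)) @[n --> \oo] --> m.
  rewrite -[X in _ --> X]mul1r; apply: cvgM; last exact: mulrn_sin_cvg.
  have e0 : expR (- (v * (n.+1%:R^-1 * n.+1%:R^-1)) / 2) @[n --> \oo] --> expR (- (v * (0 * 0)) / 2).
    apply: (cvg_comp _ expR); last exact: continuous_expR.
    apply: cvgM; last exact: cvg_cst.
    apply: cvgN; apply: cvgM; first exact: cvg_cst.
    by apply: cvgM; exact: cvg_harmonic.
  move: e0; rewrite !mulr0 oppr0 mul0r expR0; move/cvgn_ext; apply=> n /=.
  by rewrite -invfM -expr2.
move: H; under eq_fun do rewrite E.
by move=> H; exact: (cvg_unique _ H K).
Qed.

(** The squared sine is affine in the cosine of the doubled angle, so that with [N = n + 1] the mean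
    of [(N sin (X / N))^2] is [N^2 (1 - exp (-2 v / N^2)) / 2], which tends to [v]. *)
Lemma normal_transform_var (X : T -> R) (v : R) : measurable_fun setT X -> 0 <= v ->
  normal_transform P X 0 v -> P.-integrable setT (EFin \o (fun w => X w ^+ 2)) ->
  \int[P]_w X w ^+ 2 = v.
Proof.
move=> mX v0 X0v iX.
pose S n (x : R) := n.+1%:R * sin (x / n.+1%:R).
have mS n : measurable_fun setT (fun w => S n (X w) ^+ 2).
  apply: measurable_funX; apply: measurable_funM => //; apply: measurableT_comp; first exact: measurable_sin.
  exact: measurable_funM.
have H := @Rintegral_dominated_cvg (fun n w => S n (X w) ^+ 2) (fun w => X w ^+ 2)
  (fun w => X w ^+ 2) mS iX _ iX.
have {}H : \int[P]_w S n (X w) ^+ 2 @[n --> \oo] --> \int[P]_w X w ^+ 2.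
  apply: H => [n w|w].
    rewrite ger0_norm ?sqr_ge0// -[leLHS]real_normK ?num_real// -[leRHS]real_normK ?num_real//.
    by apply: lerXn2r; rewrite ?nnegrE//; exact: mulrn_sin_norm_le.
  by rewrite expr2; under eq_fun do rewrite expr2; apply: cvgM; exact: mulrn_sin_cvg.
have E n : \int[P]_w S n (X w) ^+ 2 = n.+1%:R ^+ 2 * (1 - expR (- ((2 * v) / n.+1%:R ^+ 2))) / 2.
  have sE x : S n x ^+ 2 = n.+1%:R ^+ 2 / 2 * (1 - cos (2 / n.+1%:R * x + 0)).
    rewrite addr0 /S exprMn; have := cos_mulr2n (x / n.+1%:R).
    have -> : (x / n.+1%:R) *+ 2 = 2 / n.+1%:R * x by rewrite -mulr_natl mulrCA mulrC.
    by move=> ->; rewrite cos2sin2; field.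
  under eq_Rintegral do rewrite sE.
  have ic : P.-integrable setT (EFin \o (fun w => cos (2 / n.+1%:R * X w + 0))).
    by apply: bounded_meas_integrable; exact: bounded_meas_cos.
  have i1 : P.-integrable setT (EFin \o (fun=> 1 : R)).
    apply: bounded_meas_integrable; split; first exact: measurable_cst.
    by exists 1 => w; rewrite normr1.
  have ib : P.-integrable setT (EFin \o (fun w => 1 - cos (2 / n.+1%:R * X w + 0))).
    by have := integrableB measurableT i1 ic; apply: eq_integrable.
  rewrite RintegralZl// RintegralB// Rintegral_probability_cst X0v.
  rewrite mulr0 addr0 cos0 mulr1 mulrAC; congr (_ * (1 - expR _) / _).
  by field.
have K : n.+1%:R ^+ 2 * (1 - expR (- ((2 * v) / n.+1%:R ^+ 2))) / 2 @[n --> \oo] --> v.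
  have v20 : 0 <= 2 * v by rewrite mulr_ge0.
  have K0 := expR_sq_cvg v20.
  have K1 : n.+1%:R ^+ 2 * (1 - expR (- ((2 * v) / n.+1%:R ^+ 2))) / 2 @[n --> \oo] --> 2 * v / 2.
    by apply: cvgM; [exact: K0|exact: cvg_cst].
  by rewrite [X in _ --> X](_ : v = 2 * v / 2) //; field.
move: H; under eq_fun do rewrite E.
by move=> H; exact: (cvg_unique _ H K).
Qed.

End moments.

(** * Gaussian families with a given covariance *)

Section square_integrable_variables.
Context {R : realType} {d : measure_display} {T : measurableType d}.
Variable P : probability T R.

Definition sq_integrable (X : T -> R) : Prop :=
  measurable_fun setT X /\ P.-integrable setT (EFin \o (fun w => X w ^+ 2)).

Lemma sq_integrable_mul (X Y : T -> R) : sq_integrable X -> sq_integrable Y ->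
  P.-integrable setT (EFin \o (fun w => X w * Y w)).
Proof.
move=> [mX iX] [mY iY].
apply: le_integrable (integrableD measurableT iX iY) => //.
  by apply/measurable_EFinP; exact: measurable_funM.
move=> w _ /=; rewrite lee_fin [leRHS]ger0_norm ?addr_ge0 ?sqr_ge0// normrM.
rewrite -[X in _ <= X + _]real_normK ?num_real// -[X in _ <= _ + X]real_normK ?num_real//.
have : 0 <= (`|X w| - `|Y w|) ^+ 2 by exact: sqr_ge0.
have : 0 <= `|X w| by []; have : 0 <= `|Y w| by [].
nra.
Qed.

Lemma sq_integrable_cst (k : R) : sq_integrable (fun=> k).
Proof.
split; first exact: measurable_cst.
apply: bounded_meas_integrable; split; first exact: measurable_cst.
by exists `|k ^+ 2|.
Qed.

Lemma sq_integrable_integrable (X : T -> R) : sq_integrable X ->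
  P.-integrable setT (EFin \o X).
Proof.
move=> /sq_integrable_mul/(_ (sq_integrable_cst 1)).
by apply: eq_integrable => // w _ /=; rewrite mulr1.
Qed.

Lemma sq_integrableD (X Y : T -> R) : sq_integrable X -> sq_integrable Y ->
  sq_integrable (fun w => X w + Y w).
Proof.
move=> X2 Y2; split; first by apply: measurable_funD; [case: X2|case: Y2].
have := sq_integrable_mul X2 Y2.
have [_ iX] := X2; have [_ iY] := Y2 => iXY.
have := integrableD measurableT (integrableD measurableT iX iY)
  (integrableD measurableT iXY iXY).
by apply: eq_integrable => // w _ /=; rewrite -!EFinD; congr EFin; ring.
Qed.

Lemma sq_integrableZ (k : R) (X : T -> R) : sq_integrable X ->
  sq_integrable (fun w => k * X w).
Proof.
move=> [mX iX]; split; first exact: measurable_funM.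
have := integrableZl measurableT (k ^+ 2) iX.
by apply: eq_integrable => // w _ /=; rewrite -EFinM exprMn.
Qed.

Lemma sq_integrable_ext (X Y : T -> R) : sq_integrable X -> X =1 Y -> sq_integrable Y.
Proof. by move=> + /funext <-. Qed.

Lemma sq_integrable_ae (X Y : T -> R) : sq_integrable X -> measurable_fun setT Y ->
  {ae P, forall w, X w = Y w} -> sq_integrable Y.
Proof.
move=> [mX iX] mY XY; split=> //.
have mY2 : measurable_fun setT (EFin \o (fun w => Y w ^+ 2)).
  by apply/measurable_EFinP; exact: measurable_funX.
have mX2 : measurable_fun setT (EFin \o (fun w => X w ^+ 2)).
  by apply/measurable_EFinP; exact: measurable_funX.
apply/integrableP; split=> //; move/integrableP : iX => [_].
rewrite (@ae_eq_integral _ _ _ P setT (fun w => `|(Y w ^+ 2)%R%:E|%E))//.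
- exact: measurableT_comp.
- exact: measurableT_comp.
- by apply: filterS XY => w /= ->.
Qed.

End square_integrable_variables.

Section linear_combinations.
Context {R : realType} {T : Type}.

(** Formal combinations are lists of weighted indices: a combination of combinations is then again
    one, by [lincomb_flatten]. *)
Definition lincomb {I : Type} (s : seq (R * I)) (X : I -> T -> R) (w : T) : R :=
  \sum_(p <- s) p.1 * X p.2 w.

Definition quad_form {I : Type} (K : I -> I -> R) (s : seq (R * I)) : R :=
  \sum_(p <- s) \sum_(q <- s) p.1 * q.1 * K p.2 q.2.

(** The covariance of the combinations [L j] and [L k] when [K] is that of the underlying family. *)
Definition lincomb_kernel {I J : Type} (L : J -> seq (R * I)) (K : I -> I -> R)
    (j k : J) : R :=
  \sum_(p <- L j) \sum_(q <- L k) p.1 * q.1 * K p.2 q.2.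

Definition lincomb_flatten {I J : Type} (L : J -> seq (R * I)) (s : seq (R * J)) :
    seq (R * I) :=
  flatten [seq [seq (p.1 * q.1, q.2) | q <- L p.2] | p <- s].

Lemma big_lincomb_flatten {I J : Type} (L : J -> seq (R * I)) (s : seq (R * J))
    (F : R * I -> R) :
  \sum_(r <- lincomb_flatten L s) F r =
  \sum_(p <- s) \sum_(q <- L p.2) F (p.1 * q.1, q.2).
Proof.
rewrite big_flatten big_map; apply: eq_bigr => p _; exact: big_map.
Qed.

Lemma lincomb_flattenE {I J : Type} (L : J -> seq (R * I)) (s : seq (R * J))
    (X : I -> T -> R) (w : T) :
  lincomb (lincomb_flatten L s) X w = lincomb s (fun j => lincomb (L j) X) w.
Proof.
rewrite /lincomb big_lincomb_flatten; apply: eq_bigr => p _.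
by rewrite big_distrr; apply: eq_bigr => q _; rewrite /= mulrA.
Qed.

Lemma quad_form_flatten {I J : Type} (L : J -> seq (R * I)) (s : seq (R * J))
    (K : I -> I -> R) :
  quad_form K (lincomb_flatten L s) = quad_form (lincomb_kernel L K) s.
Proof.
rewrite /quad_form big_lincomb_flatten; apply: eq_bigr => p _.
under eq_bigr do rewrite big_lincomb_flatten.
rewrite exchange_big/=; apply: eq_bigr => q _.
rewrite /lincomb_kernel big_distrr/=.
apply: eq_bigr => a _; rewrite big_distrr/=.
by apply: eq_bigr => b _; ring.
Qed.

End linear_combinations.

(** * Centred Gaussian families described by their covariance *)

Section gaussian_kernels.
Context {R : realType}.

(** A centred Gaussian family with covariance [K]. The transforms see [K] only through its quadratic
    form, that is, up to an antisymmetric part; statements about a single entry therefore assume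
    symmetry or speak of both [K i j] and [K j i]. Square integrability is what lets moments be read
    off the transforms. *)
Record gaussian_kernel {d : measure_display} {T : measurableType d}
    (P : probability T R) {I : Type} (X : I -> T -> R) (K : I -> I -> R) : Prop :=
  GaussianKernel {
    gk_sq : forall i, sq_integrable P (X i) ;
    gk_transform : forall s u, \int[P]_w cos (lincomb s X w + u) =
                               expR (- quad_form K s / 2) * cos u }.

Lemma gk_meas {d : measure_display} {T : measurableType d} (P : probability T R)
  {I : Type} (X : I -> T -> R) K i : gaussian_kernel P X K ->
  measurable_fun setT (X i).
Proof. by move=> [/(_ i)[]]. Qed.

Context {d : measure_display} {T : measurableType d}.
Variable P : probability T R.

Lemma gk_normal_transform {I : Type} (X : I -> T -> R) K s : gaussian_kernel P X K ->
  normal_transform P (lincomb s X) 0 (quad_form K s).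
Proof.
move=> [_ XK] t u; rewrite mulr0 add0r.
have := XK [seq (t * p.1, p.2) | p <- s] u.
have -> : quad_form K [seq (t * p.1, p.2) | p <- s] = quad_form K s * t ^+ 2.
  rewrite /quad_form big_map mulr_suml; apply: eq_bigr => p _.
  by rewrite big_map mulr_suml; apply: eq_bigr => q _ /=; ring.
move=> <-; apply: eq_Rintegral => w _; congr (cos (_ + _)).
by rewrite /lincomb big_map mulr_sumr; apply: eq_bigr => p _; rewrite /= mulrA.
Qed.

Lemma lincomb1 {I : Type} (X : I -> T -> R) a i w : lincomb [:: (a, i)] X w = a * X i w.
Proof. by rewrite /lincomb big_seq1. Qed.

Lemma lincomb_sq_integrable {I : Type} (X : I -> T -> R) s :
  (forall i, sq_integrable P (X i)) -> sq_integrable P (lincomb s X).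
Proof.
move=> X2; elim: s => [|p s IH].
  by apply: (sq_integrable_ext (sq_integrable_cst P 0)) => w; rewrite /lincomb big_nil.
apply: (sq_integrable_ext (sq_integrableD (sq_integrableZ p.1 (X2 p.2)) IH)) => w.
by rewrite /lincomb big_cons.
Qed.

Lemma gk_lincomb {I J : Type} (X : I -> T -> R) K (L : J -> seq (R * I)) :
  gaussian_kernel P X K ->
  gaussian_kernel P (fun j => lincomb (L j) X) (lincomb_kernel L K).
Proof.
move=> [X2 XK]; split; first by move=> j; exact: lincomb_sq_integrable.
move=> s u; rewrite -quad_form_flatten -XK; apply: eq_Rintegral => w _.
by rewrite lincomb_flattenE.
Qed.

Lemma gk_ae {I : Type} (X Y : I -> T -> R) K : gaussian_kernel P X K ->
  (forall i, measurable_fun setT (Y i)) -> (forall i, {ae P, forall w, X i w = Y i w}) ->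
  gaussian_kernel P Y K.
Proof.
move=> [X2 XK] mY XY; split; first by move=> i; exact: sq_integrable_ae (X2 i) (mY i) (XY i).
move=> s u; rewrite -XK; apply: Rintegral_ae_eq.
- apply: measurableT_comp; first exact: measurable_cos.
  apply: measurable_funD => //; apply: measurable_sum => p.
  exact: measurable_funM.
- apply: measurableT_comp; first exact: measurable_cos.
  apply: measurable_funD => //; have [] := lincomb_sq_integrable s X2 => //.
- have : {ae P, forall w, lincomb s Y w = lincomb s X w}.
    elim: s => [|p s IH]; first by apply: aeW => w; rewrite /lincomb !big_nil.
    have := XY p.2; apply: filterS2 IH => w IH XYw.
    by rewrite /lincomb !big_cons XYw -/(lincomb s X w) -IH.
  by apply: filterS => w ->.
Qed.

Lemma gk_fdd {d' : measure_display} {T' : measurableType d'} (P' : probability T' R)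
    {I : Type} (D : set I) (X : I -> T -> R) (Y : I -> T' -> R) K K' :
  gaussian_kernel P X K -> gaussian_kernel P' Y K' ->
  (forall i j, D i -> D j -> K i j = K' i j) -> fdd_eq P P' D X Y.
Proof.
move=> XK YK' KK' n t A Dt mA.
apply: trig_law => //.
- by move=> i; exact: gk_meas XK.
- by move=> i; exact: gk_meas YK'.
move=> a u; pose s := [seq (a i, t i) | i <- index_enum 'I_n].
have := gk_transform XK s u; have := gk_transform YK' s u.
have -> : quad_form K s = quad_form K' s.
  rewrite /quad_form !big_map; apply: eq_bigr => i _; rewrite !big_map.
  by apply: eq_bigr => j _ /=; rewrite KK'.
move=> <-; under eq_Rintegral do rewrite /lincomb big_map.
by under [X in _ = X -> _]eq_Rintegral do rewrite /lincomb big_map.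
Qed.

Lemma normal_transform0_ae (X : T -> R) m : measurable_fun setT X ->
  normal_transform P X m 0 -> {ae P, forall w, X w = m}.
Proof.
move=> mX X0.
have := @law_determined _ _ _ _ _ P P X (cst m) mX (measurable_cst _) _
  (~` [set m]) (measurableC (measurable_set1 _)).
have -> : (cst m : T -> R) @^-1` (~` [set m]) = set0.
  by apply/seteqP; split=> w //=; apply.
rewrite measure0 => H; exists (X @^-1` (~` [set m])); split.
- by rewrite -[X in measurable X]setTI; apply: mX => //; exact: measurableC.
- apply: H => t u; rewrite X0 mul0r oppr0 mul0r expR0 mul1r.
  by rewrite /cst Rintegral_probability_cst.
- by move=> w /=.
Qed.

Lemma gk_null {I : Type} (X : I -> T -> R) K i : gaussian_kernel P X K ->
  K i i = 0 -> {ae P, forall w, X i w = 0}.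
Proof.
move=> XK Ki; apply: normal_transform0_ae; first exact: gk_meas XK.
have := gk_normal_transform [:: (1, i)] XK.
rewrite /quad_form !big_seq1/= Ki mulr0 => H t u.
by rewrite -H; apply: eq_Rintegral => w _; rewrite lincomb1 mul1r.
Qed.

(** The transform of a null variable is 1, and [exp (- K i i / 2) = 1] forces the entry to
    vanish. *)
Lemma gk_kernel_null {I : Type} (X : I -> T -> R) K i : gaussian_kernel P X K ->
  {ae P, forall w, X i w = 0} -> K i i = 0.
Proof.
move=> XK Xi; have := gk_transform XK [:: (1, i)] 0.
rewrite /quad_form !big_seq1/= !mul1r cos0 mulr1.
have -> : \int[P]_w cos (lincomb [:: (1, i)] X w + 0) = \int[P]_w 1.
  apply: Rintegral_ae_eq => //.
    apply: measurableT_comp; first exact: measurable_cos.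
    apply: measurable_funD => //.
    by have [] := @lincomb_sq_integrable _ X [:: (1, i)] (gk_sq XK).
  by apply: filterS Xi => w Xw; rewrite lincomb1 Xw mulr0 addr0 cos0.
rewrite Rintegral_probability_cst => /(etrans (expR0 R))/expR_inj/eqP.
by rewrite eq_sym mulNr oppr_eq0 mulf_eq0 invr_eq0 pnatr_eq0 orbF => /eqP.
Qed.

(** A cosine is at most 1, hence so is its mean [exp (- quad_form K s / 2)]. *)
Lemma quad_form_ge0 {I : Type} (X : I -> T -> R) K s : gaussian_kernel P X K ->
  0 <= quad_form K s.
Proof.
move=> XK; have := gk_transform XK s 0; rewrite cos0 mulr1 => H.
have : expR (- quad_form K s / 2) <= expR 0.
  rewrite -H expR0 -[leRHS](Rintegral_probability_cst P).
  have i1 : P.-integrable setT (EFin \o (fun w => cos (lincomb s X w + 0))).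
    apply: bounded_meas_integrable; split; last by exists 1 => w; rewrite ler_norml cos_geN1 cos_le1.
    apply: measurableT_comp; first exact: measurable_cos.
    by apply: measurable_funD => //; have [] := @lincomb_sq_integrable _ X s (gk_sq XK).
  have i2 : P.-integrable setT (EFin \o (fun=> 1 : R)).
    by apply: sq_integrable_integrable; exact: sq_integrable_cst.
  by apply: le_Rintegral => // w _; exact: cos_le1.
by rewrite ler_expR; lra.
Qed.

Lemma gk_mean {I : Type} (X : I -> T -> R) K i : gaussian_kernel P X K ->
  \int[P]_w X i w = 0.
Proof.
move=> XK; apply: (@normal_transform_mean _ _ _ P (X i) 0 (quad_form K [:: (1, i)])).
- exact: gk_meas XK.
- move=> t u; rewrite -(gk_normal_transform [:: (1, i)] XK t u).
  by apply: eq_Rintegral => w _; rewrite lincomb1 mul1r.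
- exact: sq_integrable_integrable (gk_sq XK i).
Qed.

Lemma gk_var {I : Type} (X : I -> T -> R) K s : gaussian_kernel P X K ->
  \int[P]_w lincomb s X w ^+ 2 = quad_form K s.
Proof.
move=> XK; have [mL iL] := @lincomb_sq_integrable _ X s (gk_sq XK).
apply: normal_transform_var => //; first exact: quad_form_ge0 XK.
exact: gk_normal_transform.
Qed.

Lemma gk_cov {I : Type} (X : I -> T -> R) K i j : gaussian_kernel P X K ->
  (forall i j, K i j = K j i) -> \int[P]_w (X i w * X j w) = K i j.
Proof.
move=> XK sK.
have Vp := gk_var [:: (1, i); (1, j)] XK; have Vm := gk_var [:: (1, i); (-1, j)] XK.
have ip : P.-integrable setT (EFin \o (fun w => lincomb [:: (1, i); (1, j)] X w ^+ 2)).
  by have [] := @lincomb_sq_integrable _ X [:: (1, i); (1, j)] (gk_sq XK).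
have im : P.-integrable setT (EFin \o (fun w => lincomb [:: (1, i); (-1, j)] X w ^+ 2)).
  by have [] := @lincomb_sq_integrable _ X [:: (1, i); (-1, j)] (gk_sq XK).
have E w : X i w * X j w = 4^-1 * (lincomb [:: (1, i); (1, j)] X w ^+ 2 -
    lincomb [:: (1, i); (-1, j)] X w ^+ 2).
  by rewrite /lincomb !big_cons !big_nil/=; field.
under eq_Rintegral do rewrite E.
rewrite RintegralZl//; last first.
  by have := integrableB measurableT ip im; apply: eq_integrable.
rewrite RintegralB// Vp Vm /quad_form !big_cons !big_nil/= (sK j i).
by field.
Qed.

Lemma gk_gaussian_family {I : Type} (D : set I) (X : I -> T -> R) K :
  gaussian_kernel P X K -> gaussian_family P D X.
Proof.
move=> XK n t a Dt; pose s := [seq (a i, t i) | i <- index_enum 'I_n].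
have E : (fun w => \sum_(i < n) a i * X (t i) w) = lincomb s X.
  by apply/funext => w; rewrite /lincomb big_map.
rewrite E; apply: transform_gaussian_law (gk_normal_transform s XK).
  by have [] := @lincomb_sq_integrable _ X s (gk_sq XK).
exact: quad_form_ge0 XK.
Qed.

(** The way into [gaussian_kernel] for a sheet, which is known only by Gaussianity, mean and
    covariance: every combination has some normal transform, whose parameters are identified as its
    mean and its second moment. *)
Lemma gaussian_family_gk {I : Type} (X : I -> T -> R) K :
  gaussian_family P setT X -> (forall i, sq_integrable P (X i)) ->
  (forall i, \int[P]_w X i w = 0) -> (forall i j, \int[P]_w (X i w * X j w) = K i j) ->
  gaussian_kernel P X K.
Proof.
move=> gX X2 X0 XK; split=> // s u.
have [mL iL] := lincomb_sq_integrable s X2.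
have gL : gaussian_law P (lincomb s X).
  case: s mL iL => [|p0 s] mL iL.
    by right; exists 0; apply: aeW => w; rewrite /lincomb big_nil.
  set s' := p0 :: s in mL iL *.
  have := gX (size s') (fun i => (nth p0 s' i).2) (fun i => (nth p0 s' i).1) (fun=> Logic.I).
  congr (gaussian_law P _); apply/funext => w.
  by rewrite /lincomb (big_nth p0) big_mkord.
have [m [v [v0 Lmv]]] := gaussian_law_transform mL gL.
have m0 : m = 0.
  rewrite -(normal_transform_mean mL Lmv); last first.
    by apply: sq_integrable_integrable; split.
  rewrite /lincomb; elim: s {mL iL gL Lmv} => [|p s IH].
    by under eq_Rintegral do rewrite big_nil; rewrite Rintegral_probability_cst.
  under eq_Rintegral do rewrite big_cons.
  rewrite RintegralD//.
  - rewrite RintegralZl// ?X0 ?mulr0 ?add0r//.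
    exact: sq_integrable_integrable.
  - by apply: sq_integrable_integrable; apply: sq_integrableZ.
  - by apply: sq_integrable_integrable; apply: (@lincomb_sq_integrable _ X s X2).
rewrite m0 in Lmv.
have vE : v = quad_form K s.
  rewrite -(normal_transform_var mL v0 Lmv iL).
  have E1 s' i : \int[P]_w (X i w * lincomb s' X w) = \sum_(q <- s') q.1 * K i q.2.
    elim: s' => [|q s' IH].
      by rewrite big_nil; under eq_Rintegral do rewrite /lincomb big_nil mulr0;
         rewrite Rintegral_probability_cst.
    under eq_Rintegral do rewrite /lincomb big_cons mulrDr -/(lincomb s' X _) mulrCA.
    have iXX := sq_integrable_mul (X2 i) (X2 q.2).
    rewrite RintegralD//.
    - by rewrite RintegralZl// XK IH big_cons.
    - by have := integrableZl measurableT q.1 iXX; apply: eq_integrable.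
    - exact: sq_integrable_mul (X2 i) (lincomb_sq_integrable s' X2).
  have E2 s' : \int[P]_w (lincomb s' X w * lincomb s X w) =
      \sum_(p <- s') \sum_(q <- s) p.1 * q.1 * K p.2 q.2.
    elim: s' => [|p s' IH].
      by rewrite big_nil; under eq_Rintegral do rewrite /lincomb big_nil mul0r;
         rewrite Rintegral_probability_cst.
    under eq_Rintegral do rewrite [lincomb (p :: s') X _]/lincomb big_cons mulrDl
       -/(lincomb s' X _) -mulrA.
    have iXX := sq_integrable_mul (X2 p.2) (lincomb_sq_integrable s X2).
    rewrite RintegralD//.
    - rewrite RintegralZl// E1 IH big_cons; congr (_ + _).
      by rewrite mulr_sumr; apply: eq_bigr => q _; rewrite mulrA.
    - by have := integrableZl measurableT p.1 iXX; apply: eq_integrable.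
    - exact: sq_integrable_mul (lincomb_sq_integrable s' X2) (lincomb_sq_integrable s X2).
  by rewrite /quad_form -E2; apply: eq_Rintegral => w _; rewrite expr2.
have := Lmv 1 u; rewrite expr1n mulr1 mulr0 add0r -vE => <-.
by apply: eq_Rintegral => w _; rewrite mul1r.
Qed.

End gaussian_kernels.

(** * Independence of jointly Gaussian variables *)

Section independence.
Context {R : realType} {d : measure_display} {T : measurableType d}.
Variable P : probability T R.

Let tup (Z : T -> R) (w : T) := [tuple Z w | i < 1].

Let bounded_meas_tup (Z : T -> R) f : measurable_fun setT Z -> trig_class f ->
  bounded_meas (fun w => f (tup Z w)).
Proof.
move=> mZ /trig_class_bounded_meas[mf [M fM]]; split; last by exists M.
apply: measurableT_comp => //; apply/measurable_fun_tnthP => i.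
by apply: eq_measurable_fun mZ => w _ /=; rewrite tnth_mktuple.
Qed.

Lemma bounded_measM (f g : T -> R) : bounded_meas f -> bounded_meas g ->
  bounded_meas (fun w => f w * g w).
Proof.
move=> [mf [M fM]] [mg [N gN]]; split; first exact: measurable_funM.
by exists (M * N) => w; rewrite normrM ler_pM.
Qed.

(** One variable at a time: with the bounded factor [h] fixed, factorization passes from cosines of
    [Z] to the whole class. It serves with [h] a cosine of the other variable, and then with [h] any
    member of the class. *)
Let trig_class_factor (Z h : T -> R) : measurable_fun setT Z -> bounded_meas h ->
  (forall a u, \int[P]_w (cos (a * Z w + u) * h w) =
               \int[P]_w cos (a * Z w + u) * \int[P]_w h w) ->
  forall f, trig_class f -> \int[P]_w (f (tup Z w) * h w) =
                            \int[P]_w f (tup Z w) * \int[P]_w h w.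
Proof.
move=> mZ bh Zh f tf.
have bZ g : trig_class g -> P.-integrable setT (EFin \o (fun w => g (tup Z w))).
  by move=> tg; apply: bounded_meas_integrable; exact: bounded_meas_tup.
have bZh g : trig_class g -> P.-integrable setT (EFin \o (fun w => g (tup Z w) * h w)).
  move=> tg; apply: bounded_meas_integrable.
  by apply: bounded_measM => //; exact: bounded_meas_tup.
elim: (tf) => {f tf} [a u|f g tf IHf tg IHg|k f tf IHf|f_ f M tf IHf fM ff].
- have E w : \sum_(i < 1) a i * tnth (tup Z w) i + u = a ord0 * Z w + u.
    by rewrite big_ord1 tnth_mktuple.
  under eq_Rintegral do rewrite E; rewrite Zh; congr (_ * _).
  by apply: eq_Rintegral => w _; rewrite E.
- under eq_Rintegral do rewrite mulrDl.
  rewrite (RintegralD measurableT (bZh _ tf) (bZh _ tg)).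
  by rewrite (RintegralD measurableT (bZ _ tf) (bZ _ tg)) IHf IHg mulrDl.
- under eq_Rintegral do rewrite -mulrA.
  rewrite (RintegralZl k measurableT (bZh _ tf)).
  by rewrite (RintegralZl k measurableT (bZ _ tf)) IHf mulrA.
- have [mh [N hN]] := bh.
  have H1 : \int[P]_w (f_ k (tup Z w) * h w) @[k --> \oo] --> \int[P]_w (f (tup Z w) * h w).
    apply: (@Rintegral_bounded_cvg _ _ _ P (fun k w => f_ k (tup Z w) * h w) _ (M * N)).
    + by move=> k; apply: measurable_funM => //; have [] := bounded_meas_tup mZ (tf k).
    + by move=> k w; rewrite normrM ler_pM.
    + by move=> w; apply: cvgM; [exact: ff|exact: cvg_cst].
  have H2 : \int[P]_w f_ k (tup Z w) @[k --> \oo] --> \int[P]_w f (tup Z w).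
    apply: (@Rintegral_bounded_cvg _ _ _ P (fun k w => f_ k (tup Z w)) _ M).
    + by move=> k; have [] := bounded_meas_tup mZ (tf k).
    + by move=> k w.
    + by move=> w; exact: ff.
  move: H1; under eq_fun do rewrite IHf; move=> H1.
  have H3 : \int[P]_w f_ k (tup Z w) * \int[P]_w h w @[k --> \oo] -->
      \int[P]_w f (tup Z w) * \int[P]_w h w by apply: cvgM => //; exact: cvg_cst.
  exact: (cvg_unique _ H1 H3).
Qed.

Lemma independent_of_transform (X Y : T -> R) :
  measurable_fun setT X -> measurable_fun setT Y ->
  (forall a u b v, \int[P]_w (cos (a * X w + u) * cos (b * Y w + v)) =
     \int[P]_w cos (a * X w + u) * \int[P]_w cos (b * Y w + v)) ->
  independent_rv P X Y.
Proof.
move=> mX mY XY A B mA mB.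
have key f g : trig_class f -> trig_class g ->
    \int[P]_w (f (tup X w) * g (tup Y w)) =
    \int[P]_w f (tup X w) * \int[P]_w g (tup Y w).
  move=> tf tg; under eq_Rintegral do rewrite mulrC.
  rewrite [RHS]mulrC; apply: trig_class_factor => // [|b v]; first exact: bounded_meas_tup.
  under eq_Rintegral do rewrite mulrC.
  rewrite [RHS]mulrC; apply: trig_class_factor => //; exact: bounded_meas_cos.
have ind (C : set R) (mC : measurable C) :
    trig_class (fun x : 1.-tuple R => \1_C (tnth x ord0)).
  apply: trig_class_ext (measurable_trig_set (A := (fun x => tnth x ord0) @^-1` C) _) _ => //.
  by rewrite -[X in measurable X]setTI; exact: measurable_tnth.
have := key _ _ (ind A mA) (ind B mB).
have mXA : measurable (X @^-1` A) by rewrite -[X in measurable X]setTI; exact: mX.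
have mYB : measurable (Y @^-1` B) by rewrite -[X in measurable X]setTI; exact: mY.
have IA w : \1_A (tnth (tup X w) ord0) = \1_(X @^-1` A) w :> R by rewrite tnth_mktuple.
have IB w : \1_B (tnth (tup Y w) ord0) = \1_(Y @^-1` B) w :> R by rewrite tnth_mktuple.
under eq_Rintegral do rewrite IA IB.
under [X in _ = X * _ -> _]eq_Rintegral do rewrite IA.
under [X in _ = _ * X -> _]eq_Rintegral do rewrite IB.
have -> : (fun w => \1_(X @^-1` A) w * \1_(Y @^-1` B) w) = \1_(X @^-1` A `&` Y @^-1` B) :> (T -> R).
  by rewrite indicI.
rewrite /Rintegral !integral_indic ?setIT//; last exact: measurableI.
move=> H; rewrite -[LHS]fineK ?fin_num_measure//; last exact: measurableI.
by rewrite H EFinM !fineK// fin_num_measure.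
Qed.

(** Without the cross entries, the sum and the difference of [a X_i] and [b X_j] have the same
    variance; by the product-to-sum formula the mean of the product of cosines is then the product
    of the means. *)
Lemma gk_independent {I : Type} (X : I -> T -> R) K i j : gaussian_kernel P X K ->
  K i j = 0 -> K j i = 0 -> independent_rv P (X i) (X j).
Proof.
move=> XK Kij Kji.
apply: independent_of_transform; [exact: gk_meas XK|exact: gk_meas XK|].
move=> a u b v.
have E w : cos (a * X i w + u) * cos (b * X j w + v) =
    2^-1 * (cos (lincomb [:: (a, i); (b, j)] X w + (u + v)) +
            cos (lincomb [:: (a, i); (- b, j)] X w + (u - v))).
  rewrite /lincomb !big_cons !big_nil/= !addr0.
  have -> : a * X i w + b * X j w + (u + v) = (a * X i w + u) + (b * X j w + v) by ring.
  have -> : a * X i w + - b * X j w + (u - v) = (a * X i w + u) - (b * X j w + v) by ring.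
  move: (a * X i w + u) (b * X j w + v) => A B.
  by rewrite cosD cosB; field.
have E1 c k t : \int[P]_w cos (c * X k w + t) = expR (- (c ^+ 2 * K k k) / 2) * cos t.
  have := gk_transform XK [:: (c, k)] t.
  rewrite /quad_form !big_seq1/= -expr2 => <-.
  by apply: eq_Rintegral => w _; rewrite lincomb1.
have bc s t : P.-integrable setT (EFin \o (fun w => cos (lincomb s X w + t))).
  apply: bounded_meas_integrable; split; last by exists 1 => w; rewrite ler_norml cos_geN1 cos_le1.
  apply: measurableT_comp; first exact: measurable_cos.
  by apply: measurable_funD => //; have [] := lincomb_sq_integrable s (gk_sq XK).
under eq_Rintegral do rewrite E.
rewrite RintegralZl//; last first.
  by have := integrableD measurableT (bc [:: (a, i); (b, j)] (u + v)) (bc [:: (a, i); (- b, j)] (u - v));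
    apply: eq_integrable.
rewrite RintegralD// !(gk_transform XK) !E1 /quad_form !big_cons !big_nil/= Kij Kji.
rewrite !mulr0 !addr0 !add0r mulrNN -!expr2 cosD cosB.
have -> : - (a ^+ 2 * K i i + b ^+ 2 * K j j) / 2 =
  - (a ^+ 2 * K i i) / 2 + - (b ^+ 2 * K j j) / 2 by ring.
by rewrite expRD; field.
Qed.

(** Independence on events says that the joint law is the product of the marginals, by uniqueness of
    product measures; the rest is Fubini. *)
Lemma independent_Rintegral (X Y : T -> R) (f g : R -> R) :
  measurable_fun setT X -> measurable_fun setT Y ->
  bounded_meas f -> bounded_meas g -> independent_rv P X Y ->
  \int[P]_w (f (X w) * g (Y w)) = \int[P]_w f (X w) * \int[P]_w g (Y w).
Proof.
move=> mX mY [mf [M fM]] [mg [N gN]] XY.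
pose X' : {RV P >-> R} := mfun_Sub (mem_set mX).
pose Y' : {RV P >-> R} := mfun_Sub (mem_set mY).
have mXY : measurable_fun setT (fun w => (X w, Y w)) by exact: measurable_fun_pair.
pose Z : {RV P >-> (R * R)%type} := mfun_Sub (mem_set mXY).
pose mux := distribution P X'; pose muy := distribution P Y'.
have muZ A : measurable A -> (mux \x muy)%E A = distribution P Z A.
  apply: product_measure_unique => {}A B mA mB.
  by rewrite -[LHS]/(P (X @^-1` A `&` Y @^-1` B)) XY.
pose F (p : R * R) := (f p.1 * g p.2)%:E.
have mF : measurable_fun setT F.
  apply/measurable_EFinP; apply: measurable_funM; exact: measurableT_comp.
have FMN p : `|f p.1 * g p.2| <= M * N by rewrite normrM ler_pM.
have H1 : (\int[P]_w F (X w, Y w) = \int[distribution P Z]_p F p)%E.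
  rewrite integral_distribution//; apply: bounded_meas_integrable; split.
    by apply/measurable_EFinP; exact: measurableT_comp mF _.
  by exists (M * N) => w; exact: (FMN (X w, Y w)).
have H2 : (\int[distribution P Z]_p F p = \int[mux \x muy]_p F p)%E.
  by apply: eq_measure_integral => A mA _; exact: (esym (muZ A mA)).
have iF : (mux \x muy)%E.-integrable setT F.
  apply: measurable_bounded_integrable => //.
  - have E1 : (mux \x muy)%E setT = 1%E by rewrite muZ// probability_setT.
    by apply: le_lt_trans (_ : (1%:E < +oo)%E); [rewrite -E1; exact: lexx|exact: ltry].
  - exact/measurable_EFinP.
  - exists (M * N); split; first exact: num_real.
    by move=> x Mx y _ /=; exact: le_trans (FMN y) (ltW Mx).
have ig : muy.-integrable setT (EFin \o g).
  by apply: bounded_meas_integrable; split=> //; exists N.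
have if_ : mux.-integrable setT (EFin \o f).
  by apply: bounded_meas_integrable; split=> //; exists M.
have H3 : (\int[mux \x muy]_p F p = (\int[mux]_x f x * \int[muy]_y g y)%R%:E)%E.
  rewrite -integral12_prod_meas1//.
  have E x : fubini_F muy F x = (f x * \int[muy]_y g y)%:E.
    rewrite /fubini_F /F/=.
    under eq_integral do rewrite EFinM.
    rewrite integralZl// EFinM; congr (_ * _)%E.
    by rewrite /Rintegral fineK//; exact: integrable_fin_num.
  under eq_integral do rewrite E mulrC EFinM.
  rewrite integralZl// mulrC EFinM; congr (_ * _)%E.
  by rewrite /Rintegral fineK//; exact: integrable_fin_num.
have H4 : \int[mux]_x f x = \int[P]_w f (X w).
  rewrite /Rintegral integral_distribution//; first exact/measurable_EFinP.
  apply: bounded_meas_integrable; split; last by exists M.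
  exact: measurableT_comp.
have H5 : \int[muy]_x g x = \int[P]_w g (Y w).
  rewrite /Rintegral integral_distribution//; first exact/measurable_EFinP.
  apply: bounded_meas_integrable; split; last by exists N.
  exact: measurableT_comp.
by rewrite -H4 -H5 [LHS]/Rintegral H1 H2 H3.
Qed.

(** Tested on [cos X_i cos X_j], independence gives [cosh (K i j) = 1], that is, [(e - 1)^2 = 0]
    with [e = exp (K i j)]. *)
Lemma gk_independent_kernel {I : Type} (X : I -> T -> R) K i j : gaussian_kernel P X K ->
  K i j = K j i -> independent_rv P (X i) (X j) -> K i j = 0.
Proof.
move=> XK sK ind.
have bc : bounded_meas (@cos R).
  by split; [exact: measurable_cos|exists 1 => w; rewrite ler_norml cos_geN1 cos_le1].
have := independent_Rintegral (gk_meas i XK) (gk_meas j XK) bc bc ind.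
have E w : cos (X i w) * cos (X j w) =
    2^-1 * (cos (lincomb [:: (1, i); (1, j)] X w + 0) +
            cos (lincomb [:: (1, i); (- 1, j)] X w + 0)).
  by rewrite /lincomb !big_cons !big_nil/= !addr0 !mul1r mulN1r cosD cosB; field.
have E1 k : \int[P]_w cos (X k w) = expR (- (K k k) / 2).
  have := gk_transform XK [:: (1, k)] 0.
  rewrite /quad_form !big_seq1/= !mul1r cos0 mulr1 => <-.
  by apply: eq_Rintegral => w _; rewrite lincomb1 mul1r addr0.
have bcs s t : P.-integrable setT (EFin \o (fun w => cos (lincomb s X w + t))).
  apply: bounded_meas_integrable; split; last by exists 1 => w; rewrite ler_norml cos_geN1 cos_le1.
  apply: measurableT_comp; first exact: measurable_cos.
  by apply: measurable_funD => //; have [] := lincomb_sq_integrable s (gk_sq XK).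
under eq_Rintegral do rewrite E.
rewrite RintegralZl//; last first.
  by have := integrableD measurableT (bcs [:: (1, i); (1, j)] 0) (bcs [:: (1, i); (- 1, j)] 0);
    apply: eq_integrable.
rewrite RintegralD// !(gk_transform XK) !E1 /quad_form !big_cons !big_nil/= -sK cos0.
set a := K i i; set b := K j j; set c := K i j.
have -> : - (1 * 1 * a + (1 * 1 * c + 0) + (1 * 1 * c + (1 * 1 * b + 0) + 0)) / 2 =
   - a / 2 + - b / 2 + - c by field.
have -> : - (1 * 1 * a + (1 * - 1 * c + 0) + (- 1 * 1 * c + (- 1 * - 1 * b + 0) + 0)) / 2 =
   - a / 2 + - b / 2 + c by field.
rewrite !expRD !mulr1 -mulrDr mulrA -[RHS]mulr1 mulrC mulrA.
move=> H; have {}H : (expR (- c) + expR c) / 2 = 1.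
  have p0 : expR (- a / 2) * expR (- b / 2) != 0 by rewrite mulf_neq0// gt_eqF// expR_gt0.
  by apply: (mulfI p0); rewrite -[RHS]H; ring.
have ec : 0 < expR c by exact: expR_gt0.
rewrite expRN in H; set e := expR c in ec H.
have {}H : (e - 1) ^+ 2 = 0.
  have : ((e^-1 + e) / 2) * (2 * e) = 2 * e by rewrite H mul1r.
  have -> : (e^-1 + e) / 2 * (2 * e) = 1 + e ^+ 2 by field; rewrite gt_eqF.
  by move=> H1; rewrite sqrrB1 [e ^+ 2 - _]addrC -addrA [e ^+ 2 + 1]addrC H1; ring.
apply: expR_inj; rewrite expR0 -/e; apply/eqP; rewrite -subr_eq0.
by rewrite -sqrf_eq0 H.
Qed.

End independence.

(** * Stochastic integrals *)

Local Open Scope complex_scope.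

Section complex_parts.
Context {R : realType}.
Implicit Types z w : R[i].

Lemma cReD z w : complex.Re (z + w) = complex.Re z + complex.Re w.
Proof. by case: z; case: w. Qed.

Lemma cImD z w : complex.Im (z + w) = complex.Im z + complex.Im w.
Proof. by case: z; case: w. Qed.

Lemma cReB z w : complex.Re (z - w) = complex.Re z - complex.Re w.
Proof. by case: z; case: w. Qed.

Lemma cImB z w : complex.Im (z - w) = complex.Im z - complex.Im w.
Proof. by case: z; case: w. Qed.

Lemma cReM z w : complex.Re (z * w) =
  complex.Re z * complex.Re w - complex.Im z * complex.Im w.
Proof. by case: z; case: w. Qed.

Lemma cImM z w : complex.Im (z * w) =
  complex.Re z * complex.Im w + complex.Im z * complex.Re w.
Proof. by case: z; case: w. Qed.

Lemma cRe_conjc z : complex.Re (conjc z) = complex.Re z.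
Proof. by case: z. Qed.

Lemma cIm_conjc z : complex.Im (conjc z) = - complex.Im z.
Proof. by case: z. Qed.

Lemma cRe_real (a : R) : complex.Re a%:C = a. Proof. by []. Qed.

Lemma cIm_real (a : R) : complex.Im a%:C = 0. Proof. by []. Qed.

Definition complexE := (cReD, cImD, cReB, cImB, cReM, cImM, cRe_conjc, cIm_conjc, cRe_real, cIm_real).

Lemma cRe_sum {I : Type} (s : seq I) (F : I -> R[i]) :
  complex.Re (\sum_(i <- s) F i) = \sum_(i <- s) complex.Re (F i).
Proof. by apply: (big_morph (@complex.Re R)) => // z w; exact: cReD. Qed.

Lemma cIm_sum {I : Type} (s : seq I) (F : I -> R[i]) :
  complex.Im (\sum_(i <- s) F i) = \sum_(i <- s) complex.Im (F i).
Proof. by apply: (big_morph (@complex.Im R)) => // z w; exact: cImD. Qed.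

Lemma sqnormc_ge0 z : 0 <= sqnormc z.
Proof. by rewrite addr_ge0// sqr_ge0. Qed.

Lemma sqnormcC z w : sqnormc (z - w) = sqnormc (w - z).
Proof. by rewrite /sqnormc !complexE; ring. Qed.

Lemma sqnormcZD_le (a : R) z w :
  sqnormc (a%:C * z + w) <= 2 * a ^+ 2 * sqnormc z + 2 * sqnormc w.
Proof.
rewrite /sqnormc !complexE !mul0r subr0 addr0.
set p := complex.Re z; set q := complex.Im z; set r := complex.Re w; set s := complex.Im w.
have : 0 <= (a * p - r) ^+ 2 + (a * q - s) ^+ 2 by rewrite addr_ge0// sqr_ge0.
nra.
Qed.

(** The difference of the two sides is [e] times a square. Below, this inequality takes the place of
    the triangle inequality of L^2 when square means pass to the limit. *)
Lemma sqr_close (a b e : R) : 0 < e ->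
  a ^+ 2 <= (1 + e) * b ^+ 2 + (1 + e^-1) * (a - b) ^+ 2.
Proof.
move=> e0; rewrite -subr_ge0.
have -> : (1 + e) * b ^+ 2 + (1 + e^-1) * (a - b) ^+ 2 - a ^+ 2 =
  e * (b - (a - b) / e) ^+ 2 by field; rewrite gt_eqF.
by rewrite mulr_ge0 ?sqr_ge0// ltW.
Qed.

Lemma sqnormc_close z w (e : R) : 0 < e ->
  sqnormc z <= (1 + e) * sqnormc w + (1 + e^-1) * sqnormc (z - w).
Proof.
move=> e0; rewrite /sqnormc !complexE.
have := sqr_close (complex.Re z) (complex.Re w) e0.
have := sqr_close (complex.Im z) (complex.Im w) e0.
lra.
Qed.

End complex_parts.

(** * Convergence of square means *)

Section square_mean_convergence.
Context {R : realType}.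

Lemma close_cvg (a c : nat -> R) (b : R) : 0 <= b ->
  (forall e, 0 < e -> \forall n \near \oo,
     a n <= (1 + e) * b + (1 + e^-1) * c n /\ b <= (1 + e) * a n + (1 + e^-1) * c n) ->
  (forall n, 0 <= c n) ->
  c n @[n --> \oo] --> (0 : R) -> a n @[n --> \oo] --> b.
Proof.
move=> b0 H c0 cc; apply/cvgrPdist_lt => r r0.
(* This choice makes [e * b] at most [r / 4]; the error term is below [r / 4] too, and [e <= 1]
   absorbs the products of small quantities. *)
pose e := Num.min 1 (r / (4 * (b + 1))).
have b1 : 0 < 4 * (b + 1) by lra.
have e0 : 0 < e by rewrite lt_min ltr01 divr_gt0.
have e1 : e <= 1 by rewrite ge_min lexx.
have eb : e * (4 * (b + 1)) <= r by rewrite -ler_pdivlMr// ge_min lexx orbT.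
have k0 : 0 < 1 + e^-1 by rewrite addr_gt0// invr_gt0.
have cl : \forall n \near \oo, `|c n| < (1 + e^-1)^-1 * (r / 4).
  by move/cvgr0Pnorm_lt: (cc); apply; rewrite mulr_gt0 ?invr_gt0// divr_gt0.
near=> n.
have [H1 H2] : a n <= (1 + e) * b + (1 + e^-1) * c n /\
  b <= (1 + e) * a n + (1 + e^-1) * c n by near: n; exact: H.
have cn : (1 + e^-1) * c n < r / 4.
  rewrite -ltr_pdivlMl//.
  by rewrite -[c n]ger0_norm//; near: n; exact: cl.
set k := (1 + e^-1) * c n in cn H1 H2.
have k1 : 0 <= k by rewrite mulr_ge0// ltW.
have kk : e * k <= k by rewrite ler_piMl.
have eeb : e * (e * b) <= e * b by rewrite ler_piMl// mulr_ge0// ltW.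
have ea : e * a n <= e * ((1 + e) * b + k) by rewrite ler_pM2l.
rewrite ltr_norml; apply/andP; split; lra.
Unshelve. all: end_near. Qed.

Context {d : measure_display} {T : measurableType d}.
Variable m : {measure set T -> \bar R}.

Lemma Rintegral_close (A B C : T -> R) (e : R) : 0 < e ->
  m.-integrable setT (EFin \o A) -> m.-integrable setT (EFin \o B) ->
  m.-integrable setT (EFin \o C) ->
  (forall x, A x <= (1 + e) * B x + (1 + e^-1) * C x) ->
  \int[m]_x A x <= (1 + e) * \int[m]_x B x + (1 + e^-1) * \int[m]_x C x.
Proof.
move=> e0 iA iB iC H.
have iB' := integrableZl measurableT (1 + e) iB.
have iC' := integrableZl measurableT (1 + e^-1) iC.
rewrite -(RintegralZl (1 + e) measurableT iB) -(RintegralZl (1 + e^-1) measurableT iC).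
rewrite -(RintegralD measurableT iB' iC').
by apply: le_Rintegral => //; have := integrableD measurableT iB' iC'.
Qed.

Lemma sq_close_cvg (A C : nat -> T -> R) (B : T -> R) :
  (forall n, m.-integrable setT (EFin \o A n)) -> m.-integrable setT (EFin \o B) ->
  (\forall n \near \oo, m.-integrable setT (EFin \o C n)) ->
  (forall x, 0 <= B x) -> (forall n x, 0 <= C n x) ->
  (forall e n x, 0 < e -> A n x <= (1 + e) * B x + (1 + e^-1) * C n x /\
                          B x <= (1 + e) * A n x + (1 + e^-1) * C n x) ->
  \int[m]_x C n x @[n --> \oo] --> (0 : R) ->
  \int[m]_x A n x @[n --> \oo] --> \int[m]_x B x.
Proof.
move=> iA iB iC B0 C0 H cC; apply: close_cvg cC.
- by apply: Rintegral_ge0.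
- move=> e e0; near=> n; have iCn : m.-integrable setT (EFin \o C n) by near: n.
  by split; apply: Rintegral_close => // x; have [] := H e n x e0.
- by move=> n; apply: Rintegral_ge0.
Unshelve. all: end_near. Qed.

Lemma integrable_sumR {I : Type} (s : seq I) (F : I -> T -> R) :
  (forall i, m.-integrable setT (EFin \o F i)) ->
  m.-integrable setT (EFin \o (fun x => \sum_(i <- s) F i x)).
Proof.
move=> iF; have := @integrable_sum _ _ _ m setT measurableT _ s xpredT (fun i => EFin \o F i) (fun i _ => iF i).
by apply: eq_integrable => // x _; rewrite /= sumEFin.
Qed.

Lemma Rintegral_sumR {I : Type} (s : seq I) (F : I -> T -> R) :
  (forall i, m.-integrable setT (EFin \o F i)) ->
  \int[m]_x (\sum_(i <- s) F i x) = \sum_(i <- s) \int[m]_x F i x.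
Proof.
move=> iF; elim: s => [|i s IH].
  rewrite big_nil; under eq_Rintegral do rewrite big_nil.
  by rewrite /Rintegral integral0.
rewrite big_cons; under eq_Rintegral do rewrite big_cons.
by rewrite (RintegralD measurableT (iF i) (integrable_sumR s iF)) IH.
Qed.

Lemma integrable_nonneg (f : T -> R) : measurable_fun setT f -> (forall x, 0 <= f x) ->
  (\int[m]_x (f x)%:E < +oo)%E -> m.-integrable setT (EFin \o f).
Proof.
move=> mf f0 fi; apply/integrableP; split; first exact/measurable_EFinP.
apply: le_lt_trans fi; rewrite le_eqVlt; apply/orP; left; apply/eqP.
by apply: eq_integral => x _; rewrite /= ger0_norm.
Qed.

(** A limit 0 in the extended reals gives finite integrals only from some rank on, whence
    integrability near infinity and not for every [n]. *)
Lemma integral_cvg0_real (C : nat -> T -> R) :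
  (forall n, measurable_fun setT (C n)) -> (forall n x, 0 <= C n x) ->
  (fun n => \int[m]_x (C n x)%:E)%E @ \oo --> (0 : \bar R)%E ->
  (\forall n \near \oo, m.-integrable setT (EFin \o C n)) /\
  \int[m]_x C n x @[n --> \oo] --> (0 : R).
Proof.
move=> mC C0 /fine_cvgP[fC cC]; split; last exact: cC.
apply: filterS fC => n fn; apply: integrable_nonneg => //.
by rewrite -ge0_fin_numE//; apply: integral_ge0 => x _; rewrite lee_fin.
Qed.

End square_mean_convergence.

(** * Integrals of step functions: isometry and Gaussian law *)

Section step_functions.
Context {R : realType} {dS : measure_display} {S : measurableType dS}.
Variables (mu : {measure set S -> \bar R}) (neg : S -> S).
Context {d : measure_display} {Omega : measurableType d}.
Variable P : probability Omega R.
Variable W : set S -> Omega -> R[i].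
Hypothesis hW : white_noise mu neg P W.

Let X A w := complex.Re (W A w).
Let Y A w := complex.Im (W A w).

(** For equal sets the covariance identity reads [E |W A|^2 = mu A], which is finite and controls
    both the real and the imaginary part. *)
Let wn_sq A : finite_measure_set mu A -> sq_integrable P (X A) /\ sq_integrable P (Y A).
Proof.
move=> fA; have [mX mY] := wn_measurable hW fA.
have [cA _] := wn_cov hW fA fA.
have mN : measurable_fun setT (fun w => sqnormc (W A w)).
  by apply: measurable_funD; exact: measurable_funX.
have iN : P.-integrable setT (EFin \o (fun w => sqnormc (W A w))).
  apply: integrable_nonneg => //; first by move=> w; exact: sqnormc_ge0.
  move: cA; rewrite unlock setIid => cA.
  have [_ muA] := fA.
  move: muA; rewrite -cA; apply: le_lt_trans; rewrite le_eqVlt; apply/orP; left; apply/eqP.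
  by apply: eq_integral => w _; rewrite /sqnormc !complexE; congr EFin; ring.
split; split=> //.
- apply: le_integrable iN => //; first by apply/measurable_EFinP; exact: measurable_funX.
  move=> w _ /=; rewrite lee_fin !ger0_norm ?sqr_ge0 ?sqnormc_ge0//.
  by rewrite lerDl sqr_ge0.
- apply: le_integrable iN => //; first by apply/measurable_EFinP; exact: measurable_funX.
  move=> w _ /=; rewrite lee_fin !ger0_norm ?sqr_ge0 ?sqnormc_ge0//.
  by rewrite lerDr sqr_ge0.
Qed.

Let wn_covR A B : finite_measure_set mu A -> finite_measure_set mu B ->
  \int[P]_w (X A w * X B w + Y A w * Y B w) = fine (mu (A `&` B)) /\
  \int[P]_w (Y A w * X B w - X A w * Y B w) = 0.
Proof.
move=> fA fB; have [c1 c2] := wn_cov hW fA fB; rewrite !unlock in c1 c2.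
split.
  rewrite -c1 /Rintegral; congr fine; apply: eq_integral => w _.
  by rewrite !complexE; congr EFin; rewrite /X /Y; ring.
rewrite -[RHS]/(fine 0%E) -c2 /Rintegral; congr fine; apply: eq_integral => w _.
by rewrite !complexE; congr EFin; rewrite /X /Y; ring.
Qed.

(** The common value of the squared norm of a step function and of the mean square of its integral.
    The sets may overlap, hence the double sum. *)
Definition step_gram (f : step_fun mu) : R :=
  \sum_(i < sf_size f) \sum_(j < sf_size f)
    (complex.Re (sf_coef i) * complex.Re (sf_coef j) +
     complex.Im (sf_coef i) * complex.Im (sf_coef j)) *
    fine (mu (@sf_set _ _ _ _ f i `&` @sf_set _ _ _ _ f j)).

(** The second group of terms carries the imaginary part of [z i] times the conjugate of [z j]: its
    mean is 0 for values of the white noise, and it vanishes identically for indicators. *)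
Lemma sqnormc_sum (n : nat) (c z : 'I_n -> R[i]) :
  sqnormc (\sum_i c i * z i) = \sum_i \sum_j
   ((complex.Re (c i) * complex.Re (c j) + complex.Im (c i) * complex.Im (c j)) *
    (complex.Re (z i) * complex.Re (z j) + complex.Im (z i) * complex.Im (z j)) +
    (complex.Re (c i) * complex.Im (c j) - complex.Im (c i) * complex.Re (c j)) *
    (complex.Im (z i) * complex.Re (z j) - complex.Re (z i) * complex.Im (z j))).
Proof.
rewrite /sqnormc cRe_sum cIm_sum !expr2 !big_distrlr/= -big_split/=.
apply: eq_bigr => i _; rewrite -big_split/=; apply: eq_bigr => j _.
by rewrite !complexE; ring.
Qed.

Lemma step_integral_gram (f : step_fun mu) :
  P.-integrable setT (EFin \o (fun w => sqnormc (step_integral W f w))) /\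
  \int[P]_w sqnormc (step_integral W f w) = step_gram f.
Proof.
pose A i := @sf_set _ _ _ _ f i.
have fA i : finite_measure_set mu (A i) by exact: sf_finite.
have [X2 Y2] : (forall i, sq_integrable P (X (A i))) /\ (forall i, sq_integrable P (Y (A i))).
  by split=> i; have [] := wn_sq (fA i).
pose a i j := complex.Re (@sf_coef _ _ _ _ f i) * complex.Re (@sf_coef _ _ _ _ f j) +
     complex.Im (@sf_coef _ _ _ _ f i) * complex.Im (@sf_coef _ _ _ _ f j).
pose b i j := complex.Re (@sf_coef _ _ _ _ f i) * complex.Im (@sf_coef _ _ _ _ f j) -
     complex.Im (@sf_coef _ _ _ _ f i) * complex.Re (@sf_coef _ _ _ _ f j).
pose p i j w := X (A i) w * X (A j) w + Y (A i) w * Y (A j) w.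
pose q i j w := Y (A i) w * X (A j) w - X (A i) w * Y (A j) w.
have E w : sqnormc (step_integral W f w) = \sum_i \sum_j (a i j * p i j w + b i j * q i j w).
  rewrite /step_integral sqnormc_sum; apply: eq_bigr => i _; apply: eq_bigr => j _.
  by rewrite /a /b /p /q /X /Y; ring.
have ip i j : P.-integrable setT (EFin \o p i j).
  have := integrableD measurableT (sq_integrable_mul (X2 i) (X2 j)) (sq_integrable_mul (Y2 i) (Y2 j)).
  exact: eq_integrable.
have iq i j : P.-integrable setT (EFin \o q i j).
  have := integrableB measurableT (sq_integrable_mul (Y2 i) (X2 j)) (sq_integrable_mul (X2 i) (Y2 j)).
  exact: eq_integrable.
have ipq i j : P.-integrable setT (EFin \o (fun w => a i j * p i j w + b i j * q i j w)).
  have := integrableD measurableT (integrableZl measurableT (a i j) (ip i j))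
    (integrableZl measurableT (b i j) (iq i j)).
  exact: eq_integrable.
have is_ i : P.-integrable setT (EFin \o (fun w => \sum_j (a i j * p i j w + b i j * q i j w))).
  exact: integrable_sumR.
split.
  by have := integrable_sumR (index_enum _) is_; apply: eq_integrable => // w _; rewrite /= E.
under eq_Rintegral do rewrite E.
rewrite (Rintegral_sumR _ is_); apply: eq_bigr => i _.
rewrite (Rintegral_sumR _ (ipq i)); apply: eq_bigr => j _.
rewrite (RintegralD measurableT (integrableZl measurableT (a i j) (ip i j)) (integrableZl measurableT (b i j) (iq i j))).
rewrite (RintegralZl (a i j) measurableT (ip i j)) (RintegralZl (b i j) measurableT (iq i j)).
by have [-> ->] := wn_covR (fA i) (fA j); rewrite mulr0 addr0.
Qed.

Lemma step_val_gram (f : step_fun mu) :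
  mu.-integrable setT (EFin \o (fun s => sqnormc (step_val f s))) /\
  \int[mu]_s sqnormc (step_val f s) = step_gram f.
Proof.
pose A i := @sf_set _ _ _ _ f i.
have fA i : finite_measure_set mu (A i) by exact: sf_finite.
pose a i j := complex.Re (@sf_coef _ _ _ _ f i) * complex.Re (@sf_coef _ _ _ _ f j) +
     complex.Im (@sf_coef _ _ _ _ f i) * complex.Im (@sf_coef _ _ _ _ f j).
have E s : sqnormc (step_val f s) = \sum_i \sum_j (a i j * \1_(A i `&` A j) s).
  rewrite /step_val sqnormc_sum; apply: eq_bigr => i _; apply: eq_bigr => j _.
  by rewrite !complexE indicI /a/=; ring.
have mA i j : measurable (A i `&` A j).
  by apply: measurableI; [have [] := fA i|have [] := fA j].
have i1 i j : mu.-integrable setT (EFin \o \1_(A i `&` A j)).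
  apply: integrable_nonneg => //.
  rewrite integral_indic// setIT; have [mAi Ai] := fA i; apply: le_lt_trans Ai.
  by apply: le_measure; rewrite ?inE//; exact: subIsetl.
have i2 i j : mu.-integrable setT (EFin \o (fun s => a i j * \1_(A i `&` A j) s)).
  have := integrableZl measurableT (a i j) (i1 i j); exact: eq_integrable.
have i3 i : mu.-integrable setT (EFin \o (fun s => \sum_j (a i j * \1_(A i `&` A j) s))).
  exact: integrable_sumR.
split.
  by have := integrable_sumR (index_enum _) i3; apply: eq_integrable => // w _; rewrite /= E.
under eq_Rintegral do rewrite E.
rewrite (Rintegral_sumR _ i3); apply: eq_bigr => i _.
rewrite (Rintegral_sumR _ (i2 i)); apply: eq_bigr => j _.
rewrite (RintegralZl (a i j) measurableT (i1 i j)); congr (_ * _).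
by rewrite /Rintegral integral_indic// setIT.
Qed.

Lemma step_integral_measurable (f : step_fun mu) :
  measurable_fun setT (fun w => complex.Re (step_integral W f w)) /\
  measurable_fun setT (fun w => complex.Im (step_integral W f w)).
Proof.
split.
  under eq_fun do rewrite /step_integral cRe_sum.
  apply: measurable_sum => i; have [mX mY] := wn_measurable hW (sf_finite i).
  under eq_fun do rewrite cReM.
  by apply: measurable_funB; exact: measurable_funM.
under eq_fun do rewrite /step_integral cIm_sum.
apply: measurable_sum => i; have [mX mY] := wn_measurable hW (sf_finite i).
under eq_fun do rewrite cImM.
by apply: measurable_funD; exact: measurable_funM.
Qed.

Lemma step_val_measurable (f : step_fun mu) :
  measurable_fun setT (fun s => complex.Re (step_val f s)) /\
  measurable_fun setT (fun s => complex.Im (step_val f s)).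
Proof.
split.
  under eq_fun do rewrite /step_val cRe_sum.
  apply: measurable_sum => i; have [mA _] := sf_finite i.
  under eq_fun do rewrite cReM cRe_real cIm_real.
  apply: measurable_funB; apply: measurable_funM => //; exact: measurable_indic.
under eq_fun do rewrite /step_val cIm_sum.
apply: measurable_sum => i; have [mA _] := sf_finite i.
under eq_fun do rewrite cImM cRe_real cIm_real.
apply: measurable_funD; apply: measurable_funM => //; exact: measurable_indic.
Qed.

Lemma step_integral_gaussian (f : step_fun mu) :
  let Z w := complex.Re (step_integral W f w) in
  sq_integrable P Z /\ normal_transform P Z 0 (\int[P]_w Z w ^+ 2).
Proof.
move=> Z.
have [mZ mZ'] := step_integral_measurable f.
have [iN _] := step_integral_gram f.
have Z2 : sq_integrable P Z.
  split=> //; apply: le_integrable iN => //.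
    by apply/measurable_EFinP; exact: measurable_funX.
  move=> w _ /=; rewrite lee_fin !ger0_norm ?sqr_ge0 ?sqnormc_ge0//.
  by rewrite lerDl sqr_ge0.
split=> //.
pose n := sf_size f.
have gZ : gaussian_law P Z.
  (* The real part of [c * W A] is [Re c * Re (W A) - Im c * Im (W A)]. The integral thus has a real
     part that combines [2 n] members of the Gaussian family, first the real parts and then the
     imaginary ones. *)
  pose t (k : 'I_(n + n)) : set S * bool := match fintype.split k with
    | inl i => (@sf_set _ _ _ _ f i, false) | inr i => (@sf_set _ _ _ _ f i, true) end.
  pose a (k : 'I_(n + n)) : R := match fintype.split k with
    | inl i => complex.Re (@sf_coef _ _ _ _ f i) | inr i => - complex.Im (@sf_coef _ _ _ _ f i) end.
  have G : gaussian_family P _ _ := wn_gaussian hW.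
  have := G (n + n)%N t a.
  have ft k : [set p : set S * bool | finite_measure_set mu p.1] (t k).
    by rewrite /t/=; case: (fintype.split k) => i /=; exact: sf_finite.
  move=> /(_ ft); congr (gaussian_law P _); apply/funext => w.
  rewrite big_split_ord/= -big_split/= /Z /step_integral cRe_sum.
  apply: eq_bigr => i _; rewrite /a /t.
  have -> : fintype.split (lshift n i) = inl i by exact: (unsplitK (inl i)).
  have -> : fintype.split (rshift n i) = inr i by exact: (unsplitK (inr i)).
  by rewrite /= cReM mulNr.
have [m [v [v0 Zmv]]] := gaussian_law_transform mZ gZ.
have m0 : m = 0.
  rewrite -(normal_transform_mean mZ Zmv (sq_integrable_integrable Z2)).
  rewrite /Z; under eq_Rintegral do rewrite /step_integral cRe_sum.
  have iXY i : P.-integrable setT (EFin \o X (@sf_set _ _ _ _ f i)) /\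
      P.-integrable setT (EFin \o Y (@sf_set _ _ _ _ f i)).
    by have [? ?] := wn_sq (sf_finite i); split; exact: sq_integrable_integrable.
  have iF i : P.-integrable setT (EFin \o (fun w => complex.Re (@sf_coef _ _ _ _ f i * W (@sf_set _ _ _ _ f i) w))).
    have [iX iY] := iXY i.
    have := integrableB measurableT (integrableZl measurableT (complex.Re (@sf_coef _ _ _ _ f i)) iX)
      (integrableZl measurableT (complex.Im (@sf_coef _ _ _ _ f i)) iY).
    by apply: eq_integrable => // w _; rewrite /= cReM.
  rewrite (Rintegral_sumR _ iF) big1// => i _.
  under eq_Rintegral do rewrite cReM.
  have [iX iY] := iXY i.
  rewrite (RintegralB measurableT (integrableZl measurableT (complex.Re (@sf_coef _ _ _ _ f i)) iX)
      (integrableZl measurableT (complex.Im (@sf_coef _ _ _ _ f i)) iY)).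
  rewrite (RintegralZl _ measurableT iX) (RintegralZl _ measurableT iY).
  have [e1 e2] := wn_mean hW (sf_finite i); rewrite !unlock in e1 e2.
  by rewrite /Rintegral e1 e2/= !mulr0 subr0.
rewrite m0 in Zmv *; rewrite (normal_transform_var mZ v0 Zmv)//.
by have [] := Z2.
Qed.

End step_functions.

(** * Stochastic integrals as limits in square mean *)

Section stochastic_integrals.
Context {R : realType} {dS : measure_display} {S : measurableType dS}.
Variables (mu : {measure set S -> \bar R}) (neg : S -> S).
Context {d : measure_display} {Omega : measurableType d}.
Variable P : probability Omega R.
Variable W : set S -> Omega -> R[i].
Hypothesis hW : white_noise mu neg P W.

Lemma cos_dist_le (a b : R) : `|cos a - cos b| <= `|a - b|.
Proof.
pose p := (a + b) / 2; pose q := (a - b) / 2.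
have -> : a = p + q by rewrite /p /q; field.
have -> : b = p - q by rewrite /p /q; field.
rewrite cosD cosB.
have -> : cos p * cos q - sin p * sin q - (cos p * cos q + sin p * sin q) = - (2 * (sin p * sin q)) by ring.
have -> : p + q - (p - q) = 2 * q by ring.
clearbody p q; rewrite normrN !normrM ler_pM2l ?normr_gt0//.
have H : `|sin p| <= 1 by rewrite ler_norml sin_geN1 sin_le1.
by have := norm_sin_le q; apply: le_trans; rewrite ler_piMl.
Qed.

Lemma square_integrable_sqnormc (g : S -> R[i]) : square_integrable mu g ->
  mu.-integrable setT (EFin \o (fun s => sqnormc (g s))).
Proof.
move=> [mR mI fg]; apply: integrable_nonneg => //.
  by apply: measurable_funD; exact: measurable_funX.
by move=> s; exact: sqnormc_ge0.
Qed.

Lemma measurable_sqnormcB (g f : S -> R[i]) :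
  measurable_fun setT (fun s => complex.Re (g s)) ->
  measurable_fun setT (fun s => complex.Im (g s)) ->
  measurable_fun setT (fun s => complex.Re (f s)) ->
  measurable_fun setT (fun s => complex.Im (f s)) ->
  measurable_fun setT (fun s => sqnormc (g s - f s)).
Proof.
move=> gR gI fR fI; rewrite /sqnormc.
apply: measurable_funD; apply: measurable_funX.
  by under eq_fun do rewrite cReB; exact: measurable_funB.
by under eq_fun do rewrite cImB; exact: measurable_funB.
Qed.

Let measurable_PB (f : step_fun mu) (X : Omega -> R) : measurable_fun setT X ->
  measurable_fun setT (fun w => sqnormc (step_integral W f w - (X w)%:C)).
Proof.
move=> mX; have [mR mI] := step_integral_measurable hW f; rewrite /sqnormc.
apply: measurable_funD; apply: measurable_funX.
  by under eq_fun do rewrite cReB cRe_real; exact: measurable_funB.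
by under eq_fun do rewrite cImB cIm_real subr0.
Qed.

Let measurable_SB (f : step_fun mu) (g : S -> R[i]) : square_integrable mu g ->
  measurable_fun setT (fun s => sqnormc (step_val f s - g s)).
Proof.
move=> [mR mI _]; have [fR fI] := step_val_measurable f.
exact: measurable_sqnormcB.
Qed.

(** Convergence in L^2 gives convergence of the transforms through [|y| <= r / 2 + y^2 / (2 r)],
    applied to the difference of the arguments of the cosines, with [r] the prescribed accuracy. *)
Lemma normal_transform_limit (Z : nat -> Omega -> R) (X : Omega -> R) (v : nat -> R) (v0 : R) :
  (forall n, sq_integrable P (Z n)) -> sq_integrable P X ->
  (forall n, normal_transform P (Z n) 0 (v n)) ->
  v n @[n --> \oo] --> v0 ->
  \int[P]_w (Z n w - X w) ^+ 2 @[n --> \oo] --> (0 : R) ->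
  normal_transform P X 0 v0.
Proof.
move=> Z2 X2 Zv vv ZX t u.
have [mX iX] := X2.
have H1 : \int[P]_w cos (t * Z n w + u) @[n --> \oo] -->
    expR (- (v0 * t ^+ 2) / 2) * cos (t * 0 + u).
  under eq_fun do rewrite Zv.
  apply: cvgM; last exact: cvg_cst.
  apply: (cvg_comp _ expR); last exact: continuous_expR.
  apply: cvgM; last exact: cvg_cst.
  by apply: cvgN; apply: cvgM => //; exact: cvg_cst.
have H2 : \int[P]_w cos (t * Z n w + u) @[n --> \oo] --> \int[P]_w cos (t * X w + u).
  apply/cvgrPdist_lt => r r0.
  have k0 : 0 < (t ^+ 2 + 1) / (2 * r).
    by rewrite divr_gt0 ?mulr_gt0// ltr_wpDl ?sqr_ge0.
  have cl : \forall n \near \oo, `|\int[P]_w (Z n w - X w) ^+ 2| < ((t ^+ 2 + 1) / (2 * r))^-1 * (r / 2).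
    by move/cvgr0Pnorm_lt: (ZX); apply; rewrite mulr_gt0 ?invr_gt0// divr_gt0.
  near=> n.
  have cn : `|\int[P]_w (Z n w - X w) ^+ 2| < ((t ^+ 2 + 1) / (2 * r))^-1 * (r / 2) by near: n.
  have [mZ iZ] := Z2 n.
  have [mD iD] : sq_integrable P (fun w => Z n w - X w).
    apply: (sq_integrable_ext (sq_integrableD (Z2 n) (sq_integrableZ (-1) X2))) => w.
    by rewrite mulN1r.
  have icX : P.-integrable setT (EFin \o (fun w => cos (t * X w + u))).
    by apply: bounded_meas_integrable; exact: bounded_meas_cos.
  have icZ : P.-integrable setT (EFin \o (fun w => cos (t * Z n w + u))).
    by apply: bounded_meas_integrable; exact: bounded_meas_cos.
  have icD : P.-integrable setT (EFin \o (fun w => cos (t * X w + u) - cos (t * Z n w + u))).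
    by have := integrableB measurableT icX icZ; apply: eq_integrable.
  rewrite -(RintegralB measurableT icX icZ).
  apply: le_lt_trans (le_normr_Rintegral measurableT icD) _.
  have iB := integrableZl measurableT (t ^+ 2 / (2 * r)) iD.
  have ir : P.-integrable setT (EFin \o (fun=> r / 2)).
    by apply: sq_integrable_integrable; exact: sq_integrable_cst.
  apply: (@le_lt_trans _ _ (\int[P]_w (r / 2 + t ^+ 2 / (2 * r) * (Z n w - X w) ^+ 2))).
    apply: le_Rintegral => //.
    - by have := integrable_norm icD; apply: eq_integrable.
    - by have := integrableD measurableT ir iB; apply: eq_integrable.
    move=> w _; apply: le_trans (cos_dist_le _ _) _.
    have -> : t * X w + u - (t * Z n w + u) = - (t * (Z n w - X w)) by ring.
    rewrite normrN.
    have -> : t ^+ 2 / (2 * r) * (Z n w - X w) ^+ 2 = (t * (Z n w - X w)) ^+ 2 / (2 * r) by field; rewrite gt_eqF.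
    set y := t * _; rewrite -[y ^+ 2]real_normK ?num_real//.
    have : 0 <= (`|y| - r) ^+ 2 / (2 * r) by rewrite divr_ge0 ?sqr_ge0// mulr_ge0// ltW.
    have -> : (`|y| - r) ^+ 2 / (2 * r) = `|y| ^+ 2 / (2 * r) + r / 2 - `|y| by field; rewrite gt_eqF.
    lra.
  rewrite (RintegralD measurableT ir iB) Rintegral_probability_cst.
  rewrite (RintegralZl (t ^+ 2 / (2 * r)) measurableT iD).
  have I0 : 0 <= \int[P]_w (Z n w - X w) ^+ 2 by apply: Rintegral_ge0 => // w _; exact: sqr_ge0.
  rewrite ger0_norm// ltr_pdivlMl// in cn.
  move: cn I0; set J := Rintegral _ _ _ => cn I0.
  have : t ^+ 2 / (2 * r) * J <= (t ^+ 2 + 1) / (2 * r) * J.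
    by rewrite ler_wpM2r// ler_pM2r ?invr_gt0 ?mulr_gt0// lerDl.
  lra.
exact: (cvg_unique _ H2 H1).
Unshelve. all: end_near. Qed.

(** The isometry passes to the limit from the Gram sums. As [X] is real, the real parts of the step
    integrals are at least as close to it as the integrals themselves, and these real parts are
    Gaussian. *)
Lemma stochastic_integral_transform (g : S -> R[i]) (X : Omega -> R) :
  square_integrable mu g -> measurable_fun setT X -> stochastic_integral mu P W g X ->
  sq_integrable P X /\ normal_transform P X 0 (\int[mu]_s sqnormc (g s)).
Proof.
move=> g2 mX [f [cS cP]]; rewrite unlock in cP.
have [iD cD] := @integral_cvg0_real _ _ _ mu (fun n s => sqnormc (step_val (f n) s - g s))
  (fun n => measurable_SB (f n) g2) (fun n s => sqnormc_ge0 _) cS.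
have [iC cC] := @integral_cvg0_real _ _ _ P (fun n w => sqnormc (step_integral W (f n) w - (X w)%:C))
  (fun n => measurable_PB (f n) mX) (fun n s => sqnormc_ge0 _) cP.
have ig := square_integrable_sqnormc g2.
have sqX w : sqnormc (X w)%:C = X w ^+ 2 by rewrite /sqnormc cRe_real cIm_real expr0n addr0.
(* A single step integral at finite distance from [X] suffices for the square integrability of
   [X]. *)
have iX : P.-integrable setT (EFin \o (fun w => X w ^+ 2)).
  have [N _ /(_ N (leqnn N)) iCN] := iC.
  have [iIN _] := step_integral_gram hW (f N).
  have iB := integrableD measurableT (integrableZl measurableT (1 + 1) iIN) (integrableZl measurableT (1 + 1^-1) iCN).
  apply: le_integrable iB => //.
    by apply/measurable_EFinP; exact: measurable_funX.
  move=> w _ /=; rewrite lee_fin !ger0_norm ?sqr_ge0//; last first.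
    by rewrite addr_ge0// mulr_ge0 ?sqnormc_ge0// addr_ge0// invr_ge0.
  by rewrite -sqX [in leRHS]sqnormcC; apply: sqnormc_close.
have cI : \int[P]_w sqnormc (step_integral W (f n) w) @[n --> \oo] --> \int[P]_w X w ^+ 2.
  apply: (@sq_close_cvg _ _ _ P (fun n w => sqnormc (step_integral W (f n) w))
    (fun n w => sqnormc (step_integral W (f n) w - (X w)%:C))) => //.
  - by move=> n; have [] := step_integral_gram hW (f n).
  - by move=> w; exact: sqr_ge0.
  - by move=> n w; exact: sqnormc_ge0.
  - move=> e n w e0; rewrite -sqX; split; first exact: sqnormc_close.
    by rewrite [X in _ + _ * X]sqnormcC; exact: sqnormc_close.
have cJ : \int[mu]_s sqnormc (step_val (f n) s) @[n --> \oo] --> \int[mu]_s sqnormc (g s).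
  apply: (@sq_close_cvg _ _ _ mu (fun n s => sqnormc (step_val (f n) s))
    (fun n s => sqnormc (step_val (f n) s - g s))) => //.
  - by move=> n; have [] := step_val_gram (f n).
  - by move=> w; exact: sqnormc_ge0.
  - by move=> n w; exact: sqnormc_ge0.
  - move=> e n w e0; split; first exact: sqnormc_close.
    by rewrite [X in _ + _ * X]sqnormcC; exact: sqnormc_close.
have vE : \int[P]_w X w ^+ 2 = \int[mu]_s sqnormc (g s).
  move: cI; under eq_fun do rewrite (step_integral_gram hW _).2 -(step_val_gram _).2.
  by move=> cI; exact: (cvg_unique _ cI cJ).
split; first by split.
pose Z n w := complex.Re (step_integral W (f n) w).
have Z2 n : sq_integrable P (Z n) by have [] := step_integral_gaussian hW (f n).
have sqZ n w : (Z n w - X w) ^+ 2 <= sqnormc (step_integral W (f n) w - (X w)%:C).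
  by rewrite /sqnormc cReB cRe_real lerDl sqr_ge0.
have iZX n : P.-integrable setT (EFin \o (fun w => (Z n w - X w) ^+ 2)).
  have X2 : sq_integrable P X by split.
  have [_] := sq_integrableD (Z2 n) (sq_integrableZ (-1) X2).
  by apply: eq_integrable => // w _; rewrite /= mulN1r.
have cZ : \int[P]_w (Z n w - X w) ^+ 2 @[n --> \oo] --> (0 : R).
  have K0 : (cst 0 : nat -> R) n @[n --> \oo] --> (0 : R) by exact: cvg_cst.
  apply: (squeeze_cvgr _ K0 cC); near=> n; apply/andP; split.
    by apply: Rintegral_ge0 => // w _; exact: sqr_ge0.
  by apply: le_Rintegral => //; near: n.
have cv : \int[P]_w Z n w ^+ 2 @[n --> \oo] --> \int[P]_w X w ^+ 2.
  apply: (@sq_close_cvg _ _ _ P (fun n w => Z n w ^+ 2) (fun n w => (Z n w - X w) ^+ 2)) => //.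
  - by move=> n; have [] := Z2 n.
  - exact: nearW.
  - by move=> w; exact: sqr_ge0.
  - by move=> n w; exact: sqr_ge0.
  - move=> e n w e0; split; first exact: sqr_close.
    by rewrite -[X in _ + _ * X]sqrrN opprB; exact: sqr_close.
rewrite -vE.
apply: (normal_transform_limit Z2 _ _ cv cZ); first by split.
by move=> n; have [] := step_integral_gaussian hW (f n).
Unshelve. all: end_near. Qed.

Definition step_lin (a : R) (f f' : step_fun mu) : step_fun mu.
Proof.
refine (@StepFun _ _ _ mu (sf_size f + sf_size f')
  (fun k => match fintype.split k with inl i => a%:C * sf_coef i | inr i => sf_coef i end)
  (fun k => match fintype.split k with inl i => @sf_set _ _ _ _ f i | inr i => @sf_set _ _ _ _ f' i end) _).
by move=> k; case: (fintype.split k) => i; exact: sf_finite.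
Defined.

Lemma step_lin_sum (a : R) (f f' : step_fun mu) (ev : set S -> R[i]) :
  \sum_(i < sf_size (step_lin a f f')) sf_coef i * ev (sf_set i) =
  a%:C * (\sum_(i < sf_size f) sf_coef i * ev (sf_set i)) +
  \sum_(i < sf_size f') sf_coef i * ev (sf_set i).
Proof.
rewrite /step_lin/= big_split_ord/= mulr_sumr; congr (_ + _); apply: eq_bigr => i _.
  have -> : fintype.split (lshift (sf_size f') i) = inl i by exact: (unsplitK (inl i)).
  by rewrite mulrA.
by have -> : fintype.split (rshift (sf_size f) i) = inr i by exact: (unsplitK (inr i)).
Qed.

Lemma stochastic_integral0 : stochastic_integral mu P W (fun=> 0) (fun=> 0).
Proof.
pose f0 : step_fun mu := @StepFun _ _ _ mu 0 (fun=> 0) (fun=> set0)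
  (fun i => match i with Ordinal _ H => False_ind _ (notF H) end).
exists (fun=> f0); rewrite unlock; split.
  under eq_fun do under eq_integral do rewrite /step_val big_ord0 subr0 /sqnormc/= expr0n addr0.
  by under eq_fun do rewrite integral0; exact: cvg_cst.
under eq_fun do under eq_integral do rewrite /step_integral big_ord0 subr0 /sqnormc/= expr0n addr0.
by under eq_fun do rewrite integral0; exact: cvg_cst.
Qed.

Let cvg_lin (a b : nat -> \bar R) (k : R) : 0 <= k ->
  a n @[n --> \oo] --> (0 : \bar R)%E -> b n @[n --> \oo] --> (0 : \bar R)%E ->
  (k%:E * a n + 2%:E * b n)%E @[n --> \oo] --> (0 : \bar R)%E.
Proof.
move=> k0 a0 b0; rewrite -[X in _ --> X](adde0 0%E).
apply: cvgeD => //.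
  by rewrite -[X in _ --> X](mule0 k%:E); apply: cvgeZl.
by rewrite -[X in _ --> X](mule0 2%:E); apply: cvgeZl.
Qed.

Lemma stochastic_integral_lin (a : R) (g g' : S -> R[i]) (X X' : Omega -> R) :
  square_integrable mu g -> square_integrable mu g' ->
  measurable_fun setT X -> measurable_fun setT X' ->
  stochastic_integral mu P W g X -> stochastic_integral mu P W g' X' ->
  stochastic_integral mu P W (fun s => a%:C * g s + g' s) (fun w => a * X w + X' w).
Proof.
move=> g2 g2' mX mX' [f [cS cP]] [f' [cS' cP']].
exists (fun n => step_lin a (f n) (f' n)); rewrite unlock in cP cP' *.
have k0 : 0 <= 2 * a ^+ 2 by rewrite mulr_ge0// sqr_ge0.
have [gR gI _] := g2; have [gR' gI' _] := g2'.
have K0 : (cst 0%E : nat -> \bar R) n @[n --> \oo] --> (0 : \bar R)%E by exact: cvg_cst.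
split.
- apply: (squeeze_cvge _ K0 (cvg_lin k0 cS cS')).
  apply: nearW => n; apply/andP; split.
    by apply: integral_ge0 => s _; rewrite lee_fin sqnormc_ge0.
  have m1 := measurable_SB (f n) g2; have m2 := measurable_SB (f' n) g2'.
  have em1 : measurable_fun setT (fun s => (sqnormc (step_val (f n) s - g s))%:E) by exact/measurable_EFinP.
  have em2 : measurable_fun setT (fun s => (sqnormc (step_val (f' n) s - g' s))%:E) by exact/measurable_EFinP.
  rewrite -ge0_integralZl//; try (by rewrite lee_fin); try (by move=> s _; rewrite lee_fin sqnormc_ge0).
  rewrite -ge0_integralZl//; try (by rewrite lee_fin); try (by move=> s _; rewrite lee_fin sqnormc_ge0).
  rewrite -ge0_integralD//; first last.
  + by apply: measurable_funeM.
  + by move=> s _; rewrite -EFinM lee_fin mulr_ge0// sqnormc_ge0.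
  + by apply: measurable_funeM.
  + by move=> s _; rewrite -EFinM lee_fin mulr_ge0// sqnormc_ge0.
  apply: ge0_le_integral => //.
  + by move=> s _; rewrite lee_fin sqnormc_ge0.
  + apply/measurable_EFinP.
    have [R1 I1] := step_val_measurable (step_lin a (f n) (f' n)).
    apply: measurable_sqnormcB => //.
      by under eq_fun do rewrite cReD cReM cRe_real cIm_real; apply: measurable_funD => //; apply: measurable_funB; exact: measurable_funM.
    by under eq_fun do rewrite cImD cImM cRe_real cIm_real; apply: measurable_funD => //; apply: measurable_funD; exact: measurable_funM.
  + by apply: emeasurable_funD; exact: measurable_funeM.
  + move=> s _; rewrite -!EFinM -EFinD lee_fin.
    apply: le_trans (sqnormcZD_le _ _ _); rewrite le_eqVlt; apply/orP; left; apply/eqP; congr sqnormc.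
    rewrite /step_val (step_lin_sum a (f n) (f' n) (fun A => (\1_A s)%:C)); ring.
- apply: (squeeze_cvge _ K0 (cvg_lin k0 cP cP')).
  apply: nearW => n; apply/andP; split.
    by apply: integral_ge0 => s _; rewrite lee_fin sqnormc_ge0.
  have m1 := measurable_PB (f n) mX; have m2 := measurable_PB (f' n) mX'.
  have em1 : measurable_fun setT (fun w => (sqnormc (step_integral W (f n) w - (X w)%:C))%:E) by exact/measurable_EFinP.
  have em2 : measurable_fun setT (fun w => (sqnormc (step_integral W (f' n) w - (X' w)%:C))%:E) by exact/measurable_EFinP.
  rewrite -ge0_integralZl//; try (by rewrite lee_fin); try (by move=> s _; rewrite lee_fin sqnormc_ge0).
  rewrite -ge0_integralZl//; try (by rewrite lee_fin); try (by move=> s _; rewrite lee_fin sqnormc_ge0).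
  rewrite -ge0_integralD//; first last.
  + by apply: measurable_funeM.
  + by move=> s _; rewrite -EFinM lee_fin mulr_ge0// sqnormc_ge0.
  + by apply: measurable_funeM.
  + by move=> s _; rewrite -EFinM lee_fin mulr_ge0// sqnormc_ge0.
  apply: ge0_le_integral => //.
  + by move=> s _; rewrite lee_fin sqnormc_ge0.
  + apply/measurable_EFinP; apply: measurable_PB.
    by apply: measurable_funD => //; exact: measurable_funM.
  + by apply: emeasurable_funD; exact: measurable_funeM.
  + move=> w _; rewrite -!EFinM -EFinD lee_fin.
    apply: le_trans (sqnormcZD_le _ _ _); rewrite le_eqVlt; apply/orP; left; apply/eqP; congr sqnormc.
    rewrite /step_integral (step_lin_sum a (f n) (f' n) (fun A => W A w)).
    by rewrite rmorphD rmorphM/=; ring.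
Qed.

(** The real part of the Hermitian product in L^2; it is the whole covariance because the integrals
    are real. *)
Definition re_inner {J : Type} (g : J -> S -> R[i]) (j k : J) : R :=
  \int[mu]_s (complex.Re (g j s) * complex.Re (g k s) +
              complex.Im (g j s) * complex.Im (g k s)).

Lemma integrable_re_inner (g g' : S -> R[i]) :
  square_integrable mu g -> square_integrable mu g' ->
  mu.-integrable setT (EFin \o (fun s => complex.Re (g s) * complex.Re (g' s) +
              complex.Im (g s) * complex.Im (g' s))).
Proof.
move=> g2 g2'; have [gR gI _] := g2; have [gR' gI' _] := g2'.
apply: le_integrable (integrableD measurableT (square_integrable_sqnormc g2) (square_integrable_sqnormc g2')) => //.
  by apply/measurable_EFinP; apply: measurable_funD; exact: measurable_funM.
move=> s _ /=; rewrite lee_fin [leRHS]ger0_norm; last by rewrite addr_ge0 ?sqnormc_ge0.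
rewrite /sqnormc.
set p := complex.Re (g s); set q := complex.Im (g s).
set p' := complex.Re (g' s); set q' := complex.Im (g' s).
have := sqr_ge0 (p - p'); have := sqr_ge0 (q - q').
have := sqr_ge0 (p + p'); have := sqr_ge0 (q + q').
have := sqr_ge0 p; have := sqr_ge0 q; have := sqr_ge0 p'; have := sqr_ge0 q'.
by rewrite ler_norml => ? ? ? ? ? ? ? ?; apply/andP; split; nra.
Qed.

(** By linearity a combination of the integrals is the integral of [G s]; its variance, the squared
    norm of [G s], expands into the quadratic form of [re_inner g]. *)
Lemma stochastic_integral_kernel {J : Type} (g : J -> S -> R[i]) (X : J -> Omega -> R) :
  (forall j, square_integrable mu (g j)) -> (forall j, measurable_fun setT (X j)) ->
  (forall j, stochastic_integral mu P W (g j) (X j)) ->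
  gaussian_kernel P X (re_inner g).
Proof.
move=> g2 mX gX.
split; first by move=> j; have [] := stochastic_integral_transform (g2 j) (mX j) (gX j).
pose G (s : seq (R * J)) (x : S) : R[i] := \sum_(p <- s) p.1%:C * g p.2 x.
have Gq s : mu.-integrable setT (EFin \o (fun x => sqnormc (G s x))) /\
    \int[mu]_x sqnormc (G s x) = quad_form (re_inner g) s.
  pose F (p q : R * J) x := complex.Re (g p.2 x) * complex.Re (g q.2 x) +
     complex.Im (g p.2 x) * complex.Im (g q.2 x).
  have E x : sqnormc (G s x) = \sum_(p <- s) \sum_(q <- s) p.1 * q.1 * F p q x.
    rewrite /sqnormc /G cRe_sum cIm_sum !expr2 !big_distrlr/= -big_split/=.
    apply: eq_bigr => p _; rewrite -big_split/=; apply: eq_bigr => q _.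
    by rewrite !complexE /F; ring.
  have iF p q : mu.-integrable setT (EFin \o F p q) by exact: integrable_re_inner.
  have iF2 p q : mu.-integrable setT (EFin \o (fun x => p.1 * q.1 * F p q x)).
    by have := integrableZl measurableT (p.1 * q.1) (iF p q); apply: eq_integrable.
  have iF3 p : mu.-integrable setT (EFin \o (fun x => \sum_(q <- s) p.1 * q.1 * F p q x)).
    exact: integrable_sumR.
  split.
    by have := integrable_sumR s iF3; apply: eq_integrable => // x _; rewrite /= E.
  under eq_Rintegral do rewrite E.
  rewrite (Rintegral_sumR _ iF3); apply: eq_bigr => p _.
  rewrite (Rintegral_sumR _ (iF2 p)); apply: eq_bigr => q _.
  by rewrite (RintegralZl (p.1 * q.1) measurableT (iF p q)).
have mG s : measurable_fun setT (fun x => complex.Re (G s x)) /\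
    measurable_fun setT (fun x => complex.Im (G s x)).
  split; rewrite /G.
    under eq_fun do rewrite cRe_sum; apply: measurable_sum => p; have [gR gI _] := g2 p.2.
    by under eq_fun do rewrite cReM cRe_real cIm_real; apply: measurable_funB; exact: measurable_funM.
  under eq_fun do rewrite cIm_sum; apply: measurable_sum => p; have [gR gI _] := g2 p.2.
  by under eq_fun do rewrite cImM cRe_real cIm_real; apply: measurable_funD; exact: measurable_funM.
have G2 s : square_integrable mu (G s).
  have [? ?] := mG s; split=> //.
  have [/integrableP[_ +] _] := Gq s.
  by apply: le_lt_trans; rewrite le_eqVlt; apply/orP; left; apply/eqP;
     apply: eq_integral => x _; rewrite /= ger0_norm// sqnormc_ge0.
have mL s : measurable_fun setT (lincomb s X).
  by apply: measurable_sum => p; exact: measurable_funM.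
have GL s : stochastic_integral mu P W (G s) (lincomb s X).
  elim: s => [|p s IH].
    have -> : G [::] = (fun=> 0) by apply/funext => x; rewrite /G big_nil.
    have -> : lincomb [::] X = (fun=> 0) by apply/funext => x; rewrite /lincomb big_nil.
    exact: stochastic_integral0.
  have -> : G (p :: s) = (fun x => p.1%:C * g p.2 x + G s x).
    by apply/funext => x; rewrite /G big_cons.
  have -> : lincomb (p :: s) X = (fun w => p.1 * X p.2 w + lincomb s X w).
    by apply/funext => x; rewrite /lincomb big_cons.
  exact: stochastic_integral_lin.
move=> s u; have [_ L] := stochastic_integral_transform (G2 s) (mL s) (GL s).
have := L 1 u; rewrite (Gq s).2 expr1n mulr1 mulr0 add0r => <-.
by apply: eq_Rintegral => w _; rewrite mul1r.
Qed.

Lemma scaled_stochastic_integral_kernel {J : Type} (g : J -> S -> R[i]) (a : J -> R)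
    (X : J -> {RV P >-> R}) :
  (forall j, square_integrable mu (g j)) ->
  (forall j, scaled_stochastic_integral mu P W (a j) (g j) (X j)) ->
  gaussian_kernel P (fun j => X j : Omega -> R) (fun j k => a j * a k * re_inner g j k).
Proof.
move=> g2 gX.
have exZ j : exists Z : {RV P >-> R},
    stochastic_integral mu P W (g j) Z /\ {ae P, forall w, X j w = a j * Z w}.
  by have [Z HZ1 HZ2] := gX j; exists Z.
have [Z HZ] := choice exZ.
have ZK := @stochastic_integral_kernel J g Z g2 (fun j => measurable_funP (Z j)) (fun j => (HZ j).1).
have := gk_ae (gk_lincomb (fun j => [:: (a j, j)]) ZK) (fun j => measurable_funP (X j)).
have H j : {ae P, forall w, lincomb [:: (a j, j)] (fun j => Z j : Omega -> R) w = X j w}.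
  by have [_] := HZ j; apply: filterS => w ->; rewrite lincomb1.
move=> /(_ H); congr gaussian_kernel; apply/funext => j; apply/funext => k.
by rewrite /lincomb_kernel !big_seq1.
Qed.

End stochastic_integrals.

(** * Gaussian fields with a given variogram *)

Section polarization.
Context {R : realType}.

(* If a centred process vanishes at 0 and its increments over [x', x] have variance
   [phi (x - x')], then [polar phi x x'] is the covariance of its values and
   [dpolar phi u x u' x'] that of its increments over [u, x] and [u', x']. *)
Definition polar (phi : R -> R) (x x' : R) : R := (phi x + phi x' - phi (x - x')) / 2.

Definition dpolar (phi : R -> R) (u x u' x' : R) : R :=
  (phi (x - u') + phi (u - x') - phi (x - x') - phi (u - u')) / 2.

(** For a field null on the axes, [v z w] plays the part of the variance of the increment over a
    rectangle with sides [z] and [w]; polarizing in each variable yields the covariance of the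
    values at two points. *)
Definition field_kernel (v : R -> R -> R) (x y x' y' : R) : R :=
  polar (fun z => polar (v z) y y') x x'.

(* The list of the corners of a rectangle, with the signs of [incr]. *)
Definition corners (j : (R * R) * (R * R)) : seq (R * (R * R)) :=
  [:: (1, (j.2.1, j.2.2)); (-1, (j.1.1, j.2.2)); (-1, (j.2.1, j.1.2)); (1, (j.1.1, j.1.2))].

Definition rect_kernel (v : R -> R -> R) (j k : (R * R) * (R * R)) : R :=
  dpolar (fun z => dpolar (v z) j.1.2 j.2.2 k.1.2 k.2.2) j.1.1 j.2.1 k.1.1 k.2.1.

Lemma polar_dpolar (phi : R -> R) (u x u' x' : R) :
  polar phi x x' - polar phi u x' - polar phi x u' + polar phi u u' =
  dpolar phi u x u' x'.
Proof. by rewrite /polar /dpolar; field. Qed.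

Lemma dpolarZ k (phi : R -> R) (u x u' x' : R) :
  dpolar (fun t => k * phi t) u x u' x' = k * dpolar phi u x u' x'.
Proof. by rewrite /dpolar; field. Qed.

Lemma corners_kernel (v : R -> R -> R) j k :
  lincomb_kernel corners (fun p q => field_kernel v p.1 p.2 q.1 q.2) j k =
  rect_kernel v j k.
Proof.
case: j => -[u w] [x y]; case: k => -[u' w'] [x' y'].
rewrite /lincomb_kernel !big_cons !big_nil/= !addr0 /rect_kernel/=.
rewrite -polar_dpolar.
rewrite /field_kernel.
set a := polar (fun z => dpolar _ _ _ _ _) x x'.
set b := polar (fun z => dpolar _ _ _ _ _) u x'.
set c := polar (fun z => dpolar _ _ _ _ _) x u'.
set e := polar (fun z => dpolar _ _ _ _ _) u u'.
have E s t : polar (fun z => dpolar (v z) w y w' y') s t =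
    polar (fun z => polar (v z) y y') s t - polar (fun z => polar (v z) w y') s t -
    polar (fun z => polar (v z) y w') s t + polar (fun z => polar (v z) w w') s t.
  by rewrite /polar /dpolar; field.
by rewrite /a /b /c /e !E; ring.
Qed.

End polarization.

Section gaussian_fields.
Context {R : realType} {d : measure_display} {Omega : measurableType d}.
Variable P : probability Omega R.
Implicit Types (V : R -> R -> {RV P >-> R}) (v : R -> R -> R).

Let quad : set (R * R) := closed_quadrant.

(* Absolute values extend the field to the index set R x R. *)
Definition abs_field V (p : R * R) (w : Omega) : R := V `|p.1| `|p.2| w.

Definition gaussian_field V v : Prop :=
  gaussian_kernel P (abs_field V)
    (fun p q => field_kernel v `|p.1| `|p.2| `|q.1| `|q.2|).

Lemma abs_fieldE V p : quad p -> abs_field V p = V p.1 p.2.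
Proof. by move=> [p1 p2]; rewrite /abs_field !ger0_norm. Qed.

Lemma fdd_eq_ext {d' : measure_display} {Omega' : measurableType d'}
    (P' : probability Omega' R) {I : Type} (D : set I)
    (X X' : I -> Omega -> R) (Y Y' : I -> Omega' -> R) :
  (forall i, D i -> X i = X' i) -> (forall i, D i -> Y i = Y' i) ->
  fdd_eq P P' D X Y -> fdd_eq P P' D X' Y'.
Proof.
move=> XX YY H n t A Dt mA; have := H n t A Dt mA.
have -> : [set w | A [tuple X (t i) w | i < n]] = [set w | A [tuple X' (t i) w | i < n]].
  apply/seteqP; split=> w /=; (rewrite (_ : [tuple X (t i) w | i < n] = [tuple X' (t i) w | i < n])//;
    apply: eq_from_tnth => i; rewrite !tnth_mktuple XX//).
have -> // : [set w | A [tuple Y (t i) w | i < n]] = [set w | A [tuple Y' (t i) w | i < n]].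
apply/seteqP; split=> w /=; (rewrite (_ : [tuple Y (t i) w | i < n] = [tuple Y' (t i) w | i < n])//;
    apply: eq_from_tnth => i; rewrite !tnth_mktuple YY//).
Qed.

Lemma gaussian_field_zero_mean V v : gaussian_field V v -> zero_mean V.
Proof.
move=> GV x y x0 y0; have iV := sq_integrable_integrable (gk_sq GV (x, y)).
have := gk_mean (x, y) GV; rewrite abs_fieldE// in iV *.
by rewrite expectation_def /Rintegral => H; rewrite -[LHS]fineK ?H//; exact: integrable_fin_num.
Qed.

Lemma gaussian_field_finite_variance V v : gaussian_field V v -> finite_variance V.
Proof.
move=> GV x y x0 y0; have [mV iV] := gk_sq GV (x, y).
have EV := gaussian_field_zero_mean GV x0 y0.
rewrite /variance unlock EV/= expectation.unlock.
have := integrable_fin_num measurableT iV; rewrite fin_numE ltey => /andP[_].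
have -> // : (\int[P]_w (((V x y \- cst 0) * (V x y \- cst 0))%R w)%:E =
  \int[P]_w (EFin \o (fun w => abs_field V (x, y) w ^+ 2)%R) w)%E.
by apply: eq_integral => w _; rewrite abs_fieldE//= expr2 /GRing.mul/= /cst subr0.
Qed.

Lemma gaussian_field_null_on_axes V v : (forall z, v z 0 = 0) -> (forall z, v 0 z = 0) ->
  gaussian_field V v -> null_on_axes V.
Proof.
move=> v1 v2 GV t t0; split.
  have := gk_null (i := (t, 0)) GV; rewrite abs_fieldE//=; apply.
  by rewrite /field_kernel /polar/= normr0 subrr !v1; field.
have := gk_null (i := (0, t)) GV; rewrite abs_fieldE//=; apply.
by rewrite /field_kernel /polar /= normr0 !subrr !v2; lra.
Qed.

(** Polarization evaluates [v] also at differences of coordinates, which can be negative: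
    homogeneity is therefore assumed for all [z] and [w]. *)
Lemma gaussian_field_operator_scaling V v gamma H : gaussian_field V v ->
  (forall lambda, 0 < lambda -> forall z w,
     v (lambda * z) (lambda `^ gamma * w) = (lambda `^ H) ^+ 2 * v z w) ->
  operator_scaling V gamma H.
Proof.
move=> GV Hv l l0.
have lg0 : 0 < l `^ gamma by exact: powR_gt0.
have G1 := gk_lincomb (fun p : R * R => [:: (1, (l * p.1, l `^ gamma * p.2))]) GV.
have G2 := gk_lincomb (fun p : R * R => [:: (l `^ H, p)]) GV.
apply: fdd_eq_ext (gk_fdd (D := quad) G1 G2 _).
- move=> p [p1 p2]; apply/funext => w; rewrite lincomb1 mul1r abs_fieldE//.
  by split; rewrite mulr_ge0// ltW.
- by move=> p Dp; apply/funext => w; rewrite lincomb1 abs_fieldE.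
- move=> p q [p1 p2] [q1 q2]; rewrite /lincomb_kernel !big_seq1/= !mul1r.
  rewrite !normrM (gtr0_norm l0) (gtr0_norm lg0) !ger0_norm//.
  by rewrite /field_kernel /polar -!mulrBr !Hv//; ring.
Qed.

Lemma gk_incr V v : gaussian_field V v ->
  gaussian_kernel P (fun j => lincomb (corners j) (abs_field V))
    (lincomb_kernel corners (fun p q => field_kernel v `|p.1| `|p.2| `|q.1| `|q.2|)).
Proof. by move=> GV; exact: (gk_lincomb corners GV). Qed.

Definition nonneg_rect (j : (R * R) * (R * R)) : Prop :=
  [/\ 0 <= j.1.1, 0 <= j.1.2, 0 <= j.2.1 & 0 <= j.2.2].

Lemma incr_corners V u z x y : nonneg_rect ((u, z), (x, y)) ->
  lincomb (corners ((u, z), (x, y))) (abs_field V) = incr V u z x y.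
Proof.
move=> [/= u0 z0 x0 y0]; apply/funext => w.
rewrite /lincomb !big_cons !big_nil/= !mulN1r !mul1r addr0 /abs_field/= !ger0_norm//.
by rewrite /incr !addrA.
Qed.

Lemma incr_kernel v j k : nonneg_rect j -> nonneg_rect k ->
  lincomb_kernel corners (fun p q => field_kernel v `|p.1| `|p.2| `|q.1| `|q.2|) j k =
  rect_kernel v j k.
Proof.
move=> [j1 j2 j3 j4] [k1 k2 k3 k4]; rewrite -corners_kernel.
by rewrite /lincomb_kernel !big_cons !big_nil/= !ger0_norm.
Qed.

(** [dpolar] depends on the endpoints only through their differences, which a translation leaves
    unchanged. *)
Lemma gaussian_field_stationary V v : gaussian_field V v -> stationary_increments V.
Proof.
move=> GV u z u0 z0.
have GI := gk_incr GV.
have G1 := gk_lincomb (fun p : R * R => [:: (1, ((u, z), p))]) GI.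
have G2 := gk_lincomb (fun p : R * R => [:: (1, ((0, 0), (p.1 - u, p.2 - z)))]) GI.
have n1 (p : R * R) : u <= p.1 -> z <= p.2 -> nonneg_rect ((u, z), p).
  by move=> p1 p2; split=> /=; rewrite ?ltW// (lt_le_trans _ p1, lt_le_trans _ p2).
have n2 (p : R * R) : u <= p.1 -> z <= p.2 -> nonneg_rect ((0, 0), (p.1 - u, p.2 - z)).
  by move=> p1 p2; split=> //=; rewrite subr_ge0.
apply: fdd_eq_ext (gk_fdd (D := [set p : R * R | u <= p.1 /\ z <= p.2]) G1 G2 _).
- move=> [x y] [/= p1 p2]; apply/funext => w; rewrite lincomb1 mul1r incr_corners//.
  exact: (n1 (x, y)).
- move=> [x y] [/= p1 p2]; apply/funext => w; rewrite lincomb1 mul1r incr_corners//.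
  exact: (n2 (x, y)).
- move=> p q [p1 p2] [q1 q2]; set K := lincomb_kernel corners _; rewrite /lincomb_kernel !big_seq1 !mul1r {}/K.
  rewrite !incr_kernel; [|exact: n2..|exact: n1|exact: n1].
  rewrite /rect_kernel /dpolar/=.
  have E a b c : a - c - (b - c) = a - b :> R by ring.
  have E' a c : 0 - (a - c) = c - a :> R by ring.
  by rewrite !E !E' !subrr !subr0.
Qed.

(** Rectangles are open on the left and below, so the lower corner may lie on an axis; a negative
    coordinate, however, would bring a point of an axis into the rectangle. *)
Lemma rect_subset_quadrant (u z x y : R) : u < x -> z < y ->
  rect u z x y `<=` quadrant -> nonneg_rect ((u, z), (x, y)).
Proof.
move=> ux zy H.
have [/= x0 y0] : quadrant (x, y) by apply: H; split; rewrite /= in_itv/= lexx ?ux ?zy.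
have u0 : 0 <= u.
  rewrite leNgt; apply/negP => u0.
  have [/=] : quadrant (0, y); last by rewrite ltxx.
  by apply: H; split; rewrite /= in_itv/=; [rewrite u0 ltW|rewrite zy lexx].
have z0 : 0 <= z.
  rewrite leNgt; apply/negP => z0.
  have [/= _] : quadrant (x, 0); last by rewrite ltxx.
  by apply: H; split; rewrite /= in_itv/=; [rewrite ux lexx|rewrite z0 ltW].
by split=> //=; rewrite ltW.
Qed.

Lemma gaussian_field_independent V v (u z x y u' z' x' y' : R) : gaussian_field V v ->
  nonneg_rect ((u, z), (x, y)) -> nonneg_rect ((u', z'), (x', y')) ->
  rect_kernel v ((u, z), (x, y)) ((u', z'), (x', y')) = 0 ->
  rect_kernel v ((u', z'), (x', y')) ((u, z), (x, y)) = 0 ->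
  independent_rv P (incr V u z x y) (incr V u' z' x' y').
Proof.
move=> GV n1 n2 K1 K2.
have := gk_independent (i := ((u, z), (x, y))) (j := ((u', z'), (x', y'))) (gk_incr GV).
by rewrite !incr_corners// !incr_kernel//; apply.
Qed.

Lemma gaussian_field_independent_kernel V v (u z x y u' z' x' y' : R) : gaussian_field V v ->
  nonneg_rect ((u, z), (x, y)) -> nonneg_rect ((u', z'), (x', y')) ->
  rect_kernel v ((u, z), (x, y)) ((u', z'), (x', y')) =
  rect_kernel v ((u', z'), (x', y')) ((u, z), (x, y)) ->
  independent_rv P (incr V u z x y) (incr V u' z' x' y') ->
  rect_kernel v ((u, z), (x, y)) ((u', z'), (x', y')) = 0.
Proof.
move=> GV n1 n2 K1 ind.
have := gk_independent_kernel (i := ((u, z), (x, y))) (j := ((u', z'), (x', y'))) (gk_incr GV).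
by rewrite !incr_corners// !incr_kernel//; apply.
Qed.

(** The difference of two increments is regarded as a family with a single index, so that [gk_null]
    and [gk_kernel_null] relate its almost sure vanishing to its variance. *)
Lemma gk_incr_diff V v j k : gaussian_field V v -> nonneg_rect j -> nonneg_rect k ->
  gaussian_kernel P (fun _ : unit => lincomb [:: (1, j); (-1, k)]
      (fun j => lincomb (corners j) (abs_field V)))
    (fun _ _ => rect_kernel v j j - rect_kernel v j k - rect_kernel v k j + rect_kernel v k k).
Proof.
move=> GV nj nk; have := gk_lincomb (fun _ : unit => [:: (1, j); (-1, k)]) (gk_incr GV).
congr gaussian_kernel; apply/funext => t1; apply/funext => t2.
set K := lincomb_kernel corners _; rewrite /lincomb_kernel !big_cons !big_nil/= {}/K !incr_kernel//.
ring.
Qed.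

Lemma gaussian_field_invariant V v (u z x y u' z' x' y' : R) : gaussian_field V v ->
  nonneg_rect ((u, z), (x, y)) -> nonneg_rect ((u', z'), (x', y')) ->
  let j := ((u, z), (x, y)) in let k := ((u', z'), (x', y')) in
  rect_kernel v j j - rect_kernel v j k - rect_kernel v k j + rect_kernel v k k = 0 <->
  {ae P, forall w, incr V u z x y w = incr V u' z' x' y' w}.
Proof.
move=> GV n1 n2 j k; have GD := gk_incr_diff GV n1 n2.
have E w : lincomb [:: (1, j); (-1, k)] (fun j => lincomb (corners j) (abs_field V)) w =
    incr V u z x y w - incr V u' z' x' y' w.
  by rewrite [LHS]/lincomb !big_cons !big_nil/= !incr_corners// addr0 mul1r mulN1r.
split=> [K0|H].
  have := gk_null (i := tt) GD K0; apply: filterS => w; rewrite E => /eqP.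
  by rewrite subr_eq0 => /eqP.
apply: (gk_kernel_null (i := tt) GD); apply: filterS H => w; rewrite E => ->.
by rewrite subrr.
Qed.

Lemma separated_ord (a b a' b' s : R) : a < b -> a' < b' ->
  (forall t, a < t <= b -> t <= s) -> (forall t, a' < t <= b' -> s <= t) -> b <= a'.
Proof.
move=> ab ab' H H'; have bs : b <= s by apply: H; rewrite ab lexx.
apply: le_trans bs _; rewrite leNgt; apply/negP => a's.
(* When [a' < s], this is a point of the second interval strictly below [s]; the left end [a']
   itself does not belong to the interval. *)
have := H' (Num.min b' ((a' + s) / 2)); rewrite ge_min lexx lt_min ab'/= andbT.
have h1 : a' < (a' + s) / 2 by lra.
rewrite h1 => /(_ isT); rewrite le_min => /andP[_]; lra.
Qed.

(** The absolute value is the variogram of Brownian motion, whose increments over non-overlapping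
    intervals are uncorrelated. *)
Lemma dpolar_abs (u x u' x' : R) : u < x -> u' < x' -> x <= u' \/ x' <= u ->
  dpolar Num.norm u x u' x' = 0.
Proof.
move=> ux ux' [H|H]; rewrite /dpolar.
- have L a b : a <= b -> `|a - b| = b - a :> R by move=> ab; rewrite distrC ger0_norm ?subr_ge0.
  by rewrite !L; [field|lra..].
- have L a b : b <= a -> `|a - b| = a - b :> R by move=> ab; rewrite ger0_norm ?subr_ge0.
  by rewrite !L; [field|lra..].
Qed.

Lemma gaussian_field_independent_axis2 V (a : R -> R) : gaussian_field V (fun z w => a z * `|w|) ->
  independent_increments V (0, 1).
Proof.
move=> GV s u z x y u' z' x' y' ux zy ux' zy' Q Q' sep.
have n1 := rect_subset_quadrant ux zy Q; have n2 := rect_subset_quadrant ux' zy' Q'.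
have D : dpolar Num.norm z y z' y' = 0 /\ dpolar Num.norm z' y' z y = 0.
  have o : y <= z' \/ y' <= z.
    case: sep => -[H H']; [left|right].
      apply: (@separated_ord z y z' y' s) => // t tt.
        have /= := H (x, t); rewrite mul0r mul1r add0r; apply.
        by split; rewrite /= in_itv/= ?ux ?lexx.
      have /= := H' (x', t); rewrite mul0r mul1r add0r; apply.
      by split; rewrite /= in_itv/= ?ux' ?lexx.
    apply: (@separated_ord z' y' z y s) => // t tt.
      have /= := H (x', t); rewrite mul0r mul1r add0r; apply.
      by split; rewrite /= in_itv/= ?ux' ?lexx.
    have /= := H' (x, t); rewrite mul0r mul1r add0r; apply.
    by split; rewrite /= in_itv/= ?ux ?lexx.
  by split; apply: dpolar_abs => //; case: o => o; by [left|right].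
have E u1 z1 x1 y1 u2 z2 x2 y2 : dpolar Num.norm z1 y1 z2 y2 = 0 ->
    rect_kernel (fun z w => a z * `|w|) ((u1, z1), (x1, y1)) ((u2, z2), (x2, y2)) = 0.
  move=> D0; rewrite /rect_kernel/=.
  have -> : (fun t => dpolar (fun w => a t * `|w|) z1 y1 z2 y2) = (fun=> 0).
    by apply/funext => t; rewrite dpolarZ D0 mulr0.
  by rewrite /dpolar !addr0 subrr subr0 mul0r.
by apply: (gaussian_field_independent GV n1 n2); apply: E; case: D.
Qed.

Lemma gaussian_field_independent_axis1 V (a : R -> R) : gaussian_field V (fun z w => `|z| * a w) ->
  independent_increments V (1, 0).
Proof.
move=> GV s u z x y u' z' x' y' ux zy ux' zy' Q Q' sep.
have n1 := rect_subset_quadrant ux zy Q; have n2 := rect_subset_quadrant ux' zy' Q'.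
have D : dpolar Num.norm u x u' x' = 0 /\ dpolar Num.norm u' x' u x = 0.
  have o : x <= u' \/ x' <= u.
    case: sep => -[H H']; [left|right].
      apply: (@separated_ord u x u' x' s) => // t tt.
        have /= := H (t, y); rewrite mul0r mul1r addr0; apply.
        by split; rewrite /= in_itv/= ?zy ?lexx.
      have /= := H' (t, y'); rewrite mul0r mul1r addr0; apply.
      by split; rewrite /= in_itv/= ?zy' ?lexx.
    apply: (@separated_ord u' x' u x s) => // t tt.
      have /= := H (t, y'); rewrite mul0r mul1r addr0; apply.
      by split; rewrite /= in_itv/= ?zy' ?lexx.
    have /= := H' (t, y); rewrite mul0r mul1r addr0; apply.
    by split; rewrite /= in_itv/= ?zy ?lexx.
  by split; apply: dpolar_abs => //; case: o => o; by [left|right].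
have E u1 z1 x1 y1 u2 z2 x2 y2 : dpolar Num.norm u1 x1 u2 x2 = 0 ->
    rect_kernel (fun z w => `|z| * a w) ((u1, z1), (x1, y1)) ((u2, z2), (x2, y2)) = 0.
  move=> D0; rewrite /rect_kernel/=.
  have -> : (fun t : R => dpolar (fun w => `|t| * a w) z1 y1 z2 y2) = (fun t => dpolar a z1 y1 z2 y2 * `|t|).
    by apply/funext => t; rewrite mulrC -dpolarZ.
  by rewrite dpolarZ D0 mulr0.
by apply: (gaussian_field_independent GV n1 n2); apply: E; case: D.
Qed.

(** For the square function [dpolar] is [(x - u) (x' - u')]. It sees only the lengths, so the
    difference of the increments over two translates along the axis has variance 0. *)
Lemma gaussian_field_invariant_axis1 V (a : R -> R) : gaussian_field V (fun z w => z ^+ 2 * a w) ->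
  invariant_increments V (1, 0).
Proof.
move=> GV t u z x y s s' ux zy Q Q'.
have n1 := rect_subset_quadrant ux zy Q.
have n2 : nonneg_rect ((u + s, z + s'), (x + s, y + s')).
  by apply: rect_subset_quadrant => //; rewrite ltrD2r.
apply/(gaussian_field_invariant GV n1 n2).
by rewrite /rect_kernel/= /dpolar /s' /= mulr0 !addr0; field.
Qed.

Lemma gaussian_field_invariant_axis2 V (a : R -> R) : gaussian_field V (fun z w => a z * w ^+ 2) ->
  invariant_increments V (0, 1).
Proof.
move=> GV t u z x y s s' ux zy Q Q'.
have n1 := rect_subset_quadrant ux zy Q.
have n2 : nonneg_rect ((u + s, z + s'), (x + s, y + s')).
  by apply: rect_subset_quadrant => //; rewrite ltrD2r.
apply/(gaussian_field_invariant GV n1 n2).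
by rewrite /rect_kernel/= /dpolar /s /= mulr0 !addr0; field.
Qed.

(* [(0,1]^2] and its diagonal or antidiagonal neighbour are separated by a line
   orthogonal to any given direction. *)
Lemma gaussian_field_dependent V v : gaussian_field V v ->
  (forall z w, v (- z) w = v z w) -> (forall z w, v z (- w) = v z w) ->
  (forall z, v z 0 = 0) -> (forall z, v 0 z = 0) ->
  v 2 2 - 2 * v 1 2 - 2 * v 2 1 + 4 * v 1 1 != 0 ->
  (forall s t, `|s| + `|t| = 1 ->
     dpolar (fun z => dpolar (v z) 0 1 t (1 + t)) 0 1 s (1 + s) != v 1 1) ->
  dependent_increments V.
Proof.
move=> GV e1 e2 v1 v2 HA HB l l0; split.
- move=> ind.
  have rq (a b : R) : 0 <= a -> 0 <= b -> rect a b (a + 1) (b + 1) `<=` quadrant.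
    move=> a0 b0 [p q] [/=]; rewrite !in_itv/= => /andP[p1 _] /andP[q1 _].
    by split=> /=; [exact: le_lt_trans p1|exact: le_lt_trans q1].
  have nr (a b : R) : 0 <= a -> 0 <= b -> nonneg_rect ((a, b), (a + 1, b + 1)).
    by move=> a0 b0; split=> //=; lra.
  (* The covariance of the increments over two adjacent unit intervals; taken in each variable, it
     produces the mixed difference of [HA] up to the factor 4. *)
  have D12 (phi : R -> R) : (forall z, phi (- z) = phi z) -> phi 0 = 0 ->
      dpolar phi 0 (0 + 1) 1 (1 + 1) = (phi 2 - 2 * phi 1) / 2.
    move=> ev p0; rewrite /dpolar add0r subrr p0 !sub0r !ev.
    have -> : 1 - (1 + 1) = - 1 :> R by ring.
    by rewrite ev -[1 + 1]/2; field.
  have D21 (phi : R -> R) : (forall z, phi (- z) = phi z) -> phi 0 = 0 ->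
      dpolar phi 1 (1 + 1) 0 (0 + 1) = (phi 2 - 2 * phi 1) / 2.
    move=> ev p0; rewrite /dpolar add0r subrr p0 !subr0.
    have -> : 1 + 1 - 1 = 1 :> R by ring.
    by rewrite -[1 + 1]/2; field.
  have R1 : rect_kernel v ((0, 0), (0 + 1, 0 + 1)) ((1, 1), (1 + 1, 1 + 1)) =
      (v 2 2 - 2 * v 1 2 - 2 * v 2 1 + 4 * v 1 1) / 4.
    rewrite /rect_kernel/=.
    under eq_fun do rewrite D12//.
    rewrite D12; first by field.
    - by move=> z; rewrite !e1.
    - by rewrite !v2; field.
  have R2 : rect_kernel v ((1, 1), (1 + 1, 1 + 1)) ((0, 0), (0 + 1, 0 + 1)) =
      (v 2 2 - 2 * v 1 2 - 2 * v 2 1 + 4 * v 1 1) / 4.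
    rewrite /rect_kernel/=.
    under eq_fun do rewrite D21//.
    rewrite D21; first by field.
    - by move=> z; rewrite !e1.
    - by rewrite !v2; field.
  have R3 : rect_kernel v ((0, 1), (0 + 1, 1 + 1)) ((1, 0), (1 + 1, 0 + 1)) =
      (v 2 2 - 2 * v 1 2 - 2 * v 2 1 + 4 * v 1 1) / 4.
    rewrite /rect_kernel/=.
    under eq_fun do rewrite D21//.
    rewrite D12; first by field.
    - by move=> z; rewrite !e1.
    - by rewrite !v2; field.
  have R4 : rect_kernel v ((1, 0), (1 + 1, 0 + 1)) ((0, 1), (0 + 1, 1 + 1)) =
      (v 2 2 - 2 * v 1 2 - 2 * v 2 1 + 4 * v 1 1) / 4.
    rewrite /rect_kernel/=.
    under eq_fun do rewrite D12//.
    rewrite D21; first by field.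
    - by move=> z; rewrite !e1.
    - by rewrite !v2; field.
  have lt01 (a : R) : a < a + 1 by rewrite ltrDl.
  have c0 : (v 2 2 - 2 * v 1 2 - 2 * v 2 1 + 4 * v 1 1) / 4 != 0.
    by rewrite mulf_neq0// invr_eq0.
  (* The squares of either pair meet at [(1, 1)], and the separating line is the perpendicular to
     [l] through this point. It separates the diagonal pair when [l.1] and [l.2] have the same sign,
     and the antidiagonal pair when they have opposite signs. *)
  have [sg|sg] : 0 <= l.1 * l.2 \/ l.1 * l.2 <= 0 by case: (leP 0 (l.1 * l.2)) => H; [left|right; exact: ltW].
  + have sep : Defs.separated l (l.1 + l.2) (rect 0 0 (0 + 1) (0 + 1)) (rect 1 1 (1 + 1) (1 + 1)).
      have [l1|l1] := leP 0 l.1; have [l2|l2] := leP 0 l.2.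
      * left; split=> -[p q] [/=]; rewrite !in_itv/= => /andP[? ?] /andP[? ?]; nra.
      * have l10 : l.1 = 0 by nra.
        right; split=> -[p q] [/=]; rewrite !in_itv/= l10 => /andP[? ?] /andP[? ?]; nra.
      * have l20 : l.2 = 0 by nra.
        right; split=> -[p q] [/=]; rewrite !in_itv/= l20 => /andP[? ?] /andP[? ?]; nra.
      * right; split=> -[p q] [/=]; rewrite !in_itv/= => /andP[? ?] /andP[? ?]; nra.
    have I := ind _ _ _ _ _ _ _ _ _ (lt01 0) (lt01 0) (lt01 1) (lt01 1) (rq 0 0 (lexx _) (lexx _)) (rq 1 1 ler01 ler01) sep.
    have := gaussian_field_independent_kernel GV (nr 0 0 (lexx _) (lexx _)) (nr 1 1 ler01 ler01) _ I.
    by rewrite R1 R2 => /(_ erefl)/eqP; apply/negP.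
  + have sep : Defs.separated l (l.1 + l.2) (rect 0 1 (0 + 1) (1 + 1)) (rect 1 0 (1 + 1) (0 + 1)).
      have [l1|l1] := leP 0 l.1; have [l2|l2] := leP l.2 0.
      * left; split=> -[p q] [/=]; rewrite !in_itv/= => /andP[? ?] /andP[? ?]; nra.
      * have l10 : l.1 = 0 by nra.
        right; split=> -[p q] [/=]; rewrite !in_itv/= l10 => /andP[? ?] /andP[? ?]; nra.
      * have l20 : l.2 = 0 by nra.
        right; split=> -[p q] [/=]; rewrite !in_itv/= l20 => /andP[? ?] /andP[? ?]; nra.
      * right; split=> -[p q] [/=]; rewrite !in_itv/= => /andP[? ?] /andP[? ?]; nra.
    have I := ind _ _ _ _ _ _ _ _ _ (lt01 0) (lt01 1) (lt01 1) (lt01 0) (rq 0 1 (lexx _) ler01) (rq 1 0 ler01 (lexx _)) sep.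
    have := gaussian_field_independent_kernel GV (nr 0 1 (lexx _) ler01) (nr 1 0 ler01 (lexx _)) _ I.
    by rewrite R3 R4 => /(_ erefl)/eqP; apply/negP.
- move=> inv; pose c := `|l.1| + `|l.2|.
  have c0 : 0 < c.
    rewrite lt_def addr_ge0// andbT; apply: contra l0; rewrite paddr_eq0//.
    by rewrite !normr_eq0; case: l {inv c} => a b /= /andP[/eqP -> /eqP ->].
  (* The direction is normalized so that the square with corners [(1, 1)] and [(2, 2)], moved by
     [(s, t)], remains in the quadrant; [HB] concerns shifts of this size. *)
  pose s := c^-1 * l.1; pose t := c^-1 * l.2.
  have st : `|s| + `|t| = 1.
    by rewrite /s /t !normrM (gtr0_norm (x := c^-1)) ?invr_gt0// -mulrDr mulVf// gt_eqF.
  have s1 : `|s| <= 1 by rewrite -st lerDl.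
  have t1 : `|t| <= 1 by rewrite -st lerDr.
  move: s1 t1; rewrite !ler_norml => /andP[s1 s2] /andP[t1 t2].
  have Q : rect (1 : R) 1 2 2 `<=` quadrant.
    by move=> -[p q] [/=]; rewrite !in_itv/= => /andP[p1 _] /andP[q1 _]; split=> /=; lra.
  have Q' : rect (1 + s) (1 + t) (2 + s) (2 + t) `<=` quadrant.
    by move=> -[p q] [/=]; rewrite !in_itv/= => /andP[p1 _] /andP[q1 _]; split=> /=; lra.
  have l12 : (1 : R) < 2 by lra.
  have I := inv c^-1 1 1 2 2 l12 l12 Q Q'.
  have n1 := rect_subset_quadrant l12 l12 Q.
  have n2 : nonneg_rect ((1 + s, 1 + t), (2 + s, 2 + t)) by split=> /=; lra.
  have /(gaussian_field_invariant GV n1 n2) := I.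
  move: (HB _ _ st).
  (* Translation invariance and evenness bring the four terms of the variance of the difference back
     to the intervals from 0 to 1 and from [a] to [1 + a]. *)
  have S (phi : R -> R) a : (forall z, phi (- z) = phi z) ->
    [/\ dpolar phi 1 2 1 2 = phi 1 - phi 0, dpolar phi (1 + a) (2 + a) (1 + a) (2 + a) = phi 1 - phi 0,
      dpolar phi 1 2 (1 + a) (2 + a) = dpolar phi 0 1 a (1 + a) &
      dpolar phi (1 + a) (2 + a) 1 2 = dpolar phi 0 1 a (1 + a)].
    move=> ev; rewrite /dpolar.
    have -> : 2 - 1 = 1 :> R by ring.
    have -> : 1 - 2 = - 1 :> R by ring.
    have -> : 2 + a - (1 + a) = 1 by ring.
    have -> : 1 + a - (2 + a) = - 1 by ring.
    have -> : 2 - (1 + a) = 1 - a by ring.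
    have -> : 1 - (2 + a) = - (1 + a) by ring.
    have -> : 2 - (2 + a) = - a by ring.
    have -> : 1 - (1 + a) = - a by ring.
    have -> : 2 + a - 1 = 1 + a by ring.
    have -> : 1 + a - 2 = - (1 - a) by ring.
    have -> : 2 + a - 2 = a by ring.
    have -> : 1 + a - 1 = a by ring.
    by rewrite !subrr !sub0r !ev; split; field.
  have ev2 z : forall w, v z (- w) = v z w by exact: e2.
  rewrite /rect_kernel/=.
  have F1 : (fun z => dpolar (v z) 1 2 1 2) = (fun z => v z 1).
    by apply/funext => z; have [-> _ _ _] := S (v z) t (ev2 z); rewrite v1 subr0.
  have F2 : (fun z => dpolar (v z) (1 + t) (2 + t) (1 + t) (2 + t)) = (fun z => v z 1).
    by apply/funext => z; have [_ -> _ _] := S (v z) t (ev2 z); rewrite v1 subr0.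
  have F3 : (fun z => dpolar (v z) 1 2 (1 + t) (2 + t)) = (fun z => dpolar (v z) 0 1 t (1 + t)).
    by apply/funext => z; have [_ _ -> _] := S (v z) t (ev2 z).
  have F4 : (fun z => dpolar (v z) (1 + t) (2 + t) 1 2) = (fun z => dpolar (v z) 0 1 t (1 + t)).
    by apply/funext => z; have [_ _ _ ->] := S (v z) t (ev2 z).
  rewrite F1 F2 F3 F4.
  have [G1 G2 _ _] := S (fun z => v z 1) s (fun z => e1 z 1).
  have evD z : dpolar (v (- z)) 0 1 t (1 + t) = dpolar (v z) 0 1 t (1 + t).
    by rewrite /dpolar !e1.
  have [_ _ G3 G4] := S (fun z => dpolar (v z) 0 1 t (1 + t)) s evD.
  rewrite G1 G2 G3 G4 v2 subr0 => /eqP HN HE; apply: HN; lra.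
Qed.

End gaussian_fields.

(** * Fractional Brownian sheets *)

Section fractional_brownian_sheets.
Context {R : realType}.

Lemma field_kernelM k (a b : R -> R) (x y x' y' : R) :
  field_kernel (fun z w => k * (a z * b w)) x y x' y' = k * (polar a x x' * polar b y y').
Proof. by rewrite /field_kernel /polar; field. Qed.

Definition fbs_variogram (h1 h2 : R) (z w : R) : R := `|z| `^ (2 * h1) * `|w| `^ (2 * h2).

Lemma fbs_kernel (h1 h2 k x y x' y' : R) : 0 <= x -> 0 <= y -> 0 <= x' -> 0 <= y' ->
  field_kernel (fun z w => k * fbs_variogram h1 h2 z w) x y x' y' =
  k * (1 / 4 * (x `^ (2 * h1) + x' `^ (2 * h1) - `|x - x'| `^ (2 * h1))
          * (y `^ (2 * h2) + y' `^ (2 * h2) - `|y - y'| `^ (2 * h2))).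
Proof.
move=> x0 y0 x0' y0'; rewrite /fbs_variogram.
rewrite (field_kernelM k (fun z => `|z| `^ (2 * h1)) (fun w => `|w| `^ (2 * h2))).
by rewrite /polar !(ger0_norm x0, ger0_norm y0, ger0_norm x0', ger0_norm y0'); field.
Qed.

Lemma polar_normC (f : R -> R) x x' :
  polar (fun z => f `|z|) x x' = polar (fun z => f `|z|) x' x.
Proof. by rewrite /polar distrC; ring. Qed.

Lemma fbs_kernelC (h1 h2 k x y x' y' : R) :
  field_kernel (fun z w => k * fbs_variogram h1 h2 z w) x y x' y' =
  field_kernel (fun z w => k * fbs_variogram h1 h2 z w) x' y' x y.
Proof.
rewrite /fbs_variogram !(field_kernelM k (fun z => `|z| `^ (2 * h1)) (fun w => `|w| `^ (2 * h2))).
by rewrite (polar_normC (fun z => z `^ (2 * h1))) (polar_normC (fun z => z `^ (2 * h2))).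
Qed.

Lemma gaussian_fieldZ {d : measure_display} {Omega : measurableType d}
    (P : probability Omega R) (V B : R -> R -> {RV P >-> R}) v k :
  (forall x y w, B x y w = k * V x y w) -> gaussian_field V v ->
  gaussian_field B (fun z w => k ^+ 2 * v z w).
Proof.
move=> BV GV; have := gk_lincomb (fun p : R * R => [:: (k, p)]) GV.
rewrite /gaussian_field (_ : (fun _ => _) = abs_field B).
  congr gaussian_kernel; apply/funext => p; apply/funext => q.
  rewrite /lincomb_kernel !big_seq1/=.
  by rewrite -expr2 /field_kernel /polar; field.
by apply/funext => p; apply/funext => w; rewrite lincomb1 /abs_field BV.
Qed.

Lemma gaussian_field_fbs {d : measure_display} {Omega : measurableType d}
    (P : probability Omega R) (B : R -> R -> {RV P >-> R}) h1 h2 :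
  0 < h1 <= 1 -> 0 < h2 <= 1 ->
  gaussian_field B (fun z w => 1 * fbs_variogram h1 h2 z w) ->
  fractional_brownian_sheet h1 h2 B.
Proof.
move=> h11 h21 GB; split=> //.
- move=> n t a Dt; have := (gk_gaussian_family (D := closed_quadrant) GB) n t a Dt.
  congr gaussian_law; apply/funext => w; apply: eq_bigr => i _.
  by rewrite abs_fieldE//; exact: Dt.
- exact: gaussian_field_zero_mean GB.
- move=> x y x' y' x0 y0 x0' y0'.
  have KC (p q : R * R) := fbs_kernelC h1 h2 1 `|p.1| `|p.2| `|q.1| `|q.2|.
  have := gk_cov (x, y) (x', y') GB KC.
  have i2 := sq_integrable_mul (gk_sq GB (x, y)) (gk_sq GB (x', y')).
  rewrite !abs_fieldE//= in i2 *.
  rewrite (ger0_norm x0) (ger0_norm y0) (ger0_norm x0') (ger0_norm y0') fbs_kernel// mul1r => <-.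
  by rewrite unlock /Rintegral fineK//; exact: integrable_fin_num.
Qed.

Lemma fbs_gaussian_field {d : measure_display} {Omega : measurableType d}
    (P : probability Omega R) (B : R -> R -> {RV P >-> R}) h1 h2 :
  fractional_brownian_sheet h1 h2 B ->
  gaussian_field B (fun z w => 1 * fbs_variogram h1 h2 z w).
Proof.
move=> [_ _ gB B0 BK].
have E2 (p q : R * R) : \int[P]_w (abs_field B p w * abs_field B q w) =
    field_kernel (fun z w => 1 * fbs_variogram h1 h2 z w) `|p.1| `|p.2| `|q.1| `|q.2|.
  by rewrite fbs_kernel// mul1r /Rintegral; have := BK _ _ _ _ (normr_ge0 p.1) (normr_ge0 p.2) (normr_ge0 q.1) (normr_ge0 q.2); rewrite unlock => ->.
apply: gaussian_family_gk.
- move=> n t a _.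
  by have := gB n (fun i => (`|(t i).1|, `|(t i).2|)) a; apply=> i; split=> /=.
- move=> p; split; first exact: measurable_funP.
  apply: integrable_nonneg.
  + by apply: measurable_funX; exact: measurable_funP.
  + by move=> w; exact: sqr_ge0.
  + have := BK _ _ _ _ (normr_ge0 p.1) (normr_ge0 p.2) (normr_ge0 p.1) (normr_ge0 p.2).
    by rewrite unlock => E; under eq_integral do rewrite expr2; rewrite E ltry.
- by move=> p; rewrite /Rintegral; have := B0 `|p.1| `|p.2|; rewrite expectation_def => ->.
- exact: E2.
Qed.

(** The field divided by [k] is itself a sheet, which settles existence. Every other sheet,
    multiplied by [k], has the covariance of the field and hence its finite-dimensional
    distributions. *)
Lemma gaussian_field_scaled_fbs {d : measure_display} {Omega : measurableType d}
    (P : probability Omega R) (V : R -> R -> {RV P >-> R}) k h1 h2 :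
  0 < k -> 0 < h1 <= 1 -> 0 < h2 <= 1 ->
  gaussian_field V (fun z w => k ^+ 2 * fbs_variogram h1 h2 z w) ->
  fdd_scaled_fbs V k (h1, h2).
Proof.
move=> k0 h11 h21 GV; split=> /=.
  have mB x y : (fun w => k^-1 * V x y w) \in @mfun _ _ Omega (measurableTypeR R).
    by rewrite inE; apply: measurable_funM => //; exact: measurable_funP.
  exists (fun x y => mfun_Sub (mB x y)); apply: gaussian_field_fbs => //.
  have := @gaussian_fieldZ _ _ P V (fun x y => mfun_Sub (mB x y)) _ k^-1 (fun x y w => erefl) GV.
  congr gaussian_field; apply/funext => z; apply/funext => w.
  by rewrite mulrA -exprMn mulVf ?expr1n// gt_eqF.
move=> d' Omega' P' B /fbs_gaussian_field GB.
apply: fdd_eq_ext (gk_fdd (D := closed_quadrant) GV (gk_lincomb (fun p : R * R => [:: (k, p)]) GB) _).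
- by move=> p Dp; rewrite abs_fieldE.
- by move=> p Dp; apply/funext => w; rewrite lincomb1 abs_fieldE.
- move=> p q Dp Dq; rewrite /lincomb_kernel !big_seq1/= -expr2.
  by rewrite !fbs_kernel ?mul1r.
Qed.

End fractional_brownian_sheets.

(** * Substitutions in Lebesgue integrals *)

Section lebesgue_substitution.
Context {R : realType}.
Let lam := @lebesgue_measure R.
Local Open Scope ereal_scope.

(** The image of Lebesgue measure under the affine map, multiplied by [k], agrees with Lebesgue
    measure on half-open intervals, hence on all measurable sets. *)
Lemma ge0_integral_affine (f : R -> \bar R) (k b : R) : (0 < k)%R ->
  measurable_fun [set: R] f -> (forall x, 0 <= f x) ->
  \int[lam]_x f x = k%:E * \int[lam]_x f (k * x + b)%R.
Proof.
move=> k0 mf f0.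
have mphi : measurable_fun [set: measurableTypeR R] ((fun x => k * x + b)%R : measurableTypeR R -> measurableTypeR R).
  by apply: measurable_funD => //; exact: measurable_funM.
pose kn : {nonneg R} := NngNum (ltW k0).
have [nu nuE] : exists nu : {measure set (measurableTypeR R) -> \bar R},
    forall A, nu A = k%:E * pushforward lam ((fun x => k * x + b)%R : R -> measurableTypeR R) A.
  by unshelve eexists (mscale kn (pushforward lam ((fun x => k * x + b)%R : measurableTypeR R -> measurableTypeR R))).
have E (A : set (measurableTypeR R)) : measurable A -> lam A = nu A.
  move=> mA; apply: (@lebesgue_measure_unique R nu) => // _ [[x y]/= _ <-].
  rewrite nuE /pushforward.
  have -> : ((fun x => k * x + b)%R : R -> R) @^-1` `]x, y] = `]((x - b) / k)%R, ((y - b) / k)%R]%classic.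
    apply/seteqP; split=> t /=; rewrite !in_itv/= ltr_pdivrMr// ler_pdivlMr//;
      rewrite ltrBlDr lerBrDr mulrC//.
  rewrite /lam !lebesgue_measure_itv/= !lte_fin ltr_pM2r ?invr_gt0// ltrD2r.
  case: ifPn => _; last by rewrite mule0.
  by rewrite -!EFinB -EFinM; congr (_%:E); field; rewrite gt_eqF.
rewrite (@eq_measure_integral _ _ _ _ nu lam) => [|A mA _]; last exact: E.
rewrite -[RHS]/(k%:E * \int[lam]_x (f \o ((fun x => k * x + b)%R : R -> R)) x).
rewrite -[in RHS](ge0_integral_pushforward mphi _ measurableT)//.
rewrite -(ge0_integral_mscale _ measurableT kn)//; apply: eq_measure_integral => A mA _; exact: nuE.
Qed.

Lemma ge0_integral_scale (f : R -> \bar R) (k : R) : (0 < k)%R ->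
  measurable_fun [set: R] f -> (forall x, 0 <= f x) ->
  \int[lam]_x f x = k%:E * \int[lam]_x f (k * x)%R.
Proof.
move=> k0 mf f0; rewrite (ge0_integral_affine 0 k0)//.
by under eq_integral do rewrite addr0.
Qed.

Lemma ge0_integral_opp (f : R -> \bar R) :
  measurable_fun [set: R] f -> (forall x, 0 <= f x) ->
  \int[lam]_x f x = \int[lam]_x f (- x)%R.
Proof.
move=> mf f0; have mphi : measurable_fun [set: measurableTypeR R] (-%R : measurableTypeR R -> measurableTypeR R).
  exact: oppr_measurable.
rewrite -[RHS](ge0_integral_pushforward mphi _ measurableT)//.
by apply: eq_measure_integral => //= A mA _; exact/esym/lebesgue_measureN.
Qed.

Let leb2 := (lam \x lam)%E.

Lemma ge0_integral2_scale (F : R * R -> \bar R) (a b : R) : (0 < a)%R -> (0 < b)%R ->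
  measurable_fun [set: R * R] F -> (forall p, 0 <= F p) ->
  \int[leb2]_p F p = (a * b)%:E * \int[leb2]_p F (a * p.1, b * p.2)%R.
Proof.
move=> a0 b0 mF F0.
have ms : measurable_fun [set: R * R] (fun p : R * R => (a * p.1, b * p.2)%R).
  by apply/measurable_fun_pairP; split; apply: measurable_funM.
rewrite !fubini_tonelli1//; last exact: measurableT_comp mF ms.
rewrite (ge0_integral_scale a0); last 2 first.
- exact: measurable_fun_fubini_tonelli_F.
- by move=> x; apply: integral_ge0.
rewrite EFinM -muleA; congr (_ * _).
rewrite -ge0_integralZl//; last 3 first.
- by apply: measurable_fun_fubini_tonelli_F => //; exact: measurableT_comp mF ms.
- by move=> x _; exact: integral_ge0.
- by rewrite lee_fin ltW.
apply: eq_integral => x _; rewrite /fubini_F/=.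
by rewrite (ge0_integral_scale b0)//; exact: measurableT_comp mF (measurable_pair1 _).
Qed.

Lemma ge0_integral2_opp (F : R * R -> \bar R) :
  measurable_fun [set: R * R] F -> (forall p, 0 <= F p) ->
  \int[leb2]_p F p = \int[leb2]_p F (- p.1, p.2)%R.
Proof.
move=> mF F0.
have ms : measurable_fun [set: R * R] (fun p : R * R => (- p.1, p.2)%R).
  by apply: measurable_fun_pair => //; apply: measurableT_comp => //; exact: oppr_measurable.
rewrite !fubini_tonelli1//; last exact: measurableT_comp mF ms.
rewrite ge0_integral_opp//; last by move=> x; apply: integral_ge0.
exact: measurable_fun_fubini_tonelli_F.
Qed.

Lemma ge0_integral2_prod (f g : R -> R) :
  measurable_fun [set: R] f -> measurable_fun [set: R] g ->
  (forall x, 0 <= f x)%R -> (forall x, 0 <= g x)%R ->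
  \int[leb2]_p (f p.1 * g p.2)%:E = (\int[lam]_x (f x)%:E) * (\int[lam]_x (g x)%:E).
Proof.
move=> mf mg f0 g0.
rewrite fubini_tonelli1//; last 2 first.
- by apply/measurable_EFinP; apply: measurable_funM; apply: measurableT_comp.
- by move=> p; rewrite lee_fin mulr_ge0.
rewrite -ge0_integralZr//; last 3 first.
- exact/measurable_EFinP.
- by move=> x _; rewrite lee_fin.
- by apply: integral_ge0 => x _; rewrite lee_fin.
apply: eq_integral => x _; rewrite /fubini_F/=.
under eq_integral do rewrite EFinM.
have mgE : measurable_fun setT (EFin \o g) by exact/measurable_EFinP.
by rewrite (@ge0_integralZl _ _ _ lam _ measurableT _ mgE) ?lee_fin// => y _; rewrite lee_fin.
Qed.

(** Reflection in the first variable exchanges the positive and the negative part. If their common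
    integral is infinite, the difference is an infinite value, which [fine] sends to 0. *)
Lemma Rintegral2_odd (f : R * R -> R) :
  measurable_fun [set: R * R] f ->
  (forall p, f (- p.1, p.2)%R = - f p)%R -> (\int[leb2]_p f p = 0)%R.
Proof.
move=> mf fo; have mE : measurable_fun [set: R * R] (EFin \o f) by exact/measurable_EFinP.
rewrite /Rintegral integralE.
have -> : \int[leb2]_x (EFin \o f)^\- x = \int[leb2]_x (EFin \o f)^\+ x.
  rewrite [RHS]ge0_integral2_opp//; last exact: measurable_funepos.
  by apply: eq_integral => p _; rewrite funeposE funenegE/= fo.
by case: (\int[leb2]_x _ x) => [r| |]//=; rewrite ?subrr// ?addeN.
Qed.

End lebesgue_substitution.

Section positive_integrals.
Context {R : realType} {d : measure_display} {T : measurableType d}.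
Variable mu : {measure set T -> \bar R}.

Lemma Rintegral_gt0 (f : T -> R) (A : set T) : mu.-integrable setT (EFin \o f) ->
  (forall x, 0 <= f x) -> measurable A -> (0 < mu A)%E -> (forall x, A x -> 0 < f x) ->
  0 < \int[mu]_x f x.
Proof.
move=> fi f0 mA A0 fA.
have I0 : 0 <= \int[mu]_x f x by apply: Rintegral_ge0.
rewrite lt_def I0 andbT; apply/eqP => I.
have mf : measurable_fun setT (EFin \o f) by exact: measurable_int fi.
have : (\int[mu]_x `|(EFin \o f) x| = 0)%E.
  rewrite (eq_integral (EFin \o f)); last by move=> x _; rewrite /= ger0_norm.
  by rewrite -[LHS]fineK ?(integrable_fin_num _ fi)//; congr (_%:E).
move/(ae_eq_integral_abs mu measurableT mf) => [N [mN N0 sub]].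
have : (mu A <= mu N)%E.
  apply: le_measure; rewrite ?inE//; move=> x Ax; apply: sub => /= H.
  by have := fA x Ax; have [->] := H Logic.I; rewrite ltxx.
by rewrite N0 leNgt A0.
Qed.

End positive_integrals.

(** * Powers and the beta function *)

Section powers.
Context {R : realType}.
Let lam := @lebesgue_measure R.

Let m01 : measurable (`]0, 1[%classic : set (measurableTypeR R)) := measurable_itv _.

(** An antiderivative bounds the integral over [[1 / (n + 2), 1]] by [1 / p], uniformly in [n], and
    monotone convergence exhausts the interval. The shift by 2 keeps the left end strictly below
    1. *)
Lemma integrable_powR01 (p : R) : 0 < p ->
  lam.-integrable `]0, 1[ (EFin \o (fun t => t `^ (p - 1))).
Proof.
move=> p0.
have mf (D : set R) : measurable_fun D (EFin \o (fun t => t `^ (p - 1))).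
  by apply/measurable_EFinP; apply: measurable_funS (measurable_powR (p - 1)).
have dF (t : R) : 0 < t -> is_derive t 1 (fun s : R => p^-1 * s `^ p : R^o) (t `^ (p - 1)).
  move=> t0; have := is_deriveZ p^-1 (is_derive1_powR p t0).
  by rewrite /GRing.scale/= mulrA mulVf ?mul1r// gt_eqF.
have cpow (e : R) t : 0 < t -> {for t, continuous (fun s : R => s `^ e)}.
  move=> t0; apply: differentiable_continuous; apply/derivable1_diffP.
  by have := is_derive1_powR e t0 => -[].
have I n : (\int[lam]_(t in `[(n.+2%:R)^-1%R, 1%R]) (t `^ (p - 1))%R%:E <= p^-1%:E)%E.
  have n0 : 0 < n.+2%:R^-1 :> R by rewrite invr_gt0 ltr0n.
  have n1 : n.+2%:R^-1 < 1 :> R by rewrite invf_lt1 ?ltr0n// ltr1n.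
  rewrite (@continuous_FTC2 _ _ (fun s => p^-1 * s `^ p))//.
  - by rewrite powR1 mulr1 -EFinB lee_fin gerBl mulr_ge0 ?powR_ge0// invr_ge0 ltW.
  - apply: continuous_in_subspaceT => t; rewrite inE/= in_itv/= => /andP[t0 _].
    exact/cpow/(lt_le_trans n0).
  - split.
    + by move=> t; rewrite in_itv/= => /andP[t0 _]; have [] := dF t (lt_trans n0 t0).
    + apply: cvg_at_right_filter; apply: cvgM; first exact: cvg_cst.
      exact: cpow.
    + apply: cvg_at_left_filter; apply: cvgM; first exact: cvg_cst.
      exact: cpow.
  - move=> t; rewrite in_itv/= => /andP[t0 _]; rewrite derive1E.
    by have D := dF t (lt_trans n0 t0); rewrite derive_val.
apply/integrableP; split; first exact: mf.
under eq_integral do rewrite gee0_abs ?lee_fin ?powR_ge0//.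
pose F (n : nat) : set R := `[(n.+2%:R)^-1, 1]%classic.
apply: (@le_lt_trans _ _ (\int[lam]_(t in \bigcup_n F n) (EFin \o (fun t : R => t `^ (p - 1))%R) t)%E).
  apply: ge0_subset_integral => //.
  - by apply: bigcup_measurable => n _; exact: measurable_itv.
  - exact: mf.
  - by move=> t _; rewrite lee_fin powR_ge0.
  - move=> t /=; rewrite in_itv/= => /andP[t0 t1].
    exists (Num.truncn t^-1) => //; rewrite /F/= in_itv/= (ltW t1) andbT.
    rewrite -[leRHS]invrK lef_pV2 ?posrE ?invr_gt0 ?ltr0n//.
    rewrite (le_trans (ltW (truncnS_gt _)))// ler_nat.
    exact: leqnSn.
apply: (@le_lt_trans _ _ p^-1%:E); last exact: ltry.
have CF : (\int[lam]_(x in F i) (EFin \o (fun t : R => t `^ (p - 1))%R) x)%E @[i --> \oo] -->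
    (\int[lam]_(x in \bigcup_i F i) (EFin \o (fun t : R => t `^ (p - 1))%R) x)%E.
  apply: ge0_nondecreasing_set_cvg_integral.
  - move=> n m nm; apply/subsetPset => t; rewrite /F/= !in_itv/= => /andP[t0 ->]; rewrite andbT.
    by apply: le_trans t0; rewrite lef_pV2 ?posrE ?ltr0n// ler_nat.
  - by move=> n; exact: measurable_itv.
  - by move=> n; exact: mf.
  - by move=> n t _; rewrite lee_fin powR_ge0.
rewrite -(cvg_lim _ CF)//; apply: lime_le; first by apply/cvg_ex; eexists; exact: CF.
by near=> n; exact: I.
Unshelve. all: by end_near. Qed.

(** Bounds, for exponents of either sign, the factor of the beta integrand that is away from its
    singularity. *)
Lemma powR_le_half (s e : R) : 1 / 2 <= s -> s <= 1 -> s `^ e <= 1 + (1 / 2) `^ e.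
Proof.
move=> s2 s1; have [e0|e0] := leP 0 e.
  apply: (@le_trans _ _ 1); last by rewrite lerDl powR_ge0.
  have P1 : 1 `^ e = 1 :> R by rewrite powR1.
  rewrite -[leRHS]P1; apply: ge0_ler_powR => //; rewrite nnegrE; lra.
apply: (@le_trans _ _ ((1 / 2) `^ e)); last by rewrite lerDr.
rewrite -(opprK e) (powRN s) (powRN (1 / 2)) lef_pV2 ?posrE ?powR_gt0//; [|lra..].
by apply: ge0_ler_powR => //; rewrite ?nnegrE; lra.
Qed.

Lemma integrable_powR01_onem (p : R) : 0 < p ->
  lam.-integrable `]0, 1[ (EFin \o (fun t => (1 - t) `^ (p - 1))).
Proof.
move=> p0; have mf (D : set R) : measurable_fun D (fun t : R => t `^ (p - 1)).
  by apply: measurable_funS (measurable_powR (p - 1)).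
have mg : measurable_fun [set: R] (fun t : R => (1 - t) `^ (p - 1)).
  by apply: measurableT_comp (mf setT) _; apply: measurable_funB.
apply/integrableP; split.
  by apply/measurable_EFinP; exact: measurable_funS mg.
under eq_integral do rewrite gee0_abs ?lee_fin ?powR_ge0//.
have /integrableP[_] := integrable_powR01 p0.
under [X in (X < _)%E -> _]eq_integral do rewrite gee0_abs ?lee_fin ?powR_ge0//.
rewrite integral_mkcond [X in _ -> (X < _)%E]integral_mkcond.
rewrite (@ge0_integral_affine _ _ 1 1)//; last 2 first.
- apply/(measurable_restrictT _ _).1 => //.
  by apply/measurable_EFinP; exact: mf.
- by move=> t; rewrite patchE; case: ifP => // _; rewrite lee_fin powR_ge0.
rewrite mul1e ge0_integral_opp; last 2 first.
- apply: measurableT_comp.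
  apply/(measurable_restrictT _ _).1 => //.
    by apply/measurable_EFinP; exact: mf.
  by apply: measurable_funD.
- by move=> t; rewrite patchE; case: ifP => // _; rewrite lee_fin powR_ge0.
move=> H; apply: le_lt_trans H; rewrite le_eqVlt; apply/orP; left; apply/eqP.
apply: eq_integral => t _.
rewrite /= mul1r !patchE.
have -> : (- t + 1 \in `]0, 1[%classic) = (t \in `]0, 1[%classic).
  by apply/idP/idP; rewrite !inE/= !in_itv/= => /andP[? ?]; apply/andP; split; lra.
by case: ifP => //= _; rewrite addrC.
Qed.

(** The interval is cut at one half: on each side at most one factor is singular, and [powR_le_half]
    bounds the other. *)
Lemma betaR_integrable (a b : R) : 0 < a -> 0 < b ->
  lam.-integrable `]0, 1[ (EFin \o (fun t => t `^ (a - 1) * (1 - t) `^ (b - 1))).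
Proof.
move=> a0 b0; pose A := 1 + (1 / 2) `^ (a - 1); pose B := 1 + (1 / 2) `^ (b - 1) : R.
have A0 : 0 <= A by rewrite addr_ge0 ?powR_ge0.
have B0 : 0 <= B by rewrite addr_ge0 ?powR_ge0.
have := integrableD m01 (integrableZl m01 B (integrable_powR01 a0))
  (integrableZl m01 A (integrable_powR01_onem b0)).
apply: le_integrable => //.
  apply/measurable_EFinP; apply: measurable_funM.
    by apply: measurable_funS (measurable_powR (a - 1)).
  apply: (@measurable_funS _ _ _ _ setT) => //.
  apply: measurableT_comp (measurable_powR (b - 1)) _; exact: measurable_funB.
move=> t; rewrite /= in_itv/= => /andP[t0 t1].
rewrite lee_fin !ger0_norm ?addr_ge0 ?mulr_ge0 ?powR_ge0//.
have [t2|t2] := leP t (1 / 2).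
  apply: (@le_trans _ _ (B * t `^ (a - 1))); last by rewrite lerDl mulr_ge0 ?powR_ge0.
  by rewrite mulrC ler_wpM2r ?powR_ge0// powR_le_half//; lra.
apply: (@le_trans _ _ (A * (1 - t) `^ (b - 1))); last by rewrite lerDr mulr_ge0 ?powR_ge0.
by rewrite ler_wpM2r ?powR_ge0// powR_le_half//; lra.
Qed.

Lemma betaR_gt0 (a b : R) : 0 < a -> 0 < b -> 0 < betaR a b.
Proof.
move=> a0 b0; have := betaR_integrable a0 b0.
rewrite (integrable_mkcond _ m01) => H.
rewrite /betaR Rintegral_mkcond; apply: (@Rintegral_gt0 _ _ _ lam _ `]0, 1[).
- by apply: eq_integrable H => // t _; rewrite /= !patchE; case: ifP.
- by move=> t; rewrite patchE; case: ifP => // _; rewrite mulr_ge0 ?powR_ge0.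
- exact: measurable_itv.
- by have := lebesgue_measure_itv (`]0%R, 1%R[ : interval R); rewrite /= lte_fin ltr01 oppr0 adde0 => ->.
- move=> t t01; rewrite patchE mem_set//; move: t01; rewrite /= in_itv/= => /andP[t0 t1].
  by rewrite mulr_gt0// powR_gt0// subr_gt0.
Qed.

End powers.

(** * The squared modulus of the kernel *)

Section kappa.
Context {R : realType}.
Let lam := @lebesgue_measure R.
Implicit Types (x y u a : R).

(** Division by 0 gives the value 0 at [u = 0] instead of the limit [x ^ 2]; the parts of [ker1]
    follow the same convention, so that the identities relating them hold for all [u]. *)
Definition kappa x u : R := (2 - 2 * cos (u * x)) / u ^+ 2.

Lemma ker1E x u : u != 0 ->
  ker1 x u = (- sin (u * x) / u) +i* (- (1 - cos (u * x)) / u).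
Proof.
move=> u0; rewrite /ker1; apply/(canLR (mulfK _)).
  by rewrite mulf_neq0//; [apply/eqP => -[]/eqP; rewrite oner_eq0|apply/eqP => -[]; exact/eqP].
set s := sin _; set k := cos _.
have -> : 1 - expi (u * x) = (1 - k) +i* (0 - s) by [].
have M (A B : R) : (A +i* B) * (iC * u%:C) =
    (A * (0 * u - 1 * 0) - B * (0 * 0 + 1 * u)) +i* (A * (0 * 0 + 1 * u) + B * (0 * u - 1 * 0)) by [].
by rewrite M; congr (_ +i* _); field.
Qed.

Lemma Re_ker1 x u : complex.Re (ker1 x u) = - sin (u * x) / u.
Proof.
have [->|u0] := eqVneq u 0; last by rewrite ker1E.
by rewrite /ker1 mulr0 invr0 mulr0 /= mul0r invr0 mulr0.
Qed.

Lemma Im_ker1 x u : complex.Im (ker1 x u) = - (1 - cos (u * x)) / u.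
Proof.
have [->|u0] := eqVneq u 0; last by rewrite ker1E.
by rewrite /ker1 mulr0 invr0 mulr0 /= invr0 mulr0.
Qed.

(** The left side is the real part of [ker1 x u] times the conjugate of [ker1 y u]; the subtraction
    formula for [cos (u x - u y)] makes it a polarization. *)
Lemma polar_kappa x y u :
  complex.Re (ker1 x u) * complex.Re (ker1 y u) + complex.Im (ker1 x u) * complex.Im (ker1 y u) =
  polar (fun z => kappa z u) x y.
Proof.
rewrite !Re_ker1 !Im_ker1 /polar /kappa mulrBr cosB.
have [->|u0] := eqVneq u 0; first by rewrite invr0 expr0n/= invr0 !mulr0 !addr0 subrr mul0r.
by field.
Qed.

Lemma sqnormc_ker1 x u : sqnormc (ker1 x u) = kappa x u.
Proof.
rewrite /sqnormc !expr2 polar_kappa /polar subrr /kappa mulr0 cos0 mulr1 subrr mul0r subr0.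
have H (t : R) : (t + t) / 2 = t by lra.
exact: H.
Qed.

Lemma kappa_ge0 x u : 0 <= kappa x u.
Proof. by rewrite -sqnormc_ker1 sqnormc_ge0. Qed.

Lemma kappaN x u : kappa (- x) u = kappa x u.
Proof. by rewrite /kappa mulrN cosN. Qed.

Lemma kappa0 u : kappa 0 u = 0.
Proof. by rewrite /kappa mulr0 cos0 mulr1 subrr mul0r. Qed.

Lemma kappar0 x : kappa x 0 = 0.
Proof. by rewrite /kappa expr0n/= invr0 mulr0. Qed.

Lemma kappaZ k x u : kappa (k * x) u = k ^+ 2 * kappa x (k * u).
Proof.
have [->|k0] := eqVneq k 0; first by rewrite mul0r kappa0 expr0n mul0r.
have [->|u0] := eqVneq u 0; first by rewrite mulr0 !kappar0 mulr0.
by rewrite /kappa (_ : u * (k * x) = k * u * x); [field; rewrite u0 k0|ring].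
Qed.

Lemma onesub_cos_le (t : R) : 2 - 2 * cos t <= t ^+ 2.
Proof.
have E : cos t = 1 - 2 * sin (t / 2) ^+ 2.
  have -> : cos t = cos ((t / 2) *+ 2) by congr cos; rewrite -mulr_natr; field.
  by rewrite cos_mulr2n -mulr_natl cos2sin2; ring.
have := norm_sin_le (t / 2); rewrite -ler_sqr ?nnegrE// !real_normK ?num_real// E.
by rewrite exprMn; lra.
Qed.

Lemma kappa_le_sqr x u : kappa x u <= x ^+ 2.
Proof.
have [->|u0] := eqVneq u 0; first by rewrite kappar0 sqr_ge0.
rewrite /kappa ler_pdivrMr ?exprn_even_gt0//.
by apply: le_trans (onesub_cos_le _) _; rewrite exprMn mulrC.
Qed.

Lemma kappa_gt0 x u : 0 < x <= 1 -> 0 < u < 1 -> 0 < kappa x u.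
Proof.
move=> /andP[x0 x1] /andP[u0 u1]; rewrite divr_gt0 ?exprn_gt0//.
have : cos (u * x) < 1; last lra.
have E : cos (u * x) = 1 - 2 * sin (u * x / 2) ^+ 2.
  have -> : cos (u * x) = cos ((u * x / 2) *+ 2) by congr cos; rewrite -mulr_natr; field.
  by rewrite cos_mulr2n -mulr_natl cos2sin2; ring.
rewrite E; have : 0 < sin (u * x / 2) ^+ 2; last lra.
have ux : 0 < u * x by rewrite mulr_gt0.
have ux1 : u * x <= 1 by rewrite mulr_ile1// ltW.
by rewrite exprn_gt0// sin2_gt0//; lra.
Qed.

(** The inverse is [u] times a real power of [u^2], an expression that also takes the value 0 at the
    origin. *)
Lemma measurable_inv_fun : measurable_fun [set: R] (fun u : R => u^-1).
Proof.
have -> : (fun u : R => u^-1) = (fun u => u * (u ^+ 2) `^ (-1)).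
  apply/funext => u; rewrite powR_inv1 ?sqr_ge0//.
  by have [->|u0] := eqVneq u 0; [rewrite invr0 mul0r|field].
apply: measurable_funM => //; apply: measurableT_comp (measurable_powR _) _.
exact: measurable_funX.
Qed.

Lemma measurable_kappa x : measurable_fun [set: R] (kappa x).
Proof.
apply: measurable_funM.
  apply: measurable_funB => //; apply: measurable_funM => //.
  by apply: measurableT_comp; [exact: measurable_cos|exact: measurable_funM].
by apply: measurableT_comp; [exact: measurable_inv_fun|exact: measurable_funX].
Qed.

Lemma measurable_normr_powR a : measurable_fun [set: R] (fun u : R => `|u| `^ a).
Proof. by apply: measurableT_comp (measurable_powR _) _; exact: normr_measurable. Qed.

Lemma integrable_oneDsqrV : lam.-integrable setT (EFin \o (fun u : R => (oneDsqr u)^-1)).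
Proof.
apply: integrable_nonneg.
- exact: continuous_measurable_fun continuous_oneDsqrV.
- by move=> u; rewrite invr_ge0 ltW// ?oneDsqr_gt0.
rewrite (@ge0_symfun_integralT _ (fun u => (oneDsqr u)^-1)).
- rewrite -set_itvcy integral0y_oneDsqr -EFinM; exact: ltry.
- by move=> u; rewrite invr_ge0 ltW// ?oneDsqr_gt0.
- exact: continuous_oneDsqrV.
- by move=> u; rewrite /= /oneDsqr sqrrN.
Qed.

Lemma integrable_opp (f : R -> R) : lam.-integrable setT (EFin \o f) -> (forall u, 0 <= f u) ->
  lam.-integrable setT (EFin \o (fun u => f (- u))).
Proof.
move=> fi f0; have mf : measurable_fun [set: R] f by have /measurable_EFinP := measurable_int _ fi.
apply: integrable_nonneg => //.
  by apply: measurableT_comp mf _; exact: oppr_measurable.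
rewrite -(@ge0_integral_opp _ (EFin \o f)); last 2 first.
- exact/measurable_EFinP.
- by move=> u; rewrite lee_fin.
have /integrableP[_] := fi.
by under eq_integral do rewrite gee0_abs ?lee_fin//.
Qed.

(** Where [|u| < 1] the bound is [x^2 |u|^(-a)], integrable as [a < 1]; elsewhere
    [kappa x u <= 4 / u^2 <= 8 / (1 + u^2)] and the power is at most 1. *)
Lemma kappa_powR_integrable a x : 0 <= a < 1 ->
  lam.-integrable setT (EFin \o (fun u => kappa x u * `|u| `^ (- a))).
Proof.
move=> /andP[a0 a1].
pose f := ((fun t : R => t `^ (1 - a - 1)) \_ `]0, 1[%classic).
have p0 : 0 < 1 - a by rewrite subr_gt0.
have m01 : measurable (`]0, 1[%classic : set (measurableTypeR R)) by exact: measurable_itv.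
have f0 u : 0 <= f u by rewrite /f patchE; case: ifP => // _; exact: powR_ge0.
have fi : lam.-integrable setT (EFin \o f).
  have := integrable_powR01 p0; rewrite (integrable_mkcond _ m01).
  by apply: eq_integrable => // t _; rewrite /= /f !patchE; case: ifP.
have := integrableD measurableT (integrableZl measurableT (2 * x ^+ 2 + 8) integrable_oneDsqrV)
  (integrableZl measurableT (x ^+ 2) (integrableD measurableT fi (integrable_opp fi f0))).
apply: le_integrable => //.
  by apply/measurable_EFinP; apply: measurable_funM; [exact: measurable_kappa|exact: measurable_normr_powR].
have ff (u : R) : 0 < `|u| < 1 -> f u + f (- u) = `|u| `^ (- a).
  move=> /andP[u0 u1]; rewrite /f !patchE.
  have -> : 1 - a - 1 = - a by ring.
  have [up|un] := leP 0 u.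
    rewrite ger0_norm// in u0 u1 *.
    rewrite mem_set ?memNset/= ?addr0// in_itv/= ?u0//.
    by rewrite oppr_gt0 ltNge up.
  rewrite ltr0_norm// in u0 u1 *.
  rewrite memNset ?mem_set/= ?add0r// in_itv/= ?u0//.
  by rewrite ltNge ltW.
move=> u _ /=; rewrite lee_fin [leLHS]ger0_norm; last by apply: mulr_ge0; [exact: kappa_ge0|exact: powR_ge0].
have D0 : 0 < 1 + u ^+ 2 by rewrite ltr_pwDl ?sqr_ge0.
have C0 : 0 <= (2 * x ^+ 2 + 8) / oneDsqr u.
  by rewrite divr_ge0 ?(ltW (oneDsqr_gt0 _))// addr_ge0// mulr_ge0// sqr_ge0.
have F0 : 0 <= x ^+ 2 * (f u + f (- u)) by rewrite mulr_ge0 ?sqr_ge0 ?addr_ge0.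
rewrite [leRHS]ger0_norm ?addr_ge0//.
have [u0|u0] := eqVneq u 0; first by rewrite (_ : kappa x u = 0) ?mul0r ?addr_ge0// u0 kappar0.
have [u1|u1] := ltP `|u| 1.
  apply: (@le_trans _ _ (x ^+ 2 * (f u + f (- u)))); last by rewrite lerDr.
  by rewrite ff ?normr_gt0 ?u0// ler_wpM2r ?powR_ge0// kappa_le_sqr.
apply: (@le_trans _ _ ((2 * x ^+ 2 + 8) / oneDsqr u)); last by rewrite lerDl.
apply: (@le_trans _ _ (kappa x u)).
  rewrite ler_piMr ?kappa_ge0// powRN invf_le1 ?powR_gt0 ?normr_gt0//.
  have P1 : 1 `^ a = 1 :> R by rewrite powR1.
  by rewrite -P1; apply: ge0_ler_powR; rewrite ?nnegrE.
have u2 : 1 <= u ^+ 2 by rewrite -real_normK ?num_real// expr_ge1.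
rewrite /kappa /oneDsqr ler_pdivrMr ?(lt_le_trans ltr01)// mulrAC ler_pdivlMr//.
by have := cos_geN1 (u * x); have := cos_le1 (u * x); have := sqr_ge0 x; nra.
Qed.

(** For [0 <= a < 1] and up to a constant factor, the variogram of a fractional Brownian motion of
    index [(1 + a) / 2], in spectral form. *)
Definition power_variogram a x : R := \int[lam]_u (kappa x u * `|u| `^ (- a)).

Lemma power_variogramE a x : 0 <= a < 1 ->
  power_variogram a x = `|x| `^ (1 + a) * power_variogram a 1.
Proof.
move=> a01; have /andP[a0 a1] := a01.
have ev z : power_variogram a (- z) = power_variogram a z.
  by apply: eq_Rintegral => u _; rewrite kappaN.
have mk z : measurable_fun [set: R] (fun u => kappa z u * `|u| `^ (- a)).
  by apply: measurable_funM; [exact: measurable_kappa|exact: measurable_normr_powR].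
have k0 z u : 0 <= kappa z u * `|u| `^ (- a) by rewrite mulr_ge0 ?kappa_ge0 ?powR_ge0.
suff P z : 0 < z -> power_variogram a z = z `^ (1 + a) * power_variogram a 1.
  have [x0|x0|->] := ltrgt0P x.
  - exact: P.
  - by rewrite -ev P ?oppr_gt0.
  - rewrite powR0 ?mul0r; last by rewrite gt_eqF// ltr_pwDl.
    by rewrite /power_variogram; under eq_Rintegral do rewrite kappa0 mul0r; rewrite Rintegral_cst// mul0r.
move=> z0; rewrite /power_variogram /Rintegral.
have E1 : (\int[lam]_u (kappa 1 u * `|u| `^ (- a))%:E =
    z%:E * \int[lam]_u (kappa 1 (z * u) * `|z * u| `^ (- a))%:E)%E.
  apply: (@ge0_integral_scale _ (EFin \o (fun u => kappa 1 u * `|u| `^ (- a))) z z0).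
  - by apply/measurable_EFinP; exact: mk.
  - by move=> u; rewrite lee_fin.
have E2 : (\int[lam]_u (kappa 1 (z * u) * `|z * u| `^ (- a))%:E =
    (z `^ (- a) / z ^+ 2)%:E * \int[lam]_u (kappa z u * `|u| `^ (- a))%:E)%E.
  have -> : (\int[lam]_u (kappa 1 (z * u) * `|z * u| `^ (- a))%:E =
      \int[lam]_u ((z `^ (- a) / z ^+ 2)%:E * (kappa z u * `|u| `^ (- a))%:E))%E.
    apply: eq_integral => u _; rewrite /= -EFinM; congr (_%:E).
    rewrite normrM powRM// (gtr0_norm z0).
    by have := kappaZ z 1 u; rewrite mulr1 => ->; field; exact: lt0r_neq0.
  apply: ge0_integralZl => //.
  - by apply/measurable_EFinP; exact: mk.
  - by move=> u _; rewrite lee_fin.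
  - by rewrite lee_fin divr_ge0 ?powR_ge0 ?sqr_ge0.
rewrite E1 E2; have fin : (\int[lam]_u (kappa z u * `|u| `^ (- a))%:E)%E \is a fin_num.
  exact: integrable_fin_num (kappa_powR_integrable z a01).
rewrite -(fineK fin) -!EFinM /=; set I := fine _.
rewrite powRD; last by rewrite (lt0r_neq0 z0) implybT.
rewrite powRr1 ?ltW// powRN; have := powR_gt0 a z0; set za := z `^ a => za0.
by field; rewrite !gt_eqF.
Qed.

Lemma itv01_measure_gt0 : (0 < lam `]0%R, 1%R[)%E.
Proof.
by have := lebesgue_measure_itv (`]0%R, 1%R[ : interval R); rewrite /= lte_fin ltr01 oppr0 adde0 => E; rewrite /lam E.
Qed.

Lemma power_variogram_gt0 a : 0 <= a < 1 -> 0 < power_variogram a 1.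
Proof.
move=> a01; apply: (@Rintegral_gt0 _ _ _ lam _ `]0, 1[) => //.
- exact: kappa_powR_integrable.
- by move=> u; rewrite mulr_ge0 ?kappa_ge0 ?powR_ge0.
- exact: itv01_measure_gt0.
- move=> u; rewrite /= in_itv/= => u01.
  rewrite mulr_gt0 ?kappa_gt0 ?ltr01 ?lexx// powR_gt0// normr_gt0.
  by case/andP: u01 => u0 _; rewrite gt_eqF.
Qed.

End kappa.

(** * Covariances of the stochastic integrals *)

Section integral_polarization.
Context {R : realType} {d : measure_display} {T : measurableType d}.
Variable mu : {measure set T -> \bar R}.
Implicit Types (f g : T -> R) (F : R -> T -> R).

Let int f := mu.-integrable setT (EFin \o f).

Lemma Rintegral_lin a b f g : int f -> int g ->
  int (fun t => a * f t + b * g t) /\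
  \int[mu]_t (a * f t + b * g t) = a * \int[mu]_t f t + b * \int[mu]_t g t.
Proof.
move=> fi gi.
have afi : int (fun t => a * f t).
  by have := integrableZl measurableT a fi; apply: eq_integrable => // t _ /=.
have bgi : int (fun t => b * g t).
  by have := integrableZl measurableT b gi; apply: eq_integrable => // t _ /=.
split; first by have := integrableD measurableT afi bgi; apply: eq_integrable => // t _ /=.
by rewrite (RintegralD measurableT afi bgi) (RintegralZl a measurableT fi) (RintegralZl b measurableT gi).
Qed.

(** A polarization is a finite linear combination, so it commutes with the integral; this is what
    reduces identities between covariances to identities between integrands. *)
Lemma Rintegral_polar F x x' : (forall z, int (F z)) ->
  int (fun t => polar (F ^~ t) x x') /\
  \int[mu]_t polar (F ^~ t) x x' = polar (fun z => \int[mu]_t F z t) x x'.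
Proof.
move=> Fi; have [i1 E1] := Rintegral_lin (1 / 2) (1 / 2) (Fi x) (Fi x').
have [i2 E2] := Rintegral_lin 1 (- (1 / 2)) i1 (Fi (x - x')).
have E : (fun t => polar (F ^~ t) x x') =
    (fun t => 1 * (1 / 2 * F x t + 1 / 2 * F x' t) + - (1 / 2) * F (x - x') t).
  by apply/funext => t; rewrite /polar; field.
by rewrite E; split=> //; rewrite E2 E1 /polar; field.
Qed.

Lemma Rintegral_dpolar F u x u' x' : (forall z, int (F z)) ->
  int (fun t => dpolar (F ^~ t) u x u' x') /\
  \int[mu]_t dpolar (F ^~ t) u x u' x' = dpolar (fun z => \int[mu]_t F z t) u x u' x'.
Proof.
move=> Fi; have [i1 E1] := Rintegral_lin (1 / 2) (1 / 2) (Fi (x - u')) (Fi (u - x')).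
have [i2 E2] := Rintegral_lin (- (1 / 2)) (- (1 / 2)) (Fi (x - x')) (Fi (u - u')).
have [i3 E3] := Rintegral_lin 1 1 i1 i2.
have E : (fun t => dpolar (F ^~ t) u x u' x') =
    (fun t => 1 * (1 / 2 * F (x - u') t + 1 / 2 * F (u - x') t) +
              1 * (- (1 / 2) * F (x - x') t + - (1 / 2) * F (u - u') t)).
  by apply/funext => t; rewrite /dpolar; field.
by rewrite E; split=> //; rewrite E3 E2 E1 /dpolar; field.
Qed.

Lemma Rintegral_field_kernel (F : R -> R -> T -> R) x y x' y' : (forall z w, int (F z w)) ->
  int (fun t => field_kernel (fun z w => F z w t) x y x' y') /\
  \int[mu]_t field_kernel (fun z w => F z w t) x y x' y' =
  field_kernel (fun z w => \int[mu]_t F z w t) x y x' y'.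
Proof.
move=> Fi; have [i1 E1] := Rintegral_polar x x' (fun z => (Rintegral_polar y y' (Fi z)).1).
split=> //; rewrite /field_kernel E1; congr (polar _ x x').
by apply/funext => z; exact: (Rintegral_polar y y' (Fi z)).2.
Qed.

Lemma Rintegral_rect_kernel (F : R -> R -> T -> R) j k : (forall z w, int (F z w)) ->
  int (fun t => rect_kernel (fun z w => F z w t) j k) /\
  \int[mu]_t rect_kernel (fun z w => F z w t) j k =
  rect_kernel (fun z w => \int[mu]_t F z w t) j k.
Proof.
move=> Fi.
have [i1 E1] := Rintegral_dpolar j.1.1 j.2.1 k.1.1 k.2.1
  (fun z => (Rintegral_dpolar j.1.2 j.2.2 k.1.2 k.2.2 (Fi z)).1).
split=> //; rewrite /rect_kernel E1; congr (dpolar _ _ _ _ _).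
by apply/funext => z; exact: (Rintegral_dpolar _ _ _ _ (Fi z)).2.
Qed.

End integral_polarization.

(** * Covariances of the kernels on the line and in the plane *)

Section line_kernels.
Context {R : realType}.
Let lam := @lebesgue_measure R.
Let leb2 := (lam \x lam)%E.

Lemma cRe_scale (z : R[i]) (t : R) : complex.Re (z * t%:C) = complex.Re z * t.
Proof. by rewrite !complexE mulr0 subr0. Qed.

Lemma cIm_scale (z : R[i]) (t : R) : complex.Im (z * t%:C) = complex.Im z * t.
Proof. by rewrite !complexE mulr0 add0r. Qed.

Lemma measurable_Re_ker1 x : measurable_fun [set: R] (fun u : R => complex.Re (ker1 x u)).
Proof.
under eq_fun do rewrite Re_ker1.
apply: measurable_funM; last exact: measurable_inv_fun.
apply: measurableT_comp => //; apply: measurableT_comp; first exact: measurable_sin.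
exact: measurable_funM.
Qed.

Lemma measurable_Im_ker1 x : measurable_fun [set: R] (fun u : R => complex.Im (ker1 x u)).
Proof.
under eq_fun do rewrite Im_ker1.
apply: measurable_funM; last exact: measurable_inv_fun.
apply: measurableT_comp => //; apply: measurable_funB => //.
by apply: measurableT_comp; [exact: measurable_cos|exact: measurable_funM].
Qed.

Lemma normr_powRX2 (e u : R) : (`|u| `^ (- e)) ^+ 2 = `|u| `^ (- (2 * e)).
Proof. by rewrite -powR_mulrn ?powR_ge0// -powRrM; congr (_ `^ _); ring. Qed.

Lemma line_square_integrable (e x : R) : 0 <= 2 * e < 1 ->
  square_integrable lam (fun u => ker1 x u * (`|u| `^ (- e))%:C).
Proof.
move=> e01.
split.
- under eq_fun do rewrite cRe_scale.
  by apply: measurable_funM; [exact: measurable_Re_ker1|exact: measurable_normr_powR].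
- under eq_fun do rewrite cIm_scale.
  by apply: measurable_funM; [exact: measurable_Im_ker1|exact: measurable_normr_powR].
- have /integrableP[_] := kappa_powR_integrable x e01.
  apply: le_lt_trans; rewrite le_eqVlt; apply/orP; left; apply/eqP.
  apply: eq_integral => u _; 
  have K : 0 <= kappa x u * `|u| `^ (- (2 * e)) by apply: mulr_ge0; [exact: kappa_ge0|exact: powR_ge0].
  rewrite /= (ger0_norm K).
  by rewrite /sqnormc cRe_scale cIm_scale !exprMn normr_powRX2 -mulrDl -sqnormc_ker1.
Qed.

Lemma line_re_inner (e x x' : R) : 0 <= 2 * e < 1 ->
  \int[lam]_u (complex.Re (ker1 x u * (`|u| `^ (- e))%:C) * complex.Re (ker1 x' u * (`|u| `^ (- e))%:C) +
               complex.Im (ker1 x u * (`|u| `^ (- e))%:C) * complex.Im (ker1 x' u * (`|u| `^ (- e))%:C)) =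
  polar (power_variogram (2 * e)) x x'.
Proof.
move=> e01.
have [_ <-] := Rintegral_polar x x' (fun z => kappa_powR_integrable z e01).
apply: eq_Rintegral => u _; rewrite !cRe_scale !cIm_scale.
transitivity (polar (fun z => kappa z u) x x' * (`|u| `^ (- e)) ^+ 2).
  by rewrite -polar_kappa; ring.
by rewrite normr_powRX2 /polar; field.
Qed.

Lemma ker2E (x y : R) p : ker2 x y p = ker1 x p.1 * ker1 y p.2.
Proof.
rewrite /ker2 /ker1 [RHS]mulrACA -invfM; congr (_ / _); rewrite expr2; ring.
Qed.

Definition plane_variogram (M : R * R -> R) (z w : R) : R :=
  \int[leb2]_p (kappa z p.1 * kappa w p.2 * M p).

Section plane.
Variables m : R * R -> R.
Hypothesis mm : measurable_fun [set: R * R] m.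
Hypothesis m_even : forall p, m (- p.1, p.2) = m p.
Hypothesis kappa_int : forall z w : R,
  leb2.-integrable setT (EFin \o (fun p => kappa z p.1 * kappa w p.2 * m p ^+ 2)).

Let g (q : R * R) (p : R * R) : R[i] := ker2 q.1 q.2 p * (m p)%:C.

Let Reg q p : complex.Re (g q p) = (complex.Re (ker1 q.1 p.1) * complex.Re (ker1 q.2 p.2) -
  complex.Im (ker1 q.1 p.1) * complex.Im (ker1 q.2 p.2)) * m p.
Proof. by rewrite /g ker2E cRe_scale cReM. Qed.

Let Img q p : complex.Im (g q p) = (complex.Re (ker1 q.1 p.1) * complex.Im (ker1 q.2 p.2) +
  complex.Im (ker1 q.1 p.1) * complex.Re (ker1 q.2 p.2)) * m p.
Proof. by rewrite /g ker2E cIm_scale cImM. Qed.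

Lemma plane_square_integrable x y :
  square_integrable leb2 (fun p => ker2 x y p * (m p)%:C).
Proof.
have mR z : measurable_fun [set: R * R] (fun p : R * R => complex.Re (ker1 z p.1)).
  by apply: measurableT_comp (measurable_Re_ker1 z) _; exact: measurable_fst.
have mR' z : measurable_fun [set: R * R] (fun p : R * R => complex.Re (ker1 z p.2)).
  by apply: measurableT_comp (measurable_Re_ker1 z) _; exact: measurable_snd.
have mI z : measurable_fun [set: R * R] (fun p : R * R => complex.Im (ker1 z p.1)).
  by apply: measurableT_comp (measurable_Im_ker1 z) _; exact: measurable_fst.
have mI' z : measurable_fun [set: R * R] (fun p : R * R => complex.Im (ker1 z p.2)).
  by apply: measurableT_comp (measurable_Im_ker1 z) _; exact: measurable_snd.
have mRe : measurable_fun [set: R * R] (fun p => complex.Re (g (x, y) p)).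
  rewrite (funext (Reg (x, y))); apply: measurable_funM; last exact: mm.
  by apply: measurable_funB; apply: measurable_funM; [exact: mR|exact: mR'|exact: mI|exact: mI'].
have mIm : measurable_fun [set: R * R] (fun p => complex.Im (g (x, y) p)).
  rewrite (funext (Img (x, y))); apply: measurable_funM; last exact: mm.
  by apply: measurable_funD; apply: measurable_funM; [exact: mR|exact: mI'|exact: mI|exact: mR'].
split=> //.
- have /integrableP[_] := kappa_int x y.
  apply: le_lt_trans; rewrite le_eqVlt; apply/orP; left; apply/eqP.
  apply: eq_integral => p _; 
  have K : 0 <= kappa x p.1 * kappa y p.2 * m p ^+ 2.
    by apply: mulr_ge0; [apply: mulr_ge0; exact: kappa_ge0|exact: sqr_ge0].
  rewrite [RHS]/= (ger0_norm K).
  rewrite /sqnormc (Reg (x, y)) (Img (x, y)) -!sqnormc_ker1 /sqnormc/=.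
  by congr (_%:E); ring.
Qed.

Lemma plane_re_inner q q' :
  \int[leb2]_p (complex.Re (g q p) * complex.Re (g q' p) + complex.Im (g q p) * complex.Im (g q' p)) =
  field_kernel (plane_variogram (fun p => m p ^+ 2)) q.1 q.2 q'.1 q'.2.
Proof.
have [iA <-] := Rintegral_field_kernel q.1 q.2 q'.1 q'.2 kappa_int.
have iG := integrable_re_inner (plane_square_integrable q.1 q.2) (plane_square_integrable q'.1 q'.2).
(* [c1] and [c2] are the imaginary parts of [ker1] times a conjugate, one in each variable. Their
   product is what the real part for the plane kernels contains besides the product of the two
   polarizations, and [c1] is odd. *)
pose c1 u := complex.Im (ker1 q.1 u) * complex.Re (ker1 q'.1 u) - complex.Re (ker1 q.1 u) * complex.Im (ker1 q'.1 u).
pose c2 u := complex.Im (ker1 q.2 u) * complex.Re (ker1 q'.2 u) - complex.Re (ker1 q.2 u) * complex.Im (ker1 q'.2 u).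
pose C (p : R * R) := c1 p.1 * (c2 p.2 * m p ^+ 2).
have c1N u : c1 (- u) = - c1 u.
  by rewrite /c1 !Re_ker1 !Im_ker1 !mulNr !sinN !cosN !invrN; ring.
have GC p : complex.Re (g q p) * complex.Re (g q' p) + complex.Im (g q p) * complex.Im (g q' p) =
    1 * field_kernel (fun z w => kappa z p.1 * kappa w p.2 * m p ^+ 2) q.1 q.2 q'.1 q'.2 + -1 * C p.
  have -> : field_kernel (fun z w => kappa z p.1 * kappa w p.2 * m p ^+ 2) q.1 q.2 q'.1 q'.2 =
      polar (kappa ^~ p.1) q.1 q'.1 * polar (kappa ^~ p.2) q.2 q'.2 * m p ^+ 2.
    by rewrite /field_kernel /polar; field.
  by rewrite -!polar_kappa !Reg !Img /C /c1 /c2; ring.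
(* [C] is the difference of two functions already known to be integrable. *)
have iC : leb2.-integrable setT (EFin \o C).
  have [] := Rintegral_lin 1 (-1) iA iG.
  move=> + _; apply: eq_integrable => // p _ /=; congr (_%:E).
  by have := GC p; rewrite /g => ->; ring.
have oC p : C (- p.1, p.2) = - C p.
  by rewrite /C m_even/= c1N mulNr.
have C0 : \int[leb2]_p C p = 0.
  by apply: Rintegral2_odd => //; have /measurable_EFinP := measurable_int _ iC.
under eq_Rintegral do rewrite GC.
by have [_ ->] := Rintegral_lin 1 (-1) iA iC; rewrite C0 mulr0 addr0 mul1r.
Qed.

End plane.
End line_kernels.

Section fields_of_integrals.
Context {R : realType} {d : measure_display} {Omega : measurableType d}.
Variable P : probability Omega R.
Let lam := @lebesgue_measure R.
Let leb2 := (lam \x lam)%E.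

Lemma stochastic_integral_scaled1 {dS : measure_display} {S : measurableType dS}
    (mu : {measure set S -> \bar R}) (W : set S -> Omega -> R[i]) g (X : {RV P >-> R}) :
  stochastic_integral mu P W g X -> scaled_stochastic_integral mu P W 1 g X.
Proof. by move=> H; exists X => //; apply: aeW => w; rewrite mul1r. Qed.

Lemma gaussian_field_ext (V : R -> R -> {RV P >-> R}) v v' :
  gaussian_field V v -> (forall z w, v z w = v' z w) -> gaussian_field V v'.
Proof. by move=> GV vv; rewrite (_ : v' = v)//; apply/funext => z; apply/funext => w; rewrite vv. Qed.

Lemma plane_gaussian_field (W : set (R * R) -> Omega -> R[i]) (m : R * R -> R) k
    (V : R -> R -> {RV P >-> R}) :
  white_noise2 P W -> measurable_fun [set: R * R] m -> (forall p, m (- p.1, p.2) = m p) ->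
  (forall z w : R,
    leb2.-integrable setT (EFin \o (fun p => kappa z p.1 * kappa w p.2 * m p ^+ 2))) ->
  (forall x y, 0 <= x -> 0 <= y ->
    scaled_stochastic_integral leb2 P W k (fun p => ker2 x y p * (m p)%:C) (V x y)) ->
  gaussian_field V (fun z w => k ^+ 2 * plane_variogram (fun p => m p ^+ 2) z w).
Proof.
move=> hW mm me mi HV.
have := scaled_stochastic_integral_kernel hW
  (g := fun (q p : R * R) => ker2 `|q.1| `|q.2| p * (m p)%:C) (a := fun=> k)
  (X := fun q : R * R => V `|q.1| `|q.2|)
  (fun q => plane_square_integrable mm mi `|q.1| `|q.2|)
  (fun q => HV _ _ (normr_ge0 q.1) (normr_ge0 q.2)).
congr gaussian_kernel; apply/funext => q; apply/funext => q'.
rewrite /re_inner (plane_re_inner mm me mi (`|q.1|, `|q.2|) (`|q'.1|, `|q'.2|))/=.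
by rewrite /field_kernel /polar; field.
Qed.

Lemma line_kernel (W1 : set R -> Omega -> R[i]) (e : R) (k : R * R -> R) (X : R * R -> {RV P >-> R})
    (c : R * R -> R) :
  white_noise1 P W1 -> 0 <= 2 * e < 1 ->
  (forall q, scaled_stochastic_integral lam P W1 (k q)
     (fun u => ker1 (c q) u * (`|u| `^ (- e))%:C) (X q)) ->
  gaussian_kernel P (fun q => X q : Omega -> R)
    (fun q q' => k q * k q' * polar (power_variogram (2 * e)) (c q) (c q')).
Proof.
move=> hW e01 HX.
have := scaled_stochastic_integral_kernel hW
  (g := fun q u => ker1 (c q) u * (`|u| `^ (- e))%:C) (a := k) (X := X)
  (fun q => line_square_integrable (c q) e01) HX.
congr gaussian_kernel; apply/funext => q; apply/funext => q'.
by rewrite /re_inner line_re_inner.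
Qed.

(** The deterministic factor contributes [x x'], the polarization of the square function; this is
    the source of the exponent 2 in the first variable. *)
Lemma line_gaussian_field_y (W1 : set R -> Omega -> R[i]) (e k : R) (V : R -> R -> {RV P >-> R}) :
  white_noise1 P W1 -> 0 <= 2 * e < 1 ->
  (forall x y, 0 <= x -> 0 <= y -> scaled_stochastic_integral lam P W1 (x * k)
     (fun u => ker1 y u * (`|u| `^ (- e))%:C) (V x y)) ->
  gaussian_field V (fun z w => z ^+ 2 * (k ^+ 2 * power_variogram (2 * e) w)).
Proof.
move=> hW e01 HV.
have := line_kernel (k := fun q => `|q.1| * k) (c := fun q => `|q.2|)
  (X := fun q => V `|q.1| `|q.2|) hW e01 (fun q => HV _ _ (normr_ge0 q.1) (normr_ge0 q.2)).
congr gaussian_kernel; apply/funext => q; apply/funext => q'.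
by rewrite /field_kernel /polar; field.
Qed.

Lemma line_gaussian_field_x (W1 : set R -> Omega -> R[i]) (e k : R) (V : R -> R -> {RV P >-> R}) :
  white_noise1 P W1 -> 0 <= 2 * e < 1 ->
  (forall x y, 0 <= x -> 0 <= y -> scaled_stochastic_integral lam P W1 (y * k)
     (fun u => ker1 x u * (`|u| `^ (- e))%:C) (V x y)) ->
  gaussian_field V (fun z w => (k ^+ 2 * power_variogram (2 * e) z) * w ^+ 2).
Proof.
move=> hW e01 HV.
have := line_kernel (k := fun q => `|q.2| * k) (c := fun q => `|q.1|)
  (X := fun q => V `|q.1| `|q.2|) hW e01 (fun q => HV _ _ (normr_ge0 q.1) (normr_ge0 q.2)).
congr gaussian_kernel; apply/funext => q; apply/funext => q'.
by rewrite /field_kernel /polar; field.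
Qed.

End fields_of_integrals.

Section product_weights.
Context {R : realType}.
Let lam := @lebesgue_measure R.
Let leb2 := (lam \x lam)%E.

Lemma integrable2_prod (f g : R -> R) :
  lam.-integrable setT (EFin \o f) -> lam.-integrable setT (EFin \o g) ->
  (forall x, 0 <= f x) -> (forall x, 0 <= g x) ->
  leb2.-integrable setT (EFin \o (fun p => f p.1 * g p.2)) /\
  \int[leb2]_p (f p.1 * g p.2) = \int[lam]_x f x * \int[lam]_x g x.
Proof.
move=> fi gi f0 g0.
have mf : measurable_fun [set: R] f by have /measurable_EFinP := measurable_int _ fi.
have mg : measurable_fun [set: R] g by have /measurable_EFinP := measurable_int _ gi.
have E := ge0_integral2_prod mf mg f0 g0.
have ff : (\int[lam]_x (f x)%:E)%E \is a fin_num by exact: integrable_fin_num fi.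
have gf : (\int[lam]_x (g x)%:E)%E \is a fin_num by exact: integrable_fin_num gi.
split; last by rewrite /Rintegral E fineM.
apply: integrable_nonneg.
- by apply: measurable_funM; apply: measurableT_comp.
- by move=> p; rewrite mulr_ge0.
- by rewrite E -(fineK ff) -(fineK gf) -EFinM; exact: ltry.
Qed.

(** An absent weight is regarded as a power of exponent 0, which is 1 at the origin too, so that
    both one-sided weights are instances of [kappa_prod_integrable]. *)
Let weight0 (u : R) : `|u| `^ (- 0) = 1. Proof. by rewrite oppr0 powRr0. Qed.

Lemma kappa_prod_integrable (a b z w : R) : 0 <= a < 1 -> 0 <= b < 1 ->
  leb2.-integrable setT (EFin \o (fun p => kappa z p.1 * kappa w p.2 * (`|p.1| `^ (- a) * `|p.2| `^ (- b)))) /\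
  plane_variogram (fun p => `|p.1| `^ (- a) * `|p.2| `^ (- b)) z w =
  power_variogram a z * power_variogram b w.
Proof.
move=> a01 b01.
have k0 x e (u : R) : 0 <= kappa x u * `|u| `^ (- e).
  by apply: mulr_ge0; [exact: kappa_ge0|exact: powR_ge0].
have [i E] := integrable2_prod (kappa_powR_integrable z a01) (kappa_powR_integrable w b01)
  (k0 z a) (k0 w b).
split; first by apply: eq_integrable i => // p _ /=; rewrite mulrACA.
by rewrite /power_variogram -E; apply: eq_Rintegral => p _; rewrite mulrACA.
Qed.

Lemma plane_weight1 (e z w : R) : 0 <= 2 * e < 1 ->
  leb2.-integrable setT (EFin \o (fun p => kappa z p.1 * kappa w p.2 * (`|p.1| `^ (- e)) ^+ 2)) /\
  plane_variogram (fun p => (`|p.1| `^ (- e)) ^+ 2) z w =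
  power_variogram (2 * e) z * power_variogram 0 w.
Proof.
move=> e01; have O01 : 0 <= (0 : R) < 1 by rewrite lexx ltr01.
have [i E] := kappa_prod_integrable z w e01 O01.
split; first by apply: eq_integrable i => // p _ /=; rewrite weight0 mulr1 normr_powRX2.
by rewrite -E; apply: eq_Rintegral => p _; rewrite weight0 mulr1 normr_powRX2.
Qed.

Lemma plane_weight2 (e z w : R) : 0 <= 2 * e < 1 ->
  leb2.-integrable setT (EFin \o (fun p => kappa z p.1 * kappa w p.2 * (`|p.2| `^ (- e)) ^+ 2)) /\
  plane_variogram (fun p => (`|p.2| `^ (- e)) ^+ 2) z w =
  power_variogram 0 z * power_variogram (2 * e) w.
Proof.
move=> e01; have O01 : 0 <= (0 : R) < 1 by rewrite lexx ltr01.
have [i E] := kappa_prod_integrable z w O01 e01.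
split; first by apply: eq_integrable i => // p _ /=; rewrite weight0 mul1r normr_powRX2.
by rewrite -E; apply: eq_Rintegral => p _; rewrite weight0 mul1r normr_powRX2.
Qed.

End product_weights.

(** * The spectral density of [V_gamma0] *)

Section power_inequalities.
Context {R : realType}.

(** The weighted geometric mean is at most the larger of the two numbers, hence at most their
    sum. *)
Lemma powR_weighted_le (A B t : R) : 0 < A -> 0 < B -> 0 < t < 1 ->
  A `^ (1 - t) * B `^ t <= A + B.
Proof.
move=> A0 B0 /andP[t0 t1].
have D (x : R) : 0 < x -> x `^ (1 - t) * x `^ t = x.
  move=> x0; rewrite -powRD; last by rewrite (lt0r_neq0 x0) implybT.
  by rewrite subrK powRr1// ltW.
have M (x y e : R) : 0 < x -> 0 <= e -> x <= y -> x `^ e <= y `^ e.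
  by move=> x0 e0 xy; apply: ge0_ler_powR => //; rewrite nnegrE; [exact: ltW|exact: le_trans (ltW x0) xy].
have [AB|AB] := leP A B.
- apply: (@le_trans _ _ B); last by rewrite lerDr ltW.
  by rewrite -[leRHS]D// ler_wpM2r ?powR_ge0// M// subr_ge0 ltW.
- apply: (@le_trans _ _ A); last by rewrite lerDl ltW.
  by rewrite -[leRHS]D// ler_wpM2l ?powR_ge0// M// ltW.
Qed.

Lemma normr_half_powR (x e : R) : x != 0 -> 0 < e -> 0 < `|2^-1 * x| `^ e < `|x| `^ e.
Proof.
move=> x0 e0; have n0 : 0 < `|x| by rewrite normr_gt0.
have E : `|2^-1 * x| = 2^-1 * `|x| by rewrite normrM ger0_norm.
rewrite E powR_gt0/=; last by rewrite mulr_gt0.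
by apply: gt0_ltr_powR => //; rewrite ?nnegrE; lra.
Qed.

Lemma powR_weightedE (x y c : R) (b t e : R) : 0 <= x -> 0 <= y -> 0 <= c ->
  ((x `^ 2) `^ (1 - t) * (c * y `^ b) `^ t) `^ e =
  x `^ (2 * ((1 - t) * e)) * (c `^ (t * e) * y `^ (b * (t * e))).
Proof.
move=> x0 y0 c0.
rewrite powRM ?powR_ge0//; congr (_ * _).
  by rewrite -(powRrM (x `^ 2)) -(powRrM x).
by rewrite -(powRrM (c * _)) powRM ?powR_ge0// -(powRrM y).
Qed.

(* [(A + b)(a + B) - (a + b)(A + B) = (A - a)(B - b) > 0], so that the four values
   [p, q, r, s] of the decreasing multiplicative function satisfy [q r < p s] with
   [q, r < p], whence [p (p + s - q - r) > (p - q) (p - r)]. *)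
Lemma powRN_mixed_difference_gt0 (k a A b B : R) : 0 < k -> 0 < a < A -> 0 < b < B ->
  0 < (a + b) `^ (- k) - (A + b) `^ (- k) - (a + B) `^ (- k) + (A + B) `^ (- k).
Proof.
move=> k0 /andP[a0 aA] /andP[b0 bB].
have lt x y : 0 < x -> x < y -> y `^ (- k) < x `^ (- k).
  move=> x0 xy; have y0 := lt_trans x0 xy.
  rewrite !powRN ltf_pV2 ?posrE ?powR_gt0//.
  by apply: gt0_ltr_powR => //; rewrite nnegrE ltW.
have ab0 : 0 < a + b by lra. have AB0 : 0 < A + B by lra.
have Ab0 : 0 < A + b by lra. have aB0 : 0 < a + B by lra.
have PQ : (A + b) `^ (- k) < (a + b) `^ (- k) by apply: lt => //; lra.
have PT : (a + B) `^ (- k) < (a + b) `^ (- k) by apply: lt => //; lra.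
have PS : (A + b) `^ (- k) * (a + B) `^ (- k) < (a + b) `^ (- k) * (A + B) `^ (- k).
  rewrite -!powRM ?(ltW ab0) ?(ltW AB0) ?(ltW Ab0) ?(ltW aB0)//.
  by apply: lt; [rewrite mulr_gt0|nra].
have P0 : 0 < (a + b) `^ (- k) by exact: powR_gt0.
move: PQ PT PS P0; set p := (a + b) `^ _; set q := (A + b) `^ _.
set r := (a + B) `^ _; set s := (A + B) `^ _ => PQ PT PS P0.
by rewrite -(pmulr_rgt0 _ P0); nra.
Qed.

End power_inequalities.

Section plane_scaling.
Context {R : realType}.
Let lam := @lebesgue_measure R.
Let leb2 := (lam \x lam)%E.

Lemma integrable2_scale (f : R * R -> R) (a b : R) : 0 < a -> 0 < b ->
  leb2.-integrable setT (EFin \o f) -> (forall p, 0 <= f p) ->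
  leb2.-integrable setT (EFin \o (fun p => f (a * p.1, b * p.2))) /\
  \int[leb2]_p f p = a * b * \int[leb2]_p f (a * p.1, b * p.2).
Proof.
move=> a0 b0 fi f0.
have mE := measurable_int _ fi.
have mf : measurable_fun [set: R * R] f by exact/measurable_EFinP.
have ms : measurable_fun [set: R * R] (fun p : R * R => (a * p.1, b * p.2)%R).
  by apply/measurable_fun_pairP; split; apply: measurable_funM.
have E := @ge0_integral2_scale _ (EFin \o f) a b a0 b0 mE (fun p => f0 p).
have fF : (\int[leb2]_p (f p)%:E)%E \is a fin_num by exact: integrable_fin_num fi.
have ab0 : 0 < a * b by rewrite mulr_gt0.
have lt : (\int[leb2]_p (f (a * p.1, b * p.2)%R)%:E < +oo)%E.
  rewrite ltNge leye_eq; apply/negP => /eqP I.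
  by move: fF; rewrite [X in X \is a fin_num]E /= I gt0_muley ?lte_fin.
have i : leb2.-integrable setT (EFin \o (fun p => f (a * p.1, b * p.2))).
  by apply: integrable_nonneg => //; exact: measurableT_comp mf ms.
split=> //.
have gF : (\int[leb2]_p (f (a * p.1, b * p.2)%R)%:E)%E \is a fin_num by exact: integrable_fin_num i.
by rewrite /Rintegral [X in fine X]E fineM.
Qed.

Lemma integrable2_scale_eq (f g : R * R -> R) (a b k : R) : 0 < a -> 0 < b -> k != 0 ->
  leb2.-integrable setT (EFin \o f) -> (forall p, 0 <= f p) ->
  (forall p, f (a * p.1, b * p.2) = k * g p) ->
  leb2.-integrable setT (EFin \o g) /\
  \int[leb2]_p f p = a * b * k * \int[leb2]_p g p.
Proof.
move=> a0 b0 k0 fi f0 fg; have [i ->] := integrable2_scale a0 b0 fi f0.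
have gi : leb2.-integrable setT (EFin \o g).
  have := integrableZl measurableT k^-1 i.
  by apply: eq_integrable => // p _; rewrite /= -EFinM fg mulrA mulVf// mul1r.
split=> //; under eq_Rintegral do rewrite fg.
by rewrite (RintegralZl k measurableT gi) mulrA.
Qed.

End plane_scaling.

Section spectral_density.
Context {R : realType}.
Variables H1 H2 c : R.
Hypotheses (hH1 : 0 < H1) (hH2 : 0 < H2) (hH : H1 * H2 < H1 + H2) (hc : 0 < c).
Let lam := @lebesgue_measure R.
Let leb2 := (lam \x lam)%E.
Notation h := (h H1 H2 c).
Let b := 2 * H2 / H1.

Let b0 : 0 < b. Proof. by rewrite divr_gt0// mulr_gt0. Qed.

Let hE p : h p = (`|p.1| `^ 2 + c * `|p.2| `^ b) `^ (- (H1 / 2)). Proof. by []. Qed.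

Lemma h_ge0 p : 0 <= h p. Proof. exact: powR_ge0. Qed.

Lemma h_evenl p : h (- p.1, p.2) = h p. Proof. by rewrite !hE/= normrN. Qed.

Lemma measurable_h : measurable_fun [set: R * R] h.
Proof.
apply: measurableT_comp (measurable_powR _) _; apply: measurable_funD.
  by apply: measurableT_comp (measurable_normr_powR 2) _; exact: measurable_fst.
apply: measurable_funM => //.
by apply: measurableT_comp (measurable_normr_powR b) _; exact: measurable_snd.
Qed.

(** The common exponent of the two factors in the bound of [h]; it is below 1 exactly when
    [H1 * H2 < H1 + H2]. *)
Let a := H1 * H2 / (H1 + H2).

Let a01 : 0 <= a < 1.
Proof.
have s0 : 0 < H1 + H2 by rewrite addr_gt0.
by rewrite /a ltr_pdivrMr// mul1r hH andbT divr_ge0 ?mulr_ge0 ?ltW.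
Qed.

Lemma h_le p : p.1 != 0 -> p.2 != 0 ->
  h p <= c `^ (- (H1 ^+ 2 / (2 * (H1 + H2)))) * (`|p.1| `^ (- a) * `|p.2| `^ (- a)).
Proof.
move=> p1 p2; have s0 : 0 < H1 + H2 by rewrite addr_gt0.
have n1 : 0 < `|p.1| by rewrite normr_gt0. have n2 : 0 < `|p.2| by rewrite normr_gt0.
have A0 : 0 < `|p.1| `^ 2 by exact: powR_gt0.
have B0 : 0 < c * `|p.2| `^ b by rewrite mulr_gt0// powR_gt0.
(* The weight for which [|p.1|] and [|p.2|] receive the same exponent [- a]. *)
pose t := H1 / (H1 + H2).
have t01 : 0 < t < 1.
  by rewrite divr_gt0//= ltr_pdivrMr// mul1r ltrDl.
have W := powR_weighted_le A0 B0 t01.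
have W0 : 0 < (`|p.1| `^ 2) `^ (1 - t) * (c * `|p.2| `^ b) `^ t by rewrite mulr_gt0// powR_gt0.
have k0 : 0 <= H1 / 2 by rewrite divr_ge0// ltW.
apply: (@le_trans _ _ (((`|p.1| `^ 2) `^ (1 - t) * (c * `|p.2| `^ b) `^ t) `^ (- (H1 / 2)))).
  rewrite hE (powRN (_ + _)) (powRN (_ * _)) lef_pV2 ?posrE ?powR_gt0 ?addr_gt0//.
  by apply: ge0_ler_powR => //; rewrite nnegrE ltW// addr_gt0.
rewrite le_eqVlt; apply/orP; left; apply/eqP.
rewrite (powR_weightedE b t _ (normr_ge0 _) (normr_ge0 _) (ltW hc)).
have -> : 2 * ((1 - t) * - (H1 / 2)) = - a by rewrite /t /a; field; rewrite gt_eqF.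
have -> : b * (t * - (H1 / 2)) = - a by rewrite /t /a /b; field; rewrite !gt_eqF.
have -> : t * - (H1 / 2) = - (H1 ^+ 2 / (2 * (H1 + H2))) by rewrite /t; field; rewrite gt_eqF.
ring.
Qed.

Lemma kappa_h_integrable (z w : R) :
  leb2.-integrable setT (EFin \o (fun p => kappa z p.1 * kappa w p.2 * h p)).
Proof.
pose C := c `^ (- (H1 ^+ 2 / (2 * (H1 + H2)))).
have := integrableZl measurableT C (kappa_prod_integrable z w a01 a01).1.
apply: le_integrable => //.
  apply/measurable_EFinP; apply: measurable_funM measurable_h.
  apply: measurable_funM.
  - by apply: measurableT_comp (measurable_kappa z) _; exact: measurable_fst.
  - by apply: measurableT_comp (measurable_kappa w) _; exact: measurable_snd.
move=> p _ /=; rewrite lee_fin.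
have kk : 0 <= kappa z p.1 * kappa w p.2 by apply: mulr_ge0; exact: kappa_ge0.
have L : 0 <= kappa z p.1 * kappa w p.2 * h p by apply: mulr_ge0 => //; exact: h_ge0.
have K : 0 <= C * (kappa z p.1 * kappa w p.2 * (`|p.1| `^ (- a) * `|p.2| `^ (- a))).
  apply: mulr_ge0; first exact: powR_ge0.
  by apply: mulr_ge0 => //; apply: mulr_ge0; exact: powR_ge0.
rewrite (ger0_norm L) (ger0_norm K).
(* On the axes [h_le] does not apply, but there one of the factors [kappa] vanishes. *)
have [p1|p1] := eqVneq p.1 0; first by rewrite p1 !kappar0 !mul0r mulr0.
have [p2|p2] := eqVneq p.2 0; first by rewrite p2 !kappar0 mulr0 !mul0r mulr0.
by rewrite (mulrCA C); exact: (ler_wpM2l kk (h_le p1 p2)).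
Qed.

Definition v_gamma0 := plane_variogram h.

Lemma v_gamma0_Nl z w : v_gamma0 (- z) w = v_gamma0 z w.
Proof. by apply: eq_Rintegral => p _; rewrite kappaN. Qed.

Lemma v_gamma0_Nr z w : v_gamma0 z (- w) = v_gamma0 z w.
Proof. by apply: eq_Rintegral => p _; rewrite kappaN. Qed.

Lemma v_gamma0_0r z : v_gamma0 z 0 = 0.
Proof.
rewrite /v_gamma0 /plane_variogram.
by under eq_Rintegral do rewrite kappa0 mulr0 mul0r; rewrite Rintegral_cst// mul0r.
Qed.

Lemma v_gamma0_0l w : v_gamma0 0 w = 0.
Proof.
rewrite /v_gamma0 /plane_variogram.
by under eq_Rintegral do rewrite kappa0 !mul0r; rewrite Rintegral_cst// mul0r.
Qed.

Let integrand_ge0 z w p : 0 <= kappa z p.1 * kappa w p.2 * h p.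
Proof. by apply: mulr_ge0; [apply: mulr_ge0; exact: kappa_ge0|exact: h_ge0]. Qed.

(* The substitution [(p, q) -> (p / z, q / w)]. *)
Lemma v_gamma0_unit_kappa z w : 0 < z -> 0 < w ->
  leb2.-integrable setT (EFin \o (fun p => kappa 1 p.1 * kappa 1 p.2 * h (z^-1 * p.1, w^-1 * p.2))) /\
  v_gamma0 z w = z * w * \int[leb2]_p (kappa 1 p.1 * kappa 1 p.2 * h (z^-1 * p.1, w^-1 * p.2)).
Proof.
move=> z0 w0; have zn := lt0r_neq0 z0; have wn := lt0r_neq0 w0.
have zi : 0 < z^-1 by rewrite invr_gt0. have wi : 0 < w^-1 by rewrite invr_gt0.
have K k (u : R) : k != 0 -> kappa k (k^-1 * u) = k ^+ 2 * kappa 1 u.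
  by move=> kn; have := kappaZ k 1 (k^-1 * u); rewrite mulr1 [k * _]mulrA mulfV// mul1r.
have F p : kappa z (z^-1 * p.1, w^-1 * p.2).1 * kappa w (z^-1 * p.1, w^-1 * p.2).2 *
    h (z^-1 * p.1, w^-1 * p.2) =
    (z * w) ^+ 2 * (kappa 1 p.1 * kappa 1 p.2 * h (z^-1 * p.1, w^-1 * p.2)).
  by rewrite [(_, _).1]/= [(_, _).2]/= !K//; ring.
have k0 : (z * w) ^+ 2 != 0 by rewrite expf_neq0// mulf_neq0.
have [j E] := integrable2_scale_eq zi wi k0 (kappa_h_integrable z w) (integrand_ge0 z w) F.
split; first exact: j.
apply: (etrans E); congr (_ * _); field; by rewrite zn wn.
Qed.

Lemma h_scale (l : R) p : 0 < l -> h (l * p.1, l `^ (H1 / H2) * p.2) = l `^ (- H1) * h p.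
Proof.
move=> l0; have l2 : 0 <= l `^ 2 by exact: powR_ge0.
have H1n := lt0r_neq0 hH1; have H2n := lt0r_neq0 hH2.
rewrite !hE [(_, _).1]/= [(_, _).2]/= !normrM (gtr0_norm l0) (gtr0_norm (powR_gt0 _ l0)).
rewrite !powRM ?powR_ge0 ?(ltW l0)// -(powRrM l).
have -> : H1 / H2 * b = 2 by rewrite /b; field; rewrite H1n H2n.
rewrite (mulrCA c) -mulrDr powRM//; last by rewrite addr_ge0 ?mulr_ge0 ?powR_ge0 ?(ltW hc).
by rewrite -powRrM; congr (_ `^ _ * _); field.
Qed.

Lemma v_gamma0_scaling (l z w : R) : 0 < l ->
  v_gamma0 (l * z) (l `^ (H1 / H2) * w) = (l `^ H_gamma0 H1 H2) ^+ 2 * v_gamma0 z w.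
Proof.
move=> l0; have H2n := lt0r_neq0 hH2.
set g := l `^ (H1 / H2); have g0 : 0 < g by exact: powR_gt0.
have F p : kappa z (l * p.1, g * p.2).1 * kappa w (l * p.1, g * p.2).2 * h (l * p.1, g * p.2) =
    (l `^ (- H1) / (l * g) ^+ 2) * (kappa (l * z) p.1 * kappa (g * w) p.2 * h p).
  rewrite [(_, _).1]/= [(_, _).2]/= h_scale// !kappaZ; field.
  by rewrite (lt0r_neq0 l0) (lt0r_neq0 g0).
have k0 : l `^ (- H1) / (l * g) ^+ 2 != 0.
  by rewrite gt_eqF// divr_gt0 ?powR_gt0// exprn_gt0// mulr_gt0.
have [_ E] := integrable2_scale_eq l0 g0 k0 (kappa_h_integrable z w) (integrand_ge0 z w) F.
have -> : v_gamma0 z w = l * g * (l `^ (- H1) / (l * g) ^+ 2) * v_gamma0 (l * z) (g * w).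
  exact: E.
(* Twice the exponent is [1 + H1 / H2 + H1]: the first two terms come from the kernels and the
   Jacobian, the last one from the degree of [h]. *)
have -> : (l `^ H_gamma0 H1 H2) ^+ 2 = l * g * l `^ H1.
  rewrite -powR_mulrn ?powR_ge0// -powRrM -[X in _ = X * _ * _]powRr1 ?ltW//.
  rewrite -!powRD ?(lt0r_neq0 l0) ?implybT//; congr (_ `^ _).
  by rewrite /H_gamma0; field.
rewrite powRN; have := powR_gt0 H1 l0; set lh := l `^ H1 => lh0.
by field; rewrite (lt0r_neq0 l0) (lt0r_neq0 g0) (lt0r_neq0 lh0).
Qed.

Lemma square01_measure_gt0 : (0 < leb2 (`]0%R, 1%R[ `*` `]0%R, 1%R[))%E.
Proof.
by rewrite /leb2 product_measure1E//; apply: mule_gt0; exact: itv01_measure_gt0.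
Qed.

Lemma square01_measurable : measurable (`]0, 1[ `*` `]0, 1[ : set (R * R)).
Proof. by apply: measurableX. Qed.

(** After the substitution of [v_gamma0_unit_kappa], the factors [z w] are 4, 2, 2, 1 and complement
    the coefficients 1, -2, -2, 4. What remains is 4 times the integral, against the same [kappa]
    factors, of the mixed difference of [h] between halved and full coordinates. *)
Lemma v_gamma0_mixed_difference :
  v_gamma0 2 2 - 2 * v_gamma0 1 2 - 2 * v_gamma0 2 1 + 4 * v_gamma0 1 1 != 0.
Proof.
pose G (z w : R) p := kappa 1 p.1 * kappa 1 p.2 * h (z^-1 * p.1, w^-1 * p.2).
have i1 (z w : R) : 0 < z -> 0 < w -> leb2.-integrable setT (EFin \o G z w).
  by move=> z0 w0; exact: (v_gamma0_unit_kappa z0 w0).1.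
have E1 (z w : R) : 0 < z -> 0 < w -> v_gamma0 z w = z * w * \int[leb2]_p G z w p.
  by move=> z0 w0; exact: (v_gamma0_unit_kappa z0 w0).2.
have o0 : 0 < (1 : R) by []. have t0 : 0 < (2 : R) by [].
have [j1 F1] := Rintegral_lin 1 (-1) (i1 2 2 t0 t0) (i1 1 2 o0 t0).
have [j2 F2] := Rintegral_lin (-1) 1 (i1 2 1 t0 o0) (i1 1 1 o0 o0).
have [j F] := Rintegral_lin 1 1 j1 j2.
have -> : v_gamma0 2 2 - 2 * v_gamma0 1 2 - 2 * v_gamma0 2 1 + 4 * v_gamma0 1 1 =
    4 * \int[leb2]_p (1 * (1 * G 2 2 p + -1 * G 1 2 p) + 1 * (-1 * G 2 1 p + 1 * G 1 1 p)).
  have e22 := E1 2 2 t0 t0. have e12 := E1 1 2 o0 t0. have e21 := E1 2 1 t0 o0.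
  have e11 := E1 1 1 o0 o0.
  clear E1; clearbody G; rewrite F F1 F2 e22 e12 e21 e11.
  move: (\int[leb2]_p G 2 2 p) (\int[leb2]_p G 1 2 p) (\int[leb2]_p G 2 1 p) (\int[leb2]_p G 1 1 p).
  by move=> x1 x2 x3 x4; ring.
have D p : 1 * (1 * G 2 2 p + -1 * G 1 2 p) + 1 * (-1 * G 2 1 p + 1 * G 1 1 p) =
    kappa 1 p.1 * kappa 1 p.2 * (h (2^-1 * p.1, 2^-1 * p.2) - h (p.1, 2^-1 * p.2) -
      h (2^-1 * p.1, p.2) + h p).
  have R4 (k x1 x2 x3 x4 : R) : 1 * (1 * (k * x1) + -1 * (k * x2)) + 1 * (-1 * (k * x3) + 1 * (k * x4)) =
    k * (x1 - x2 - x3 + x4) by ring.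
  by rewrite R4 !invr1 !mul1r -surjective_pairing.
have h0 p : p.1 != 0 -> p.2 != 0 -> 0 < h (2^-1 * p.1, 2^-1 * p.2) - h (p.1, 2^-1 * p.2) -
      h (2^-1 * p.1, p.2) + h p.
  move=> p1 p2; rewrite !hE [(_, _).1]/= [(_, _).2]/=.
  have n1 : 0 < `|p.1| by rewrite normr_gt0. have n2 : 0 < `|p.2| by rewrite normr_gt0.
  apply: powRN_mixed_difference_gt0; first by rewrite divr_gt0.
  - exact: normr_half_powR.
  - by have /andP[x y] := normr_half_powR p2 b0; rewrite mulr_gt0//= ltr_pM2l.
rewrite mulf_neq0// gt_eqF//.
apply: (@Rintegral_gt0 _ _ _ leb2 _ (`]0, 1[ `*` `]0, 1[)) => //.
- move=> p; rewrite D.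
  have [p1|p1] := eqVneq p.1 0; first by rewrite p1 kappar0 !mul0r.
  have [p2|p2] := eqVneq p.2 0; first by rewrite p2 kappar0 mulr0 !mul0r.
  by apply: mulr_ge0; [apply: mulr_ge0; exact: kappa_ge0|exact/ltW/h0].
- exact: square01_measurable.
- exact: square01_measure_gt0.
- move=> p [/=]; rewrite !in_itv/= => p01 q01; rewrite D.
  have /andP[p0 _] := p01; have /andP[q0 _] := q01.
  apply: mulr_gt0; last by apply: h0; exact: lt0r_neq0.
  by apply: mulr_gt0; apply: kappa_gt0; rewrite ?ltr01 ?lexx.
Qed.

(** A translation by [s] multiplies the Fourier component of frequency [u] by a phase, whose real
    part is [cos (u s)]. *)
Lemma dpolar_kappa (s u : R) : dpolar (kappa ^~ u) 0 1 s (1 + s) = kappa 1 u * cos (u * s).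
Proof.
have C : cos (u * (1 + s)) + cos (u * (1 - s)) = 2 * (cos u * cos (u * s)).
  by rewrite mulrDr mulrBr mulr1 cosD cosB; ring.
have -> : dpolar (kappa ^~ u) 0 1 s (1 + s) =
    (kappa (1 - s) u + kappa (1 + s) u - kappa s u - kappa s u) / 2.
  rewrite /dpolar !sub0r !kappaN (_ : 1 - (1 + s) = - s) ?kappaN//; ring.
rewrite /kappa mulr1; set k := (u ^+ 2)^-1.
have -> : cos (u * (1 - s)) = 2 * (cos u * cos (u * s)) - cos (u * (1 + s)) by rewrite -C; ring.
by field.
Qed.

Lemma v_gamma0_shift (s t : R) : `|s| + `|t| = 1 ->
  dpolar (fun z => dpolar (v_gamma0 z) 0 1 t (1 + t)) 0 1 s (1 + s) != v_gamma0 1 1.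
Proof.
move=> st.
have [i E] := Rintegral_rect_kernel ((0, 0), (1, 1)) ((s, t), (1 + s, 1 + t)) kappa_h_integrable.
rewrite /rect_kernel/= in i E.
rewrite -E.
have F p : dpolar (fun z => dpolar (fun w => kappa z p.1 * kappa w p.2 * h p) 0 1 t (1 + t)) 0 1 s (1 + s) =
    kappa 1 p.1 * kappa 1 p.2 * h p * (cos (p.1 * s) * cos (p.2 * t)).
  transitivity (dpolar (kappa ^~ p.1) 0 1 s (1 + s) * dpolar (kappa ^~ p.2) 0 1 t (1 + t) * h p).
    by rewrite /dpolar; field.
  by rewrite !dpolar_kappa; ring.
have [j G] := Rintegral_lin 1 (-1) (kappa_h_integrable 1 1) i.
(* The variance minus the covariance: its integrand is [kappa kappa h (1 - cos cos)], which is
   nonnegative, so positivity on one square suffices. *)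
suff : 0 < \int[leb2]_p (1 * (kappa 1 p.1 * kappa 1 p.2 * h p) +
   -1 * dpolar (fun z => dpolar (fun w => kappa z p.1 * kappa w p.2 * h p) 0 1 t (1 + t)) 0 1 s (1 + s)).
  rewrite G; apply: contraTneq => ->.
  by rewrite /v_gamma0 /plane_variogram mul1r mulN1r subrr ltxx.
have s1 : `|s| <= 1 by rewrite -st lerDl.
have t1 : `|t| <= 1 by rewrite -st lerDr.
have D p : 1 * (kappa 1 p.1 * kappa 1 p.2 * h p) +
   -1 * dpolar (fun z => dpolar (fun w => kappa z p.1 * kappa w p.2 * h p) 0 1 t (1 + t)) 0 1 s (1 + s) =
   kappa 1 p.1 * kappa 1 p.2 * h p * (1 - cos (p.1 * s) * cos (p.2 * t)).
  by rewrite F; ring.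
have ncos (x : R) : `|cos x| <= 1 by rewrite ler_norml cos_geN1 cos_le1.
have cc x y : cos x * cos y <= 1 :> R.
  by rewrite (le_trans (ler_norm _))// normrM mulr_ile1.
(* As [|s|] and [|t|] are at most 1, on the unit square the arguments of the cosines have absolute
   value below 1, where the cosine of a nonzero number lies strictly between -1 and 1. One of [s]
   and [t] is nonzero, and the bound on that factor suffices. *)
have c1 x r : 0 < x < 1 -> `|r| <= 1 -> r != 0 -> `|cos (x * r)| < 1 :> R.
  move=> /andP[x0 x1] r1 r0.
  have -> : cos (x * r) = cos `|x * r| by case: (ger0P (x * r)) => _; rewrite ?cosN.
  have y0 : 0 < `|x * r| by rewrite normr_gt0 mulf_neq0// gt_eqF.
  have y1 : `|x * r| < 1.
    by rewrite normrM (gtr0_norm x0); apply: le_lt_trans x1; rewrite ler_piMr// ltW.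
  set y := `|x * r| in y0 y1 *.
  have k0 : 0 < kappa 1 y by apply: kappa_gt0; rewrite ?ltr01 ?lexx ?y0.
  rewrite ltr_norml; apply/andP; split.
    by have := onesub_cos_le y; nra.
  move: k0; rewrite /kappa mulr1 pmulr_lgt0 ?invr_gt0 ?exprn_gt0//; lra.
apply: (@Rintegral_gt0 _ _ _ leb2 _ (`]0, 1[ `*` `]0, 1[)) => //.
- by move=> p; rewrite D; apply: mulr_ge0 => //; rewrite subr_ge0.
- exact: square01_measurable.
- exact: square01_measure_gt0.
- move=> p [/=]; rewrite !in_itv/= => p01 q01; rewrite D.
  have /andP[p0 _] := p01; have /andP[q0 _] := q01.
  have hp : 0 < h p.
    by rewrite hE powR_gt0// addr_gt0// ?mulr_gt0// powR_gt0// normr_gt0 lt0r_neq0.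
  apply: mulr_gt0; first by apply: mulr_gt0 => //; apply: mulr_gt0; apply: kappa_gt0; rewrite ?ltr01 ?lexx.
  rewrite subr_gt0 (le_lt_trans (ler_norm _))// normrM.
  have [s0|s0] := eqVneq s 0.
    have t0 : t != 0.
      by apply: contraTneq isT => t0; move: st; rewrite s0 t0 normr0 addr0 => /eqP; rewrite eq_sym oner_eq0.
    by apply: (@le_lt_trans _ _ `|cos (p.2 * t)|); [rewrite ler_piMl|exact: c1].
  by apply: (@le_lt_trans _ _ `|cos (p.1 * s)|); [rewrite ler_piMr|exact: c1].
Qed.

End spectral_density.

(** * The limit fields *)

Section fbs_fields.
Context {R : realType} {d : measure_display} {Omega : measurableType d}.
Variable P : probability Omega R.
Variables (V : R -> R -> {RV P >-> R}) (k h1 h2 : R).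
Hypotheses (k0 : 0 < k) (h11 : 0 < h1 <= 1) (h21 : 0 < h2 <= 1).
Hypothesis GV : gaussian_field V (fun z w => k ^+ 2 * fbs_variogram h1 h2 z w).

Lemma fbs_field_operator_scaling gamma : operator_scaling V gamma (h1 + gamma * h2).
Proof.
apply: (gaussian_field_operator_scaling GV) => l l0 z w.
have lg : 0 < l `^ gamma by exact: powR_gt0.
rewrite /fbs_variogram !normrM (gtr0_norm l0) (gtr0_norm lg).
have E : (l `^ (h1 + gamma * h2)) ^+ 2 = l `^ (2 * h1) * (l `^ gamma) `^ (2 * h2).
  rewrite -powR_mulrn ?powR_ge0// -!powRrM -powRD; last by rewrite (lt0r_neq0 l0) implybT.
  by congr (_ `^ _); ring.
by rewrite E !powRM ?powR_ge0 ?(ltW l0)//; ring.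
Qed.

Lemma fbs_field_null_on_axes : null_on_axes V.
Proof.
have pos x : 0 < x <= 1 -> 2 * x != 0 :> R by move=> /andP[x0 _]; rewrite mulf_neq0// gt_eqF.
apply: (gaussian_field_null_on_axes _ _ GV) => z; rewrite /fbs_variogram normr0 powR0 ?pos//.
- by rewrite !mulr0.
- by rewrite mul0r mulr0.
Qed.

Lemma fbs_field_independent2 : h2 = 1 / 2 -> independent_increments V (0, 1).
Proof.
move=> h2E; apply: (gaussian_field_independent_axis2 (a := fun z => k ^+ 2 * `|z| `^ (2 * h1))).
apply: (gaussian_field_ext GV) => z w; rewrite /fbs_variogram h2E.
by rewrite (_ : 2 * (1 / 2) = 1) ?powRr1 ?mulrA//; field.
Qed.

Lemma fbs_field_independent1 : h1 = 1 / 2 -> independent_increments V (1, 0).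
Proof.
move=> h1E; apply: (gaussian_field_independent_axis1 (a := fun w => k ^+ 2 * `|w| `^ (2 * h2))).
apply: (gaussian_field_ext GV) => z w; rewrite /fbs_variogram h1E.
by rewrite (_ : 2 * (1 / 2) = 1) ?powRr1 1?mulrCA//; field.
Qed.

Let normr_powR2 (z : R) : `|z| `^ (2 * 1) = z ^+ 2.
Proof. by rewrite mulr1 powR_mulrn// real_normK ?num_real. Qed.

Lemma fbs_field_invariant1 : h1 = 1 -> invariant_increments V (1, 0).
Proof.
move=> h1E; apply: (gaussian_field_invariant_axis1 (a := fun w => k ^+ 2 * `|w| `^ (2 * h2))).
by apply: (gaussian_field_ext GV) => z w; rewrite /fbs_variogram h1E normr_powR2 mulrCA.
Qed.

Lemma fbs_field_invariant2 : h2 = 1 -> invariant_increments V (0, 1).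
Proof.
move=> h2E; apply: (gaussian_field_invariant_axis2 (a := fun z => k ^+ 2 * `|z| `^ (2 * h1))).
by apply: (gaussian_field_ext GV) => z w; rewrite /fbs_variogram h2E normr_powR2 mulrA.
Qed.

End fbs_fields.

Lemma half_index {R : realType} (H : R) : 0 < H -> H < 1 ->
  0 < (H + 1) / 2 <= 1 /\ 0 < (1 : R) / 2 <= 1.
Proof. by move=> H0 H1; split; apply/andP; split; lra. Qed.

Section limit_fields.
Context {R : realType}.
Variables H1 H2 c : R.
Hypotheses (hH1 : 0 < H1) (hH2 : 0 < H2) (hH : H1 * H2 < H1 + H2) (hc : 0 < c).
Let lam := @lebesgue_measure R.
Let leb2 := (lam \x lam)%E.

Lemma exponent_lt1 (H : R) : 0 < H -> H < 1 -> 0 <= 2 * (H / 2) < 1.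
Proof. by move=> H0 Hl; rewrite mulrC divfK// ltW. Qed.

(** Serves [V_+] with [H = H1], [G = H2], and [V_-] with the roles exchanged. The upper bound is
    equivalent to [G * H < G + H], the lower one comes from [1 < H]. *)
Lemma exponent_gt1 (G H : R) : 0 < G -> 1 < H -> G * H < G + H ->
  0 <= 2 * ((H * G - G) / (2 * H)) < 1.
Proof.
move=> G0 Hg GH; have H0 : 0 < H by apply: lt_trans Hg.
have -> : 2 * ((H * G - G) / (2 * H)) = (H * G - G) / H by field; rewrite gt_eqF.
rewrite ltr_pdivrMr// mul1r divr_ge0 ?(ltW H0)//=; [lra|nra].
Qed.

Lemma measurable_sqrt_h : measurable_fun [set: R * R] (fun p => Num.sqrt (h H1 H2 c p)).
Proof.
under eq_fun do rewrite -powR12_sqrt ?h_ge0//.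
by apply: measurableT_comp (measurable_powR _) _; exact: measurable_h.
Qed.

Lemma sqrt_h_sqr p : Num.sqrt (h H1 H2 c p) ^+ 2 = h H1 H2 c p.
Proof. by rewrite sqr_sqrtr// h_ge0. Qed.

Lemma kappa_sqrt_h_integrable (z w : R) :
  leb2.-integrable setT (EFin \o (fun p => kappa z p.1 * kappa w p.2 * Num.sqrt (h H1 H2 c p) ^+ 2)).
Proof.
have := kappa_h_integrable hH1 hH2 hH hc z w.
by apply: eq_integrable => // p _; rewrite /= sqrt_h_sqr.
Qed.

Lemma measurable_weight1 e : measurable_fun [set: R * R] (fun p : R * R => `|p.1| `^ e).
Proof. by apply: measurableT_comp (measurable_normr_powR e) _; exact: measurable_fst. Qed.

Lemma measurable_weight2 e : measurable_fun [set: R * R] (fun p : R * R => `|p.2| `^ e).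
Proof. by apply: measurableT_comp (measurable_normr_powR e) _; exact: measurable_snd. Qed.

Lemma gamma0_well_defined : well_defined_gamma0 H1 H2 c.
Proof. by move=> x y _ _; exact: plane_square_integrable measurable_sqrt_h kappa_sqrt_h_integrable x y. Qed.

Lemma plus_well_defined : well_defined_plus H1 H2.
Proof.
split=> [Hl x y _ _|Hg y _].
  apply: (plane_square_integrable (measurable_weight1 _)) => z w.
  by have [] := plane_weight1 z w (exponent_lt1 hH1 Hl).
by apply: line_square_integrable; apply: exponent_gt1; rewrite // mulrC addrC.
Qed.

Lemma minus_well_defined : well_defined_minus H1 H2.
Proof.
split=> [Hl x y _ _|Hg x _].
  apply: (plane_square_integrable (measurable_weight2 _)) => z w.
  by have [] := plane_weight2 z w (exponent_lt1 hH2 Hl).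
by apply: line_square_integrable; rewrite (mulrC H1); exact: exponent_gt1.
Qed.

Lemma gamma0_field {d : measure_display} {Omega : measurableType d} (P : probability Omega R)
    (W : set (R * R) -> Omega -> R[i]) (V : R -> R -> {RV P >-> R}) :
  white_noise2 P W -> is_V_gamma0 H1 H2 c W V -> gaussian_field V (v_gamma0 H1 H2 c).
Proof.
move=> hW HV.
have := plane_gaussian_field hW measurable_sqrt_h _ kappa_sqrt_h_integrable
  (fun x y x0 y0 => stochastic_integral_scaled1 (HV x y x0 y0)).
move=> /(_ _) G; apply: (gaussian_field_ext (G _)).
  by move=> p; rewrite h_evenl.
move=> z w; rewrite expr1n mul1r.
by apply: eq_Rintegral => p _; rewrite sqrt_h_sqr.
Qed.

Let sqrtK (C : R) : 0 < C -> Num.sqrt C ^+ 2 = C. Proof. by move=> C0; rewrite sqr_sqrtr// ltW. Qed.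

Let O01 : 0 <= (0 : R) < 1. Proof. by rewrite lexx ltr01. Qed.

(** The constant is chosen ahead of the probability space, from spectral integrals at the point 1.
    Its positivity is that of these integrals and, for [H1 > 1], also that of the beta function in
    [rho1]. *)
Lemma plus_field : H1 != 1 -> exists2 k : R, 0 < k &
  forall (d : measure_display) (Omega : measurableType d) (P : probability Omega R)
    (W : set (R * R) -> Omega -> R[i]) (W1 : set R -> Omega -> R[i]) (V : R -> R -> {RV P >-> R}),
  white_noise2 P W -> white_noise1 P W1 -> is_V_plus H1 H2 c W W1 V ->
  gaussian_field V (fun z w => k ^+ 2 *
    fbs_variogram (fbs_index_plus H1 H2).1 (fbs_index_plus H1 H2).2 z w).
Proof.
rewrite neq_lt => /orP[Hl|Hg].
  have e01 := exponent_lt1 hH1 Hl.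
  have C0 : 0 < power_variogram (2 * (H1 / 2)) 1 * power_variogram 0 1 :> R.
    by rewrite mulr_gt0// power_variogram_gt0.
  exists (Num.sqrt (power_variogram (2 * (H1 / 2)) 1 * power_variogram 0 1)); first by rewrite sqrtr_gt0.
  move=> d Omega P W W1 V hW _ HV.
  have G := plane_gaussian_field hW (measurable_weight1 (- (H1 / 2)))
    (fun p => congr1 (fun x => x `^ _) (normrN p.1)) (fun z w => (plane_weight1 z w e01).1)
    (fun x y x0 y0 => stochastic_integral_scaled1 ((HV x y x0 y0).1 Hl)).
  apply: (gaussian_field_ext G) => z w.
  rewrite (plane_weight1 z w e01).2 expr1n mul1r sqrtK// /fbs_variogram /fbs_index_plus Hl.
  rewrite (power_variogramE z e01) (power_variogramE w O01) [(_, _).1]/= [(_, _).2]/=.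
  have -> : 2 * ((H1 + 1) / 2) = 1 + 2 * (H1 / 2) by field.
  have -> : 2 * (1 / 2) = 1 + 0 :> R by field.
  ring.
have e01 : 0 <= 2 * ((H1 * H2 - H2) / (2 * H1)) < 1 by apply: exponent_gt1; rewrite // mulrC addrC.
set e := (H1 * H2 - H2) / (2 * H1) in e01.
pose k := rho1 H1 * c `^ ((1 - H1) / 4).
have k0 : 0 < k.
  rewrite mulr_gt0 ?powR_gt0// sqrtr_gt0 betaR_gt0//.
  by rewrite divr_gt0// subr_gt0.
have C0 : 0 < k ^+ 2 * power_variogram (2 * e) 1 by rewrite mulr_gt0 ?exprn_gt0// power_variogram_gt0.
exists (Num.sqrt (k ^+ 2 * power_variogram (2 * e) 1)); first by rewrite sqrtr_gt0.
move=> d Omega P W W1 V _ hW HV.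
have HV' x y (x0 : 0 <= x) (y0 : 0 <= y) : scaled_stochastic_integral lam P W1 (x * k)
    (fun u => ker1 y u * (`|u| `^ (- e))%:C) (V x y).
  by have := (HV x y x0 y0).2 Hg; rewrite -mulrA.
apply: (gaussian_field_ext (line_gaussian_field_y hW e01 HV')) => z w.
rewrite sqrtK// /fbs_variogram /fbs_index_plus (lt_gtF Hg) [(_, _).1]/= [(_, _).2]/=.
rewrite (power_variogramE w e01) mulr1 powR_mulrn// real_normK ?num_real//.
have -> : 2 * ((1 + H2 - H2 / H1) / 2) = 1 + 2 * e by rewrite /e; field; rewrite gt_eqF.
ring.
Qed.

Lemma minus_field : H2 != 1 -> exists2 k : R, 0 < k &
  forall (d : measure_display) (Omega : measurableType d) (P : probability Omega R)
    (W : set (R * R) -> Omega -> R[i]) (W1 : set R -> Omega -> R[i]) (V : R -> R -> {RV P >-> R}),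
  white_noise2 P W -> white_noise1 P W1 -> is_V_minus H1 H2 c W W1 V ->
  gaussian_field V (fun z w => k ^+ 2 *
    fbs_variogram (fbs_index_minus H1 H2).1 (fbs_index_minus H1 H2).2 z w).
Proof.
rewrite neq_lt => /orP[Hl|Hg].
  have e01 := exponent_lt1 hH2 Hl.
  pose k := c `^ (- (H1 / 4)).
  have k0 : 0 < k by exact: powR_gt0.
  have C0 : 0 < k ^+ 2 * (power_variogram 0 1 * power_variogram (2 * (H2 / 2)) 1).
    by rewrite mulr_gt0 ?exprn_gt0// mulr_gt0// power_variogram_gt0.
  exists (Num.sqrt (k ^+ 2 * (power_variogram 0 1 * power_variogram (2 * (H2 / 2)) 1))).
    by rewrite sqrtr_gt0.
  move=> d Omega P W W1 V hW _ HV.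
  have G := plane_gaussian_field hW (measurable_weight2 (- (H2 / 2)))
    (fun p => erefl) (fun z w => (plane_weight2 z w e01).1)
    (fun x y x0 y0 => (HV x y x0 y0).1 Hl).
  apply: (gaussian_field_ext G) => z w.
  rewrite (plane_weight2 z w e01).2 sqrtK// /fbs_variogram /fbs_index_minus Hl.
  rewrite (power_variogramE z O01) (power_variogramE w e01) [(_, _).1]/= [(_, _).2]/=.
  have -> : 2 * ((H2 + 1) / 2) = 1 + 2 * (H2 / 2) by field.
  have -> : 2 * (1 / 2) = 1 + 0 :> R by field.
  by rewrite -/k; ring.
have e01 : 0 <= 2 * ((H1 * H2 - H1) / (2 * H2)) < 1 by rewrite (mulrC H1); exact: exponent_gt1.
set e := (H1 * H2 - H1) / (2 * H2) in e01.
pose k := rho2 H1 H2 * c `^ (- (H1 / (4 * H2))).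
have k0 : 0 < k.
  rewrite mulr_gt0 ?powR_gt0// sqrtr_gt0 mulr_gt0 ?divr_gt0// betaR_gt0// ?divr_gt0 ?mulr_gt0//.
  by rewrite -[X in _ - X]mulr1 -mulrBr mulr_gt0// subr_gt0.
have C0 : 0 < k ^+ 2 * power_variogram (2 * e) 1 by rewrite mulr_gt0 ?exprn_gt0// power_variogram_gt0.
exists (Num.sqrt (k ^+ 2 * power_variogram (2 * e) 1)); first by rewrite sqrtr_gt0.
move=> d Omega P W W1 V _ hW HV.
have HV' x y (x0 : 0 <= x) (y0 : 0 <= y) : scaled_stochastic_integral lam P W1 (y * k)
    (fun u => ker1 x u * (`|u| `^ (- e))%:C) (V x y).
  by have := (HV x y x0 y0).2 Hg; rewrite -mulrA.
apply: (gaussian_field_ext (line_gaussian_field_x hW e01 HV')) => z w.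
rewrite sqrtK// /fbs_variogram /fbs_index_minus (lt_gtF Hg) [(_, _).1]/= [(_, _).2]/=.
rewrite (power_variogramE z e01) mulr1 powR_mulrn// real_normK ?num_real//.
have -> : 2 * ((1 + H1 - H1 / H2) / 2) = 1 + 2 * e by rewrite /e; field; rewrite gt_eqF.
ring.
Qed.

Lemma fbs_index_plus01 : H1 != 1 ->
  0 < (fbs_index_plus H1 H2).1 <= 1 /\ 0 < (fbs_index_plus H1 H2).2 <= 1.
Proof.
rewrite neq_lt /fbs_index_plus => /orP[Hl|Hg]; [rewrite Hl; exact: half_index|].
rewrite (lt_gtF Hg)/= ltr01 lexx.
have := exponent_gt1 hH2 Hg _; rewrite mulrC addrC => /(_ hH).
have -> : 2 * ((H1 * H2 - H2) / (2 * H1)) = H2 - H2 / H1 by field; rewrite gt_eqF.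
by move=> /andP[? ?]; split=> //; apply/andP; split; lra.
Qed.

Lemma fbs_index_minus01 : H2 != 1 ->
  0 < (fbs_index_minus H1 H2).1 <= 1 /\ 0 < (fbs_index_minus H1 H2).2 <= 1.
Proof.
rewrite neq_lt /fbs_index_minus => /orP[Hl|Hg]; [rewrite Hl; have [? ?] := half_index hH2 Hl; by split|].
rewrite (lt_gtF Hg)/= ltr01 lexx.
have := exponent_gt1 hH1 Hg hH.
have -> : 2 * ((H2 * H1 - H1) / (2 * H2)) = H1 - H1 / H2 by field; rewrite gt_eqF.
by move=> /andP[? ?]; split=> //; apply/andP; split; lra.
Qed.

Lemma H_plusE gamma : H1 != 1 ->
  H_plus H1 H2 gamma = (fbs_index_plus H1 H2).1 + gamma * (fbs_index_plus H1 H2).2.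
Proof.
rewrite neq_lt /H_plus /fbs_index_plus => /orP[Hl|Hg].
  by rewrite Hl/=; field.
by rewrite (lt_gtF Hg)/=; field; rewrite gt_eqF.
Qed.

Lemma H_minusE gamma : H2 != 1 ->
  H_minus H1 H2 gamma = (fbs_index_minus H1 H2).1 + gamma * (fbs_index_minus H1 H2).2.
Proof.
rewrite neq_lt /H_minus /fbs_index_minus => /orP[Hl|Hg].
  by rewrite Hl/=; field.
by rewrite (lt_gtF Hg)/=; field; rewrite gt_eqF.
Qed.

End limit_fields.

Theorem proposition3p1 (R : realType) (H1 H2 c : R)
    (hH1 : 0 < H1) (hH12 : H1 <= H2) (hH : H1 * H2 < H1 + H2) (hc : 0 < c) :
  (well_defined_gamma0 H1 H2 c /\
   (H1 != 1 -> well_defined_plus H1 H2) /\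
   (H2 != 1 -> well_defined_minus H1 H2)) /\
  exists kp km : R, 0 < kp /\ 0 < km /\
  forall (d : measure_display) (Omega : measurableType d)
    (P : probability Omega R)
    (W : set (R * R) -> Omega -> R[i]) (W1 : set R -> Omega -> R[i])
    (Vg Vp Vm : R -> R -> {RV P >-> R}),
  white_noise2 P W -> white_noise1 P W1 ->
  is_V_gamma0 H1 H2 c W Vg ->
  is_V_plus H1 H2 c W W1 Vp ->
  is_V_minus H1 H2 c W W1 Vm ->
  (* (i) *)
  ([/\ zero_mean Vg, finite_variance Vg & stationary_increments Vg] /\
   (H1 != 1 ->
     [/\ zero_mean Vp, finite_variance Vp, stationary_increments Vp &
         fdd_scaled_fbs Vp kp (fbs_index_plus H1 H2)]) /\
   (H2 != 1 ->
     [/\ zero_mean Vm, finite_variance Vm, stationary_increments Vm &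
         fdd_scaled_fbs Vm km (fbs_index_minus H1 H2)])) /\
  (* (ii) *)
  (operator_scaling Vg (H1 / H2) (H_gamma0 H1 H2) /\
   (H1 != 1 -> forall gamma : R, 0 < gamma ->
     operator_scaling Vp gamma (H_plus H1 H2 gamma)) /\
   (H2 != 1 -> forall gamma : R, 0 < gamma ->
     operator_scaling Vm gamma (H_minus H1 H2 gamma))) /\
  (* (iii) *)
  ((null_on_axes Vg /\ dependent_increments Vg) /\
   (H1 != 1 -> null_on_axes Vp /\
     along_coordinate_axis (fun l =>
       independent_increments Vp l \/ invariant_increments Vp l)) /\
   (H2 != 1 -> null_on_axes Vm /\
     along_coordinate_axis (fun l =>
       independent_increments Vm l \/ invariant_increments Vm l))).
Proof.
have hH2 : 0 < H2 by exact: lt_le_trans hH12.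
split.
  split; first exact: gamma0_well_defined.
  by split=> _; [exact: plus_well_defined|exact: minus_well_defined].
have [kp kp0 HP] : exists2 kp : R, 0 < kp & H1 != 1 ->
    forall (d : measure_display) (Omega : measurableType d) (P : probability Omega R)
      (W : set (R * R) -> Omega -> R[i]) (W1 : set R -> Omega -> R[i]) (V : R -> R -> {RV P >-> R}),
    white_noise2 P W -> white_noise1 P W1 -> is_V_plus H1 H2 c W W1 V ->
    gaussian_field V (fun z w => kp ^+ 2 *
      fbs_variogram (fbs_index_plus H1 H2).1 (fbs_index_plus H1 H2).2 z w).
  (* At the excluded value the required property is vacuous, and any positive constant will do. *)
  have [E|E] := eqVneq H1 1; first by exists 1.
  by have [kp kp0 HP] := plus_field hH1 hH2 hH hc E; exists kp.
have [km km0 HM] : exists2 km : R, 0 < km & H2 != 1 ->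
    forall (d : measure_display) (Omega : measurableType d) (P : probability Omega R)
      (W : set (R * R) -> Omega -> R[i]) (W1 : set R -> Omega -> R[i]) (V : R -> R -> {RV P >-> R}),
    white_noise2 P W -> white_noise1 P W1 -> is_V_minus H1 H2 c W W1 V ->
    gaussian_field V (fun z w => km ^+ 2 *
      fbs_variogram (fbs_index_minus H1 H2).1 (fbs_index_minus H1 H2).2 z w).
  have [E|E] := eqVneq H2 1; first by exists 1.
  by have [km km0 HM] := minus_field hH1 hH2 hH hc E; exists km.
exists kp, km; split=> //; split=> // d Omega P W W1 Vg Vp Vm hW hW1 HVg HVp HVm.
have GVg := gamma0_field hH1 hH2 hH hc hW HVg.
have GVp E := HP E d Omega P W W1 Vp hW hW1 HVp.
have GVm E := HM E d Omega P W W1 Vm hW hW1 HVm.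
split.
- split; first by split; [exact: gaussian_field_zero_mean GVg|
    exact: gaussian_field_finite_variance GVg|exact: gaussian_field_stationary GVg].
  split=> E.
    have [h11 h21] := fbs_index_plus01 hH1 hH2 hH E.
    split; [exact: gaussian_field_zero_mean (GVp E)|exact: gaussian_field_finite_variance (GVp E)|
      exact: gaussian_field_stationary (GVp E)|].
    by rewrite [fbs_index_plus H1 H2]surjective_pairing; exact: gaussian_field_scaled_fbs (GVp E).
  have [h11 h21] := fbs_index_minus01 hH1 hH2 hH E.
  split; [exact: gaussian_field_zero_mean (GVm E)|exact: gaussian_field_finite_variance (GVm E)|
    exact: gaussian_field_stationary (GVm E)|].
  by rewrite [fbs_index_minus H1 H2]surjective_pairing; exact: gaussian_field_scaled_fbs (GVm E).
- split.
    split; first by apply: (gaussian_field_operator_scaling GVg) => l l0 z w; exact: v_gamma0_scaling.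
    by split=> E gamma _; rewrite ?H_plusE ?H_minusE//;
      [exact: fbs_field_operator_scaling (GVp E) gamma|exact: fbs_field_operator_scaling (GVm E) gamma].
  split.
    split; first exact: (gaussian_field_null_on_axes (@v_gamma0_0r _ H1 H2 c) (@v_gamma0_0l _ H1 H2 c) GVg).
    apply: (gaussian_field_dependent GVg).
    + exact: v_gamma0_Nl.
    + exact: v_gamma0_Nr.
    + exact: v_gamma0_0r.
    + exact: v_gamma0_0l.
    + exact: v_gamma0_mixed_difference.
    + exact: v_gamma0_shift.
  split=> E.
    have [h11 h21] := fbs_index_plus01 hH1 hH2 hH E.
    split; first exact: fbs_field_null_on_axes h11 h21 (GVp E).
    (* For [H1 < 1] the second index is [1 / 2], a Brownian direction; for [H1 > 1] the first index
       is 1, a direction in which the field is linear. *)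
    move: E; rewrite neq_lt => /orP[Hl|Hg].
      right; left; apply: (fbs_field_independent2 (GVp _)); first by rewrite lt_eqF.
      by rewrite /fbs_index_plus Hl.
    left; right; apply: (fbs_field_invariant1 (GVp _)); first by rewrite gt_eqF.
    by rewrite /fbs_index_plus (lt_gtF Hg).
  have [h11 h21] := fbs_index_minus01 hH1 hH2 hH E.
  split; first exact: fbs_field_null_on_axes h11 h21 (GVm E).
  move: E; rewrite neq_lt => /orP[Hl|Hg].
    left; left; apply: (fbs_field_independent1 (GVm _)); first by rewrite lt_eqF.
    by rewrite /fbs_index_minus Hl.
  right; right; apply: (fbs_field_invariant2 (GVm _)); first by rewrite gt_eqF.
  by rewrite /fbs_index_minus (lt_gtF Hg).
Qed.
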